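(* Let $F_2$ be the nonabelian free group of rank two and let $\Gamma_2$ be the fundamental group of a compact (closed, oriented) surface of genus two. Then the groups $\operatorname{Comm}(F_2)$ and $\operatorname{Comm}(\Gamma_2)$ are not isomorphic.
   Context: For a group $G$, the abstract commensurator $\operatorname{Comm}(G)$ is the set of equivalence classes of isomorphisms $\phi:H_1\to H_2$ between finite-index subgroups $H_1,H_2\le G$, where two such isomorphisms are equivalent if they are both defined and equal on a common finite-index subgroup of $G$. It is a group under composition (composition of representatives after restricting to suitable finite-index subgroups). The group $\Gamma_2$ has the presentation $\langle A,B,C,D : [A,B][C,D]\rangle$, where $[X,Y]=XYX^{-1}Y^{-1}$. *)

(* Defs.v *)
From HB Require Import structures.
From mathcomp Require Import all_boot.
From mathcomp Require Import all_classical.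

Set Implicit Arguments.
Unset Strict Implicit.
Unset Printing Implicit Defensive.

Local Open Scope group_scope.
Local Open Scope classical_set_scope.
Local Open Scope quotient_scope.

Definition isomorphic (G H : groupType) : Prop :=
  exists f : {multiplicative G -> H}, bijective f.

Section Presentation.
Variable I : choiceType.

(* The letter (i, false) is the generator i and (i, true) is its inverse. *)
Definition word := seq (I * bool).

Definition gen_word (i : I) : word := [:: (i, false)].
Definition inv_word (w : word) : word := rev [seq (l.1, ~~ l.2) | l <- w].
Definition comm_word (u v : word) : word :=
  u ++ v ++ inv_word u ++ inv_word v.

Variable R : set word.

(* The least congruence on words that cancels inverse letters and kills R. *)
Inductive word_eq : word -> word -> Prop :=
| word_eq_refl w : word_eq w w
| word_eq_sym u v : word_eq u v -> word_eq v u
| word_eq_trans v u w : word_eq u v -> word_eq v w -> word_eq u w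
| word_eq_cat u u' v v' :
    word_eq u u' -> word_eq v v' -> word_eq (u ++ v) (u' ++ v')
| word_eq_cancel i b : word_eq [:: (i, b); (i, ~~ b)] [::]
| word_eq_relator r : R r -> word_eq r [::].

Definition word_eqb : rel word := fun u v => `[< word_eq u v >].

Lemma word_eqb_refl : reflexive word_eqb.
Proof. by move=> w; apply/asboolP; exact: word_eq_refl. Qed.

Lemma word_eqb_sym : symmetric word_eqb.
Proof.
by move=> u v; apply/asboolP/asboolP => h; exact: word_eq_sym.
Qed.

Lemma word_eqb_trans : transitive word_eqb.
Proof.
move=> v u w /asboolP uv /asboolP vw.
by apply/asboolP; exact: word_eq_trans uv vw.
Qed.

Canonical word_equiv := EquivRel word_eqb word_eqb_refl word_eqb_sym
  word_eqb_trans.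

Definition presented := {eq_quot word_eqb}.
HB.instance Definition _ := Choice.on presented.

Definition word_class (w : word) : presented := \pi w.

Lemma word_classP u v : word_class u = word_class v <-> word_eq u v.
Proof.
have e := @eqmodP _ word_equiv u v.
by split=> [/e/asboolP | /asboolP/e].
Qed.

Lemma repr_word_class w : word_eq (repr (word_class w)) w.
Proof. by apply/word_classP; rewrite /word_class reprK. Qed.

Lemma word_classW (x : presented) : exists w, x = word_class w.
Proof. by exists (repr x); rewrite /word_class reprK. Qed.

Lemma inv_word_cat u v : inv_word (u ++ v) = inv_word v ++ inv_word u.
Proof. by rewrite /inv_word map_cat rev_cat. Qed.

Lemma inv_wordK : involutive inv_word.
Proof.
move=> w; rewrite /inv_word map_rev revK -map_comp.
by elim: w => //= -[i b] w ->; rewrite /= negbK.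
Qed.

Lemma word_eq_invl w : word_eq (inv_word w ++ w) [::].
Proof.
elim: w => [|[i b] w IH]; first exact: word_eq_refl.
rewrite -cat1s inv_word_cat -catA.
apply: word_eq_trans IH; apply: word_eq_cat; first exact: word_eq_refl.
rewrite catA -{2}[w]cat0s; apply: word_eq_cat; last exact: word_eq_refl.
by have := word_eq_cancel i (~~ b); rewrite negbK.
Qed.

Lemma word_eq_invr w : word_eq (w ++ inv_word w) [::].
Proof. by have := word_eq_invl (inv_word w); rewrite inv_wordK. Qed.

Lemma word_eq_inv u v : word_eq u v -> word_eq (inv_word u) (inv_word v).
Proof.
move=> uv; rewrite -[inv_word u]cats0.
apply: (@word_eq_trans (inv_word u ++ v ++ inv_word v)).
  by apply: word_eq_cat (word_eq_refl _) _; exact/word_eq_sym/word_eq_invr.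
rewrite catA -{2}[inv_word v]cat0s.
apply: word_eq_cat (word_eq_refl _).
apply: word_eq_trans (word_eq_invl u).
by apply: word_eq_cat (word_eq_refl _) _; exact: word_eq_sym.
Qed.

Definition presented_one : presented := word_class [::].
Definition presented_mul (x y : presented) : presented :=
  word_class (repr x ++ repr y).
Definition presented_inv (x : presented) : presented :=
  word_class (inv_word (repr x)).

Lemma presented_mulE u v :
  presented_mul (word_class u) (word_class v) = word_class (u ++ v).
Proof. by apply/word_classP/word_eq_cat; exact: repr_word_class. Qed.

Lemma presented_invE u : presented_inv (word_class u) = word_class (inv_word u).
Proof. by apply/word_classP/word_eq_inv; exact: repr_word_class. Qed.

Lemma presented_mulA : associative presented_mul.
Proof.
move=> x y z; have [[u ->] [v ->] [w ->]] :=
  And3 (word_classW x) (word_classW y) (word_classW z).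
by rewrite !presented_mulE catA.
Qed.

Lemma presented_mul1g : left_id presented_one presented_mul.
Proof. by move=> x; have [u ->] := word_classW x; rewrite presented_mulE. Qed.

Lemma presented_mulg1 : right_id presented_one presented_mul.
Proof.
by move=> x; have [u ->] := word_classW x; rewrite presented_mulE cats0.
Qed.

Lemma presented_mulVg : left_inverse presented_one presented_inv presented_mul.
Proof.
move=> x; have [u ->] := word_classW x; rewrite presented_invE presented_mulE.
exact/word_classP/word_eq_invl.
Qed.

Lemma presented_mulgV :
  right_inverse presented_one presented_inv presented_mul.
Proof.
move=> x; have [u ->] := word_classW x; rewrite presented_invE presented_mulE.
exact/word_classP/word_eq_invr.
Qed.

HB.instance Definition _ := isGroup.Build presented presented_mulA
  presented_mul1g presented_mulg1 presented_mulVg presented_mulgV.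

Definition generator (i : I) : presented := word_class (gen_word i).

Definition eval_word (H : groupType) (h : I -> H) (w : word) : H :=
  foldr (fun l x => (if l.2 then (h l.1)^-1 else h l.1) * x) 1 w.

Lemma presented_universal (H : groupType) (h : I -> H) :
  (forall r, R r -> eval_word h r = 1) ->
  exists! f : presented -> H,
    {morph f : x y / x * y} /\ forall i, f (generator i) = h i.
Proof.
move=> hR; have evalM u v : eval_word h (u ++ v) = eval_word h u * eval_word h v.
  by elim: u => [|l u IH] /=; rewrite ?mul1g// IH mulgA.
have evalE u v : word_eq u v -> eval_word h u = eval_word h v.
  elim=> [w|a b _ ->|b a c _ -> _ ->|a a' b b' _ aE _ bE|i [] /=|r /hR] //.
  - by rewrite !evalM aE bE.
  - by rewrite mulg1 mulVg.
  - by rewrite mulg1 mulgV.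
have fE w : eval_word h (repr (word_class w)) = eval_word h w.
  exact/evalE/repr_word_class.
exists (fun x : presented => eval_word h (repr x)); split.
  split=> [x y|i]; last by rewrite fE /= mulg1.
  by rewrite fE evalM.
move=> f [fM fi]; apply/funext => x; have [w ->] := word_classW x.
have f1 : f 1 = 1.
  by apply: (@mulgI _ (f 1)); rewrite -fM !mulg1.
rewrite fE; elim: w => [|[i b] w IH] /=; first exact/esym/f1.
have -> : word_class ((i, b) :: w) = word_class [:: (i, b)] * word_class w.
  by rewrite -cat1s -presented_mulE.
rewrite fM -IH; congr (_ * _); case: b => /=; last exact/esym/fi.
have -> : word_class [:: (i, true)] = (generator i)^-1.
  by rewrite [RHS]presented_invE.
apply: (@mulgI _ (h i)); rewrite mulgV -fi -fM mulgV.
exact/esym/f1.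
Qed.

End Presentation.

Definition F2 : groupType := presented (I := 'I_2) set0.

Definition Gamma2_relator : word 'I_4 :=
  let A := gen_word (Ordinal (isT : 0 < 4)) in
  let B := gen_word (Ordinal (isT : 1 < 4)) in
  let C := gen_word (Ordinal (isT : 2 < 4)) in
  let D := gen_word (Ordinal (isT : 3 < 4)) in
  comm_word A B ++ comm_word C D.

Definition Gamma2 : groupType := presented [set Gamma2_relator].

Section FiniteIndex.
Variable G : groupType.
Implicit Types (H K L : set G) (x y : G).

Definition left_coset x H : set G := [set x * h | h in H].

Definition finite_index_subgroup H : Prop :=
  group_closed (mem H) /\ finite_set (range (left_coset ^~ H)).

Lemma subgroup1 H : group_closed (mem H) -> H 1.
Proof. by case=> /set_mem. Qed.

Lemma subgroupM H x y : group_closed (mem H) -> H x -> H y -> H (x * y).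
Proof.
by move=> /group_closedM gH /mem_set Hx /mem_set Hy; apply/set_mem/gH.
Qed.

Lemma subgroupV H x : group_closed (mem H) -> H x -> H x^-1.
Proof. by move=> /group_closedV gH /mem_set Hx; apply/set_mem/gH. Qed.

Lemma group_closedPset H :
  H 1 -> (forall x y, H x -> H y -> H (x / y)) -> group_closed (mem H).
Proof.
move=> H1 HM; split; first exact/mem_set.
by move=> x y /set_mem Hx /set_mem Hy; apply/mem_set/HM.
Qed.

Lemma left_coset_eq H x y : group_closed (mem H) ->
  left_coset x H = left_coset y H <-> H (x^-1 * y).
Proof.
move=> gH; split=> [e|Hxy].
  have : left_coset y H y by exists 1; rewrite ?mulg1//; exact: subgroup1.
  by rewrite -e => -[h Hh <-]; rewrite mulKg.
apply/seteqP; split=> _ [h Hh <-].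
  exists ((x^-1 * y)^-1 * h); last by rewrite invgM invgK !mulgA mulgV mul1g.
  by apply: subgroupM => //; exact: subgroupV.
by exists (x^-1 * y * h); [exact: subgroupM|rewrite !mulgA mulgV mul1g].
Qed.

Lemma finite_index_color H (T : Type) (c : G -> T) : group_closed (mem H) ->
  finite_set (range c) -> (forall x y, c x = c y -> H (x^-1 * y)) ->
  finite_index_subgroup H.
Proof.
move=> gH fc cH; split=> //.
pose F t : set G := [set z | exists2 x, c x = t & left_coset x H z].
suff -> : range (left_coset ^~ H) = F @` range c by exact: finite_image.
have FE x : F (c x) = left_coset x H.
  apply/seteqP; split=> [z [y /esym/cH/(left_coset_eq _ _ gH) ->] //|z xz].
  by exists x.
apply/seteqP; split=> [_ [x _ <-]|_ [_ [x _ <-] <-]].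
  by exists (c x) => //; exists x.
by exists x.
Qed.

Lemma finite_index_subgroupT : finite_index_subgroup setT.
Proof.
apply: (@finite_index_color _ _ (fun=> tt)) => //; exact: group_closedPset.
Qed.

Lemma finite_index_subgroup_preim H L (f : G -> G) :
  {in H &, {morph f : x y / x * y}} -> finite_index_subgroup H ->
  finite_index_subgroup L -> finite_index_subgroup (H `&` f @^-1` L).
Proof.
move=> fM [gH fH] [gL fL].
have fM' x y : H x -> H y -> f (x * y) = f x * f y.
  by move=> /mem_set Hx /mem_set Hy; exact: fM.
have f1 : f 1 = 1.
  have H1 := subgroup1 gH.
  by apply: (@mulgI _ (f 1)); rewrite -fM'// !mulg1.
have fV x : H x -> f x^-1 = (f x)^-1.
  move=> Hx; apply: (@mulgI _ (f x)).
  by rewrite -fM' ?mulgV//; exact: subgroupV.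
have gHL : group_closed (mem (H `&` f @^-1` L)).
  apply: group_closedPset => [|x y [Hx Lx] [Hy Ly]].
    by split; rewrite /= ?f1; exact: subgroup1.
  have HVy := subgroupV gH Hy; split; first exact: subgroupM.
  by rewrite /= fM'// fV//; apply: subgroupM => //; exact: subgroupV.
pose r x := xget 1 (left_coset x H).
have rE x : H ((r x)^-1 * x).
  rewrite /r; case: xgetP => [_ -> [h Hh <-]|/(_ x)[]].
    by rewrite invgM mulgVK; exact: subgroupV.
  by exists 1; rewrite ?mulg1//; exact: subgroup1.
pose c x := (left_coset x H, left_coset (f ((r x)^-1 * x)) L).
apply: (@finite_index_color _ _ c) => //.
  apply: sub_finite_set (finite_setX fH fL) => _ [x _ <-].
  by split=> /=; [exists x | exists (f ((r x)^-1 * x))].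
move=> x y [] xy; have rxy : r x = r y by rewrite /r xy.
have Hx := rE x; have Hy := rE y; rewrite -rxy in Hy *.
move=> /(left_coset_eq _ _ gL); move/(left_coset_eq _ _ gH): xy => Hxy.
rewrite -fV// -fM'//; last exact: subgroupV.
by rewrite invgM invgK !mulgA mulgK.
Qed.

Lemma finite_index_subgroupI H K : finite_index_subgroup H ->
  finite_index_subgroup K -> finite_index_subgroup (H `&` K).
Proof. exact: (@finite_index_subgroup_preim H K id). Qed.

End FiniteIndex.

Section Commensurator.
Variable G : groupType.

(* An isomorphism dom -> cod between finite-index subgroups; the values of the
   underlying function outside dom are irrelevant (see [commensurable]). *)
Record partial_iso := PartialIso {
  piso_dom : set G;
  piso_cod : set G;
  piso_fun :> G -> G;
  piso_domP : finite_index_subgroup piso_dom;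
  piso_codP : finite_index_subgroup piso_cod;
  piso_bij : set_bij piso_dom piso_cod piso_fun;
  pisoM : {in piso_dom &, {morph piso_fun : x y / x * y}} }.

HB.instance Definition _ := gen_eqMixin partial_iso.
HB.instance Definition _ := gen_choiceMixin partial_iso.

Implicit Types p q r : partial_iso.

Definition commensurable p q : Prop :=
  exists K : set G, [/\ finite_index_subgroup K, K `<=` piso_dom p,
    K `<=` piso_dom q & {in K, p =1 q}].

Lemma commensurable_refl p : commensurable p p.
Proof. by exists (piso_dom p); split=> //; exact: piso_domP. Qed.

Lemma commensurable_sym p q : commensurable p q -> commensurable q p.
Proof. by move=> [K [fK Kp Kq pq]]; exists K; split=> // x /pq. Qed.

Lemma commensurable_trans q p r :
  commensurable p q -> commensurable q r -> commensurable p r.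
Proof.
move=> [K [fK Kp Kq pq]] [L [fL Lq Lr qr]]; exists (K `&` L).
split; first exact: finite_index_subgroupI.
- by move=> x [/Kp].
- by move=> x [_ /Lr].
- by move=> x /set_mem [/mem_set Kx /mem_set Lx]; rewrite pq// qr.
Qed.

Definition commensurableb : rel partial_iso := fun p q => `[< commensurable p q >].

Lemma commensurableb_refl : reflexive commensurableb.
Proof. by move=> p; apply/asboolP; exact: commensurable_refl. Qed.

Lemma commensurableb_sym : symmetric commensurableb.
Proof.
by move=> p q; apply/asboolP/asboolP => h; exact: commensurable_sym.
Qed.

Lemma commensurableb_trans : transitive commensurableb.
Proof.
move=> q p r /asboolP pq /asboolP qr.
by apply/asboolP; exact: commensurable_trans pq qr.
Qed.

Canonical commensurable_equiv := EquivRel commensurableb commensurableb_refl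
  commensurableb_sym commensurableb_trans.

Definition Comm := {eq_quot commensurableb}.
HB.instance Definition _ := Choice.on Comm.

Definition comm_class p : Comm := \pi p.

Lemma comm_classP p q : comm_class p = comm_class q <-> commensurable p q.
Proof.
have e := @eqmodP _ commensurable_equiv p q.
by split=> [/e/asboolP | /asboolP/e].
Qed.

Lemma repr_comm_class p : commensurable (repr (comm_class p)) p.
Proof. by apply/comm_classP; rewrite /comm_class reprK. Qed.

Lemma comm_classW (x : Comm) : exists p, x = comm_class p.
Proof. by exists (repr x); rewrite /comm_class reprK. Qed.

Lemma pisoM' p x y :
  piso_dom p x -> piso_dom p y -> p (x * y) = p x * p y.
Proof. by move=> /mem_set px /mem_set py; exact: pisoM. Qed.

Lemma piso_inj p x y : piso_dom p x -> piso_dom p y -> p x = p y -> x = y.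
Proof.
have [_ pI _] := piso_bij p.
by move=> /mem_set px /mem_set py; exact: pI.
Qed.

Lemma piso_im p x : piso_dom p x -> piso_cod p (p x).
Proof. by have [pF _ _] := piso_bij p; exact: pF. Qed.

Lemma piso_id_bij : set_bij [set: G] [set: G] id.
Proof. by split=> // x _; exists x. Qed.

Definition piso_id : partial_iso :=
  PartialIso (@finite_index_subgroupT G) (@finite_index_subgroupT G)
    piso_id_bij (fun _ _ _ _ => erefl).

Section Inverse.
Variable p : partial_iso.

Definition piso_inv_fun (z : G) : G :=
  xget 1 [set x | piso_dom p x /\ p x = z].

Lemma piso_inv_funP z :
  piso_cod p z -> piso_dom p (piso_inv_fun z) /\ p (piso_inv_fun z) = z.
Proof.
have [_ _ pS] := piso_bij p; move=> /pS[x px pxz]; rewrite /piso_inv_fun.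
by case: xgetP => [_ -> //|/(_ x)[]].
Qed.

Lemma piso_funK x : piso_dom p x -> piso_inv_fun (p x) = x.
Proof.
by move=> px; have [? ?] := piso_inv_funP (piso_im px); exact: piso_inj px _.
Qed.

Lemma piso_inv_bij : set_bij (piso_cod p) (piso_dom p) piso_inv_fun.
Proof.
split=> [z /piso_inv_funP[] //|z t /set_mem/piso_inv_funP[_ {2}<-]|x px].
  by move=> /set_mem/piso_inv_funP[_ {2}<-] ->.
by exists (p x); [exact: piso_im|exact: piso_funK].
Qed.

Lemma piso_invM : {in piso_cod p &, {morph piso_inv_fun : x y / x * y}}.
Proof.
move=> z t /set_mem/piso_inv_funP[pz zE] /set_mem/piso_inv_funP[pt tE].
rewrite -{1}zE -{1}tE -pisoM'// piso_funK//; apply: subgroupM => //.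
by case: (piso_domP p).
Qed.

Definition piso_inv : partial_iso :=
  PartialIso (piso_codP p) (piso_domP p) piso_inv_bij piso_invM.

End Inverse.

Section Composition.
Variables p q : partial_iso.

(* p \o q, restricted to the largest subgroup on which it makes sense. *)
Definition piso_comp_dom : set G := piso_dom q `&` q @^-1` piso_dom p.
Definition piso_comp_cod : set G :=
  piso_cod p `&` piso_inv p @^-1` piso_cod q.

Lemma piso_comp_domP : finite_index_subgroup piso_comp_dom.
Proof.
exact: finite_index_subgroup_preim (@pisoM q) (piso_domP q) (piso_domP p).
Qed.

Lemma piso_comp_codP : finite_index_subgroup piso_comp_cod.
Proof.
exact: finite_index_subgroup_preim (@piso_invM p) (piso_codP p) (piso_codP q).
Qed.

Lemma piso_comp_bij : set_bij piso_comp_dom piso_comp_cod (p \o q).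
Proof.
split=> [x [qx pqx]|x y /set_mem[qx pqx] /set_mem[qy pqy] /=|z [pz qz]].
- split; first exact: piso_im.
  by rewrite /= piso_funK//; exact: piso_im.
- by move=> /(piso_inj pqx pqy)/(piso_inj qx qy).
- have [pz' zE] := piso_inv_funP pz; have [qz' zE'] := piso_inv_funP qz.
  exists (piso_inv q (piso_inv p z)) => /=; last by rewrite zE' zE.
  by split=> //=; rewrite zE'.
Qed.

Lemma piso_compM : {in piso_comp_dom &, {morph p \o q : x y / x * y}}.
Proof.
by move=> x y /set_mem[qx pqx] /set_mem[qy pqy] /=; rewrite !pisoM'.
Qed.

Definition piso_comp : partial_iso :=
  PartialIso piso_comp_domP piso_comp_codP piso_comp_bij piso_compM.

End Composition.

Lemma commensurable_comp p p' q q' : commensurable p p' ->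
  commensurable q q' -> commensurable (piso_comp p q) (piso_comp p' q').
Proof.
move=> [K [fK Kp Kp' pp]] [L [fL Lq Lq' qq]].
exists (L `&` q @^-1` K); split.
- apply: finite_index_subgroup_preim => // x y /set_mem Lx /set_mem Ly.
  by apply: pisoM'; exact: Lq.
- by move=> x [Lx Kx]; split; [exact: Lq|exact: Kp].
- move=> x [Lx Kx]; split; first exact: Lq'.
  by rewrite /= -qq; [exact: Kp'|exact: mem_set].
- by move=> x /set_mem[/mem_set Lx /mem_set Kx] /=; rewrite -qq// pp.
Qed.

Lemma commensurable_inv p q :
  commensurable p q -> commensurable (piso_inv p) (piso_inv q).
Proof.
move=> [K [fK Kp Kq pq]].
have h z : piso_cod p z -> K (piso_inv p z) ->
    z = q (piso_inv p z).
  by move=> pz Kz; rewrite -pq ?(piso_inv_funP pz).2//; exact: mem_set.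
exists (piso_cod p `&` piso_inv p @^-1` K); split.
- exact: finite_index_subgroup_preim (@piso_invM p) (piso_codP p) fK.
- by move=> x [].
- by move=> z [pz Kz]; rewrite (h z)//; apply/piso_im/Kq.
- move=> z /set_mem[pz Kz]; rewrite [in RHS](h z)//=.
  by rewrite piso_funK//; exact: Kq.
Qed.

Definition Comm_one : Comm := comm_class piso_id.
Definition Comm_mul (x y : Comm) : Comm :=
  comm_class (piso_comp (repr x) (repr y)).
Definition Comm_inv (x : Comm) : Comm := comm_class (piso_inv (repr x)).

Lemma Comm_mulE p q :
  Comm_mul (comm_class p) (comm_class q) = comm_class (piso_comp p q).
Proof. by apply/comm_classP/commensurable_comp; exact: repr_comm_class. Qed.

Lemma Comm_invE p : Comm_inv (comm_class p) = comm_class (piso_inv p).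
Proof. by apply/comm_classP/commensurable_inv; exact: repr_comm_class. Qed.

Lemma Comm_mulA : associative Comm_mul.
Proof.
move=> x y z; have [[p ->] [q ->] [r ->]] :=
  And3 (comm_classW x) (comm_classW y) (comm_classW z).
rewrite !Comm_mulE; apply/comm_classP.
exists (piso_dom (piso_comp (piso_comp p q) r)); split=> //.
  exact: piso_domP.
by move=> a [? [? ?]].
Qed.

Lemma Comm_mul1g : left_id Comm_one Comm_mul.
Proof.
move=> x; have [p ->] := comm_classW x; rewrite Comm_mulE; apply/comm_classP.
by exists (piso_dom p); split=> //; exact: piso_domP.
Qed.

Lemma Comm_mulg1 : right_id Comm_one Comm_mul.
Proof.
move=> x; have [p ->] := comm_classW x; rewrite Comm_mulE; apply/comm_classP.
by exists (piso_dom p); split=> //; exact: piso_domP.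
Qed.

Lemma Comm_mulVg : left_inverse Comm_one Comm_inv Comm_mul.
Proof.
move=> x; have [p ->] := comm_classW x; rewrite Comm_invE Comm_mulE.
apply/comm_classP; exists (piso_dom p); split=> //; first exact: piso_domP.
  by move=> a pa; split=> //; exact: piso_im.
by move=> a /set_mem pa; exact: piso_funK.
Qed.

Lemma Comm_mulgV : right_inverse Comm_one Comm_inv Comm_mul.
Proof.
move=> x; have [p ->] := comm_classW x; rewrite Comm_invE Comm_mulE.
apply/comm_classP; exists (piso_cod p); split=> //; first exact: piso_codP.
  by move=> a pa; split=> //; case: (piso_inv_funP pa).
by move=> a /set_mem/piso_inv_funP[].
Qed.

HB.instance Definition _ := isGroup.Build Comm Comm_mulA Comm_mul1g Comm_mulg1
  Comm_mulVg Comm_mulgV.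

End Commensurator.

(* Main.v *)
(* Comm F2 contains a copy of Z/3 x Z/3, and Comm Gamma2 does not.

   For F2 = <a, b>, let N be the subgroup of elements of degree 0 modulo 6 in a. It is free
   on a^6 and the six conjugates a^-i b a^i, and permuting these conjugates embeds S_6 into
   Comm F2.

   Gamma2 acts properly and cocompactly on the hyperbolic plane, and Comm Gamma2 acts on the
   set of attracting fixed points at infinity of elements of Gamma2. This action preserves
   the crossing of the chord from x to y with the chord from z to t: for attracting points
   of a, b, c, d it says that far powers of c and d are separated, coarsely, by the broken
   line formed by the positive powers of a and of b, and such a coarse statement is invariant
   under isomorphisms of finite-index subgroups. An element of order 3 with a fixed point u
   would permute cyclically the three ways of pairing u, x, sx, s^2x, exactly one of which is
   crossing; so it acts trivially, hence is trivial. Thus Z/3 x Z/3 would act freely. On an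
   orbit of 9 points, some u and su are adjacent on the circle, so u, su and s^2u are pairwise
   adjacent, which is impossible in the presence of a fourth point. *)
Require Import Defs.
From mathcomp Require Import all_boot all_order all_algebra.
From mathcomp Require Import all_classical.
From mathcomp Require Import ring lra zify realalg.

Set Implicit Arguments.
Unset Strict Implicit.
Unset Printing Implicit Defensive.

Import Order.TTheory GRing.Theory Num.Theory.
Local Open Scope ring_scope.

(** * Three-dimensional Lorentzian geometry *)

(** The geometry takes place over an Archimedean real closed field, in the end the real algebraic
    numbers: points are unit vectors of the hyperboloid model, points at infinity are null vectors,
    distances are replaced by their hyperbolic cosines and the triangle inequality by [mf_triangle].
    Square roots provide the fixed points at infinity, and the Archimedean property provides the
    counts of steps. [Gamma2] sits with index four in the reflection group of a right-angled
    hexagon, which preserves an integral form. Integrality makes the action proper, and anisotropy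
    of the form excludes parabolic elements, so that every element of infinite order has a power
    with an attracting point. The obstacle in the invariance of crossing is that two attracting
    points are in general not the two ends of one axis. The line between them is therefore replaced
    by two rays of powers, each asymptotic to it. On the free side, two disjoint 3-cycles need six
    letters, hence the degree modulo 6. *)

Notation i0 := (@Ordinal 3 0 isT).
Notation i1 := (@Ordinal 3 1 isT).
Notation i2 := (@Ordinal 3 2 isT).

(* The first two coordinates are taken in a basis of a hexagonal lattice, so that the
   reflections in the sides of a regular right-angled hexagon are integral. *)
Definition gram (F : comNzRingType) : 'M[F]_3 :=
  \matrix_(i, j) (nth [::] [:: [:: 2; -1; 0]; [:: -1; 2; 0]; [:: 0; 0; -1]] i)`_j.

Definition form (F : comNzRingType) (u v : 'cV[F]_3) : F :=
  (u^T *m gram F *m v) 0 0.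

Lemma formE (F : comNzRingType) (u v : 'cV[F]_3) :
  form u v = 2 * (u i0 0 * v i0 0) - u i0 0 * v i1 0 - u i1 0 * v i0 0
    + 2 * (u i1 0 * v i1 0) - u i2 0 * v i2 0.
Proof.
rewrite /form mxE !big_ord_recl big_ord0 !mxE !big_ord_recl !big_ord0 !mxE /=.
have -> : lift ord0 ord0 = i1 by exact/val_inj.
have -> : lift ord0 (lift ord0 ord0) = i2 by exact/val_inj.
have -> : ord0 = i0 :> 'I_3 by exact/val_inj.
ring.
Qed.

Lemma vec3P (F : comNzRingType) (u v : 'cV[F]_3) :
  u i0 0 = v i0 0 -> u i1 0 = v i1 0 -> u i2 0 = v i2 0 -> u = v.
Proof.
move=> e0 e1 e2; apply/matrixP => i j; rewrite ord1.
by case: i => [[|[|[|//]]] h];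
  [move: e0 | move: e1 | move: e2]; congr (_ = _); congr (_ _ _); exact/val_inj.
Qed.

Definition vec3 (F : comNzRingType) (x y z : F) : 'cV[F]_3 :=
  \col_i [:: x; y; z]`_i.

(** The determinant. For null [u] and [v] its sign tells on which side of the line from [u] to [v]
    the point [w] lies. *)
Definition tri (F : comNzRingType) (u v w : 'cV[F]_3) : F :=
  u i0 0 * (v i1 0 * w i2 0 - v i2 0 * w i1 0)
  - u i1 0 * (v i0 0 * w i2 0 - v i2 0 * w i0 0)
  + u i2 0 * (v i0 0 * w i1 0 - v i1 0 * w i0 0).

Section Bilinear.
Variable F : comNzRingType.
Implicit Types (u v w : 'cV[F]_3) (c : F).

Lemma formC u v : form u v = form v u.
Proof. by rewrite !formE; ring. Qed.

Lemma formDl u v w : form (u + v) w = form u w + form v w.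
Proof. by rewrite !formE !mxE; ring. Qed.

Lemma formDr u v w : form w (u + v) = form w u + form w v.
Proof. by rewrite !formE !mxE; ring. Qed.

Lemma formZl c u v : form (c *: u) v = c * form u v.
Proof. by rewrite !formE !mxE; ring. Qed.

Lemma formZr c u v : form u (c *: v) = c * form u v.
Proof. by rewrite !formE !mxE; ring. Qed.

Lemma formNl u v : form (- u) v = - form u v.
Proof. by rewrite !formE !mxE; ring. Qed.

Lemma formNr u v : form u (- v) = - form u v.
Proof. by rewrite !formE !mxE; ring. Qed.

Lemma triDr u v w w' : tri u v (w + w') = tri u v w + tri u v w'.
Proof. by rewrite /tri !mxE; ring. Qed.

Lemma triZr c u v w : tri u v (c *: w) = c * tri u v w.
Proof. by rewrite /tri !mxE; ring. Qed.

Definition isometry (M : 'M[F]_3) : Prop :=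
  forall u v, form (M *m u) (M *m v) = form u v.

(* [det (gram F) = -3]. *)
Lemma gram_tri u v w u' v' w' :
  - 3 * tri u v w * tri u' v' w' =
    form u u' * (form v v' * form w w' - form v w' * form w v')
  - form u v' * (form v u' * form w w' - form v w' * form w u')
  + form u w' * (form v u' * form w v' - form v v' * form w u').
Proof. rewrite !formE /tri; ring. Qed.

End Bilinear.

(* [form] has signature (2,1); its opposite is positive on pairs of vectors of the
   future cone. *)
Definition minus_form (F : comNzRingType) (u v : 'cV[F]_3) : F := - form u v.
Notation "<< u , v >>" := (minus_form u v) (at level 0, u, v at level 99, format "<< u ,  v >>").

Section Lorentz.
Variable R : realFieldType.
Implicit Types (u v w : 'cV[R]_3) (c : R).

Lemma mfE u v : <<u, v>> = u i2 0 * v i2 0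
  - (2 * (u i0 0 * v i0 0) - u i0 0 * v i1 0 - u i1 0 * v i0 0
    + 2 * (u i1 0 * v i1 0)).
Proof. by rewrite /minus_form formE; ring. Qed.

Lemma mfC u v : <<u, v>> = <<v, u>>.
Proof. by rewrite /minus_form formC. Qed.
Lemma mfDl u v w : <<u + v, w>> = <<u, w>> + <<v, w>>.
Proof. by rewrite /minus_form formDl opprD. Qed.
Lemma mfDr u v w : <<w, u + v>> = <<w, u>> + <<w, v>>.
Proof. by rewrite /minus_form formDr opprD. Qed.
Lemma mfZl c u v : <<c *: u, v>> = c * <<u, v>>.
Proof. by rewrite /minus_form formZl mulrN. Qed.
Lemma mfZr c u v : <<u, c *: v>> = c * <<u, v>>.
Proof. by rewrite /minus_form formZr mulrN. Qed.

(** [unit_future] is the hyperboloid model, where [<<u, v>>] is the hyperbolic cosine of the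
    distance. A [null_ray] is a point at infinity; the pairing with it has the horocycles centred
    there as level sets. *)
Definition future u : Prop := 0 <= <<u, u>> /\ 0 < u i2 0.
Definition null_ray u : Prop := <<u, u>> = 0 /\ 0 < u i2 0.
Definition unit_future u : Prop := <<u, u>> = 1 /\ 0 < u i2 0.

Lemma null_future u : null_ray u -> future u.
Proof. by case=> e ?; split; rewrite ?e. Qed.

Lemma unit_future_future u : unit_future u -> future u.
Proof. by case=> e ?; split; rewrite ?e. Qed.

Lemma future_mul_bound (t s n k p : R) : 0 < t -> 0 < s -> 0 <= n -> 0 <= k ->
  n <= t ^+ 2 -> k <= s ^+ 2 -> p ^+ 2 <= n * k -> 0 <= t * s - p.
Proof.
move=> t0 s0 n0 k0 nt ks pnk.
rewrite subr_ge0; case: (leP p 0) => p0.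
  by apply: le_trans p0 _; rewrite mulr_ge0// ltW.
rewrite -(@ler_pXn2r _ 2) ?nnegrE//; [|exact: ltW|by rewrite mulr_ge0// ltW].
apply: le_trans pnk _; rewrite exprMn; exact: ler_pM.
Qed.

Lemma mf_ge0 u v : future u -> future v -> 0 <= <<u, v>>.
Proof.
move=> [uu u2] [vv v2]; rewrite mfE.
move: uu vv; rewrite !mfE.
set a := u i0 0; set b := u i1 0; set c := v i0 0; set d := v i1 0.
set t := u i2 0; set s := v i2 0 => uu vv.
apply: (@future_mul_bound t s (2 * (a * a - a * b + b * b)) (2 * (c * c - c * d + d * d))) => //.
- nra.
- nra.
- lra.
- lra.
- have := sqr_ge0 (a * d - b * c); nra.
Qed.

(** Reversed Cauchy-Schwarz. The difference of the two sides is the squared spatial norm of [(e, f)]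
    minus the Gram determinant [3 * (a * d - b * c) ^+ 2] of the spatial parts; [key] compares
    these. *)
Lemma mf_cauchy u v : future u -> future v ->
  <<u, u>> * <<v, v>> <= <<u, v>> ^+ 2.
Proof.
move=> [uu u2] _; move: uu; rewrite !mfE.
set a := u i0 0; set b := u i1 0; set c := v i0 0; set d := v i1 0.
move: u2; set t := u i2 0; set s := v i2 0 => u2 uu.
pose N := 2 * (a * a - a * b + b * b).
pose e := t * c - s * a; pose f := t * d - s * b.
have Nt : N <= t ^+ 2 by rewrite /N; lra.
have N0 : 0 <= N by rewrite /N; nra.
have W0 : 0 <= 2 * (e * e - e * f + f * f) by nra.
have key : 3 * (a * d - b * c) ^+ 2 <= 2 * (e * e - e * f + f * f).
  have t2 : 0 < t ^+ 2 by rewrite exprn_gt0.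
  rewrite -(ler_pM2l t2).
  have h : 3 * (a * f - b * e) ^+ 2 <= N * (2 * (e * e - e * f + f * f)).
    rewrite /N; have := sqr_ge0 (2 * a * e - a * f - b * e + 2 * b * f); nra.
  have -> : t ^+ 2 * (3 * (a * d - b * c) ^+ 2) = 3 * (a * f - b * e) ^+ 2.
    by rewrite /e /f; ring.
  apply: le_trans h _; exact: ler_wpM2r.
rewrite -subr_ge0; move: key; rewrite -subr_ge0; congr (0 <= _).
rewrite /e /f; ring.
Qed.

End Lorentz.

Section Lorentz2.
Variable R : realFieldType.
Implicit Types (u v w x : 'cV[R]_3) (c : R).

Lemma mf_timelike_gt0 u v : future u -> future v -> 0 < <<u, u>> ->
  0 < <<u, v>>.
Proof.
move=> fu fv uu; rewrite lt_neqAle mf_ge0// andbT; apply/eqP => /esym e.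
case: fu fv uu => _ u2 [vv v2]; move: vv e; rewrite !mfE.
set a := u i0 0; set b := u i1 0; set c := v i0 0; set d := v i1 0.
move: u2 v2; set t := u i2 0; set s := v i2 0 => u2 v2 vv e uu.
pose p := 2 * (a * c) - a * d - b * c + 2 * (b * d).
have pE : p = t * s by rewrite /p; lra.
pose n := 2 * (a * a - a * b + b * b); pose k := 2 * (c * c - c * d + d * d).
have n0 : 0 <= n by rewrite /n; nra.
have k0 : 0 <= k by rewrite /k; nra.
have nt : n < t ^+ 2 by rewrite /n; lra.
have ks : k <= s ^+ 2 by rewrite /k; lra.
have pnk : p ^+ 2 <= n * k.
  by rewrite /p /n /k; have := sqr_ge0 (a * d - b * c); nra.
have : n * k < t ^+ 2 * s ^+ 2.
  apply: (@le_lt_trans _ _ (n * s ^+ 2)); first exact: ler_wpM2l.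
  by rewrite ltr_pM2r// exprn_gt0.
by rewrite -exprMn -pE ltNge pnk.
Qed.

Lemma tri_gram u v w u' v' w' :
  3 * tri u v w * tri u' v' w' =
    <<u, u'>> * (<<v, v'>> * <<w, w'>> - <<v, w'>> * <<w, v'>>)
  - <<u, v'>> * (<<v, u'>> * <<w, w'>> - <<v, w'>> * <<w, u'>>)
  + <<u, w'>> * (<<v, u'>> * <<w, v'>> - <<v, v'>> * <<w, u'>>).
Proof. by have := gram_tri u v w u' v' w'; rewrite /minus_form; lra. Qed.

(** The multiplicative triangle inequality cosh(r + s) <= 2 cosh r cosh s, extended to points at
    infinity. The Gram determinant of [u], [v], [w] is nonnegative; two terms of known sign are
    dropped and the rest is divided by [<<u, w>>]. *)
Lemma mf_triangle u v w : future u -> future v -> future w ->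
  0 < <<v, v>> -> <<v, v>> * <<u, w>> <= 2 * <<u, v>> * <<v, w>>.
Proof.
move=> fu fv fw vv.
have := mf_ge0 fu fw; rewrite le_eqVlt => /predU1P[<-|uw].
  by rewrite mulr0 !mulr_ge0// mf_ge0.
have g := tri_gram u v w u v w.
have t0 : 0 <= 3 * tri u v w * tri u v w by rewrite -mulrA mulr_ge0// -expr2 sqr_ge0.
rewrite g in t0; have c := mf_cauchy fv fw.
have uu : 0 <= <<u, u>> by case: fu.
have ww : 0 <= <<w, w>> by case: fw.
have p0 : 0 <= <<u, u>> * (<<v, w>> ^+ 2 - <<v, v>> * <<w, w>>).
  by rewrite mulr_ge0// subr_ge0.
have q0 : 0 <= <<w, w>> * <<u, v>> ^+ 2 by rewrite mulr_ge0// sqr_ge0.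
rewrite -(ler_pM2r uw).
move: t0 p0 q0; rewrite (mfC v u) (mfC w u) (mfC w v); lra.
Qed.

Lemma null_parallel u v : null_ray u -> null_ray v -> <<u, v>> = 0 ->
  v i2 0 *: u = u i2 0 *: v.
Proof.
move=> [uu u2] [vv v2] uv.
pose w := v i2 0 *: u - u i2 0 *: v.
have ww : <<w, w>> = 0.
  rewrite /w /minus_form formDl !formDr !formNl !formNr !formZl !formZr.
  move: uu vv uv; rewrite /minus_form (formC v u) => uu vv uv.
  have -> : form u u = 0 by lra.
  have -> : form v v = 0 by lra.
  have -> : form u v = 0 by lra.
  ring.
have w2 : w i2 0 = 0 by rewrite /w !mxE; ring.
move: ww; rewrite mfE w2 => ww.
have w1 : w i1 0 = 0.
  have : 2 * w i0 0 * w i0 0 - 2 * w i0 0 * w i1 0 + 2 * w i1 0 * w i1 0 = 0 by lra.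
  move=> e; have : w i1 0 ^+ 2 = 0.
    by apply/eqP; rewrite eq_le sqr_ge0 andbT; have := sqr_ge0 (2 * w i0 0 - w i1 0); nra.
  by move/eqP; rewrite sqrf_eq0 => /eqP.
have w0 : w i0 0 = 0.
  by apply/eqP; rewrite -sqrf_eq0; apply/eqP; move: ww; rewrite w1; lra.
apply/eqP; rewrite -subr_eq0 -/w; apply/eqP.
by apply: vec3P; rewrite ?w0 ?w1 ?w2 mxE.
Qed.

Lemma future_of_pos u z : <<z, z>> >= 0 -> future u -> 0 < <<u, z>> -> future z.
Proof.
move=> zz fu uz; split=> //.
case: (ltgtP 0 (z i2 0)) => // [z2|/esym z2].
  have fz : future (- z).
    split; last by rewrite mxE oppr_gt0.
    by rewrite /minus_form formNl formNr opprK.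
  have := mf_ge0 fu fz; rewrite /minus_form formNr opprK => h.
  by move: uz; rewrite /minus_form; lra.
move: zz uz; rewrite !mfE z2; set x := z i0 0; set y := z i1 0 => zz uz.
have q : 2 * (x * x) - x * y - y * x + 2 * (y * y) = 0 by nra.
have y0 : y = 0.
  by apply/eqP; rewrite -sqrf_eq0 eq_le sqr_ge0 andbT; have := sqr_ge0 (2 * x - y); nra.
have x0 : x = 0 by apply/eqP; rewrite -sqrf_eq0; apply/eqP; rewrite y0 in q; lra.
by exfalso; move: uz; rewrite x0 y0; lra.
Qed.

Lemma unit_future_of_pos u z : <<z, z>> = 1 -> future u -> 0 < <<u, z>> -> unit_future z.
Proof. by move=> zz fu uz; have [|_ z2] := future_of_pos _ fu uz; rewrite ?zz. Qed.

Lemma mf_unit_ge1 u v : unit_future u -> unit_future v -> 1 <= <<u, v>>.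
Proof.
move=> hu hv; have fu := unit_future_future hu; have fv := unit_future_future hv.
have := mf_cauchy fu fv; case: hu hv => [-> _] [-> _].
by rewrite mulr1 expr_ge1 // mf_ge0.
Qed.

Section Axis.
Variables u v : 'cV[R]_3.
Hypothesis (nu : null_ray u) (nv : null_ray v).
Let m := <<u, v>>.
Hypothesis m_gt0 : 0 < m.

Let uu : <<u, u>> = 0. Proof. by case: nu. Qed.
Let vv : <<v, v>> = 0. Proof. by case: nv. Qed.

(** The Gram determinant of [u], [v], [z]. For a unit [z], both [<<u, z>> * <<v, z>>] and the
    determinant thus measure the distance from [z] to the line from [u] to [v]. *)
Lemma tri_sqr z :
  2 * m * <<u, z>> * <<v, z>> = m ^+ 2 * <<z, z>> + 3 * tri u v z ^+ 2.
Proof.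
have := tri_gram u v z u v z.
rewrite uu vv (mfC v u) (mfC z u) (mfC z v) -/m => h.
by rewrite expr2 mulrA h; ring.
Qed.

(** The pole of the line: the cross product of [u] and [v] multiplied by the inverse of [gram]. *)
Definition conormal : 'cV[R]_3 :=
  let c0 := u i1 0 * v i2 0 - u i2 0 * v i1 0 in
  let c1 := u i2 0 * v i0 0 - u i0 0 * v i2 0 in
  let c2 := u i0 0 * v i1 0 - u i1 0 * v i0 0 in
  vec3 ((2 * c0 + c1) / 3) ((c0 + 2 * c1) / 3) (- c2).

Lemma mf_conormal z : <<z, conormal>> = - tri u v z.
Proof. by rewrite mfE /tri !mxE /=; field. Qed.

Lemma axis_decomposition z : m ^+ 2 *: z =
  (m * <<v, z>>) *: u + (m * <<u, z>>) *: v + (3 * tri u v z) *: conormal.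
Proof.
(* With the terms in [<<u, u>>] and [<<v, v>>] kept, this is an identity for arbitrary [u] and [v];
   they vanish afterwards. *)
have id i : (m ^+ 2 - <<u, u>> * <<v, v>>) * z i 0 =
    (m * <<v, z>> - <<v, v>> * <<u, z>>) * u i 0
    + (m * <<u, z>> - <<u, u>> * <<v, z>>) * v i 0
    + 3 * tri u v z * conormal i 0.
  have : [\/ i = i0, i = i1 | i = i2].
    by case: i => [[|[|[|//]]] h]; [apply: Or31 | apply: Or32 | apply: Or33]; exact/val_inj.
  by case=> ->; rewrite /m !mfE /tri !mxE /=; field.
have coord i : (m ^+ 2 *: z) i 0 = ((m * <<v, z>>) *: u + (m * <<u, z>>) *: v
    + (3 * tri u v z) *: conormal) i 0.
  by have := id i; rewrite uu vv !mul0r !subr0 !mxE.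
by apply: vec3P; exact: coord.
Qed.

Definition axis_point (f g l : R) : 'cV[R]_3 :=
  (g / m) *: u + (f / m) *: v + (3 * l / m ^+ 2) *: conormal.

Lemma axis_pointE z : axis_point <<u, z>> <<v, z>> (tri u v z) = z.
Proof.
have m0 : m != 0 by rewrite gt_eqF.
have m2 : m ^+ 2 != 0 by rewrite expf_neq0.
apply: (scalerI m2); rewrite [RHS]axis_decomposition /axis_point !scalerDr !scalerA.
by congr (_ *: _ + _ *: _ + _ *: _); field.
Qed.

Lemma tri_conormal : tri u v conormal = m ^+ 2 / 3.
Proof.
suff -> : tri u v conormal = (m ^+ 2 - <<u, u>> * <<v, v>>) / 3.
  by rewrite uu mul0r subr0.
by rewrite /m !mfE /tri !mxE /=; field.
Qed.

Lemma axis_point_l f g l : <<u, axis_point f g l>> = f.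
Proof.
rewrite /axis_point !mfDr !mfZr uu mf_conormal -/m.
have -> : tri u v u = 0 by rewrite /tri; ring.
by field; rewrite gt_eqF.
Qed.

Lemma axis_point_r f g l : <<v, axis_point f g l>> = g.
Proof.
rewrite /axis_point !mfDr !mfZr vv mf_conormal (mfC v u) -/m.
have -> : tri u v v = 0 by rewrite /tri; ring.
by field; rewrite gt_eqF.
Qed.

Lemma tri_axis_point f g l : tri u v (axis_point f g l) = l.
Proof.
rewrite /axis_point !triDr !triZr tri_conormal.
have -> : tri u v u = 0 by rewrite /tri; ring.
have -> : tri u v v = 0 by rewrite /tri; ring.
by field; rewrite gt_eqF.
Qed.

Lemma mf_axis_point f g l z : <<axis_point f g l, z>> =
  (g * <<u, z>> + f * <<v, z>>) / m - 3 * l * tri u v z / m ^+ 2.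
Proof.
rewrite {1}/axis_point !mfDl !mfZl (mfC conormal) mf_conormal.
by field; rewrite gt_eqF.
Qed.

(** The horocycles [<<v, z>> = g] and [<<u, z>> = f], parametrised by [tri u v z]; [tri_sqr] and
    unit norm force the remaining coordinate. The parameter is proportional to arc length, so a
    horocycle can be walked in uniform steps. *)
Definition horo_l g l := axis_point ((m ^+ 2 + 3 * l ^+ 2) / (2 * m * g)) g l.
Definition horo_r f l := axis_point f ((m ^+ 2 + 3 * l ^+ 2) / (2 * m * f)) l.

Lemma horo_l_unit g l : 0 < g -> unit_future (horo_l g l).
Proof.
move=> g0; apply: (@unit_future_of_pos v); last by rewrite axis_point_r.
  rewrite mf_axis_point axis_point_l axis_point_r tri_axis_point.
  by field; rewrite !gt_eqF.
exact: null_future.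
Qed.

Lemma horo_r_unit f l : 0 < f -> unit_future (horo_r f l).
Proof.
move=> f0; apply: (@unit_future_of_pos u); last by rewrite axis_point_l.
  rewrite mf_axis_point axis_point_l axis_point_r tri_axis_point.
  by field; rewrite !gt_eqF.
exact: null_future.
Qed.

Lemma mf_horo_l g l l' : 0 < g ->
  <<horo_l g l, horo_l g l'>> = 1 + 3 * (l - l') ^+ 2 / (2 * m ^+ 2).
Proof.
move=> g0; rewrite mf_axis_point axis_point_l axis_point_r tri_axis_point.
by field; rewrite !gt_eqF.
Qed.

Lemma mf_horo_r f l l' : 0 < f ->
  <<horo_r f l, horo_r f l'>> = 1 + 3 * (l - l') ^+ 2 / (2 * m ^+ 2).
Proof.
move=> f0; rewrite mf_axis_point axis_point_l axis_point_r tri_axis_point.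
by field; rewrite !gt_eqF.
Qed.

End Axis.
End Lorentz2.

(** * Chains of bounded steps and coarse connectedness of half-planes *)

Section Linked.
Variables (T : Type) (A : T -> Prop) (r : T -> T -> Prop).

Inductive linked : T -> T -> Prop :=
| linked_refl x : A x -> linked x x
| linked_step x y z : A x -> r x y -> linked y z -> linked x z.

Lemma linked_l x y : linked x y -> A x.
Proof. by case. Qed.

Lemma linked_trans y x z : linked x y -> linked y z -> linked x z.
Proof.
elim=> [//|x' y' z' Ax rxy _ IH yz].
by apply: linked_step Ax rxy _; exact: IH.
Qed.

End Linked.

Lemma linked_map (T T' : Type) (A : T -> Prop) (A' : T' -> Prop)
    (r : T -> T -> Prop) (r' : T' -> T' -> Prop) (f : T -> T') x y :
  (forall x, A x -> A' (f x)) ->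
  (forall x y, A x -> A y -> r x y -> r' (f x) (f y)) ->
  linked A r x y -> linked A' r' (f x) (f y).
Proof.
move=> Af rf; elim=> [z /Af Az|a b c Aa rab bc IH]; first exact: linked_refl.
apply: linked_step IH; first exact: Af.
by apply: rf => //; exact: linked_l bc.
Qed.

Section Paths.
Variable R : archiRcfType.

Lemma linked_interval (T : Type) (A : T -> Prop) (r : T -> T -> Prop)
    (h : R -> T) (l0 d l l' : R) : 0 < d ->
  (forall l, l0 <= l -> A (h l)) ->
  (forall l l', `|l - l'| <= d -> r (h l) (h l')) ->
  l0 <= l -> l0 <= l' -> linked A r (h l) (h l').
Proof.
move=> d0 Ah rh hl hl'.
have [k hk] : exists k : nat, `|l - l'| <= k%:R * d.
  exists (Num.bound (`|l - l'| / d)).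
  rewrite -ler_pdivrMr// ltW// archi_boundP// divr_ge0// ltW//.
elim: k l hl hk => [|k IH] l hl.
  rewrite mul0r normr_le0 subr_eq0 => /eqP ->.
  by apply: linked_refl; exact: Ah.
case: (lerP `|l - l'| d) => hd.
  by move=> _; apply: linked_step (rh _ _ hd) (linked_refl _ _); exact: Ah.
rewrite -natr1 mulrDl mul1r => hk.
case: (lerP l l') => ll'.
  have hd' : l' - l > d by rewrite distrC ger0_norm ?subr_ge0 in hd.
  have hk' : l' - l <= k%:R * d + d by rewrite distrC ger0_norm ?subr_ge0 in hk.
  apply: linked_step (_ : r _ (h (l + d))) _; first exact: Ah.
    by apply: rh; rewrite opprD addrA subrr sub0r normrN gtr0_norm.
  apply: IH; first by lra.
  by rewrite distrC ger0_norm; lra.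
have hd' : l - l' > d by rewrite gtr0_norm ?subr_gt0 in hd.
have hk' : l - l' <= k%:R * d + d by rewrite gtr0_norm ?subr_gt0 in hk.
apply: linked_step (_ : r _ (h (l - d))) _; first exact: Ah.
  by apply: rh; rewrite opprB addrC subrK gtr0_norm.
apply: IH; first by lra.
by rewrite ger0_norm; lra.
Qed.

Variables u v : 'cV[R]_3.
Hypothesis (nu : null_ray u) (nv : null_ray v).
Let m := <<u, v>>.
Hypothesis m_gt0 : 0 < m.

(* In the half-plane cut out by the line from [u] to [v], two points beyond
   an equidistant curve are joined beyond that curve by three horocyclic arcs,
   centred at [v], [u] and [v]. *)
Lemma half_plane_linked (l0 : R) x y : 0 < l0 -> unit_future x -> unit_future y ->
  l0 <= tri u v x -> l0 <= tri u v y ->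
  linked (fun z => unit_future z /\ l0 <= tri u v z)
    (fun z z' => <<z, z'>> <= 2) x y.
Proof.
move=> l0_gt0 hx hy lx ly.
have fu := null_future nu; have fv := null_future nv.
have pos (z w : 'cV[R]_3) : null_ray w -> unit_future z -> 0 < <<w, z>>.
  move=> nw hz; rewrite mfC mf_timelike_gt0//; [exact: unit_future_future|exact: null_future|].
  by case: hz => ->.
pose g := <<v, x>>; pose g' := <<v, y>>.
have g0 : 0 < g by exact: pos.
have g'0 : 0 < g' by exact: pos.
have horoE z : unit_future z -> horo_l u v <<v, z>> (tri u v z) = z.
  move=> hz; rewrite -[RHS](axis_pointE nu nv m_gt0) /horo_l; congr axis_point.
  have vz := pos _ _ nv hz; have := tri_sqr nu nv z; case: hz => -> _.
  rewrite mulr1 => <-; rewrite -/m; field; rewrite !gt_eqF//.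
have m0 : m != 0 by rewrite gt_eqF.
pose k := g' / g; have k0 : 0 < k by rewrite divr_gt0.
(* Large enough for [D] below to be at least [l0 ^+ 2], so that the middle arc also stays beyond the
   equidistant curve. *)
pose L1 := l0 + 1 + (m ^+ 2 + 3 * l0 ^+ 2) / k.
have q0 : 0 < m ^+ 2 + 3 * l0 ^+ 2.
  by rewrite addr_gt0 ?mulr_gt0 ?exprn_gt0.
have qk0 : 0 < (m ^+ 2 + 3 * l0 ^+ 2) / k by rewrite divr_gt0.
have L1k : m ^+ 2 + 3 * l0 ^+ 2 <= k * L1 ^+ 2.
  rewrite [leRHS]mulrC -ler_pdivrMr//.
  have : 1 <= L1 by rewrite /L1; lra.
  have : (m ^+ 2 + 3 * l0 ^+ 2) / k <= L1 by rewrite /L1; lra.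
  by move=> h1 h2; apply: le_trans h1 _; rewrite expr2 ler_peMr// (le_trans ler01).
have m2 : 0 <= m ^+ 2 by rewrite sqr_ge0.
have l02 : 0 <= l0 ^+ 2 by rewrite sqr_ge0.
(* The horocycle centred at [u] through [horo_l u v g L1] has level [f1]; it meets the horocycle of
   level [g'] centred at [v] where [tri u v] is the square root of [D]. *)
pose D := ((m ^+ 2 + 3 * L1 ^+ 2) * k - m ^+ 2) / 3.
have D0 : l0 ^+ 2 <= D.
  have km : 0 <= m ^+ 2 * k by rewrite mulr_ge0// ltW.
  have ? : 0 <= k * L1 ^+ 2 by rewrite mulr_ge0// ?sqr_ge0// ltW.
  by rewrite /D; lra.
pose L2 := Num.sqrt D.
have L2D : L2 ^+ 2 = D by rewrite sqr_sqrtr//; lra.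
have L2l0 : l0 <= L2.
  rewrite -(@ler_pXn2r _ 2) ?nnegrE ?sqrtr_ge0 ?L2D//; exact: ltW.
have L1l0 : l0 <= L1 by rewrite /L1; lra.
pose f1 := (m ^+ 2 + 3 * L1 ^+ 2) / (2 * m * g).
have M0 : 0 < m ^+ 2 + 3 * L1 ^+ 2.
  by rewrite ltr_pwDl ?exprn_gt0// mulr_ge0// sqr_ge0.
have f10 : 0 < f1 by rewrite divr_gt0// !mulr_gt0.
have step1 l l' : `|l - l'| <= m / 2 -> 1 + 3 * (l - l') ^+ 2 / (2 * m ^+ 2) <= 2.
  move=> hl; have : (l - l') ^+ 2 <= (m / 2) ^+ 2.
    by rewrite -real_normK ?num_real// ler_pXn2r ?nnegrE ?normr_ge0// ltW// divr_gt0.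
  rewrite expr_div_n => h.
  have mm : 0 < m ^+ 2 by rewrite exprn_gt0.
  have : 3 * (l - l') ^+ 2 / (2 * m ^+ 2) <= 1.
    rewrite ler_pdivrMr; last by lra.
    move: h; rewrite ler_pdivlMr//; lra.
  lra.
have md : 0 < m / 2 by rewrite divr_gt0.
have pathl G l l' : 0 < G -> l0 <= l -> l0 <= l' ->
    linked (fun z => unit_future z /\ l0 <= tri u v z)
      (fun z z' => <<z, z'>> <= 2) (horo_l u v G l) (horo_l u v G l').
  move=> G0; apply: linked_interval md _ _ => [a ha|a b hab].
    by split; [exact: horo_l_unit|rewrite /horo_l tri_axis_point].
  by rewrite mf_horo_l//; exact: step1.
have pathr G l l' : 0 < G -> l0 <= l -> l0 <= l' ->
    linked (fun z => unit_future z /\ l0 <= tri u v z)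
      (fun z z' => <<z, z'>> <= 2) (horo_r u v G l) (horo_r u v G l').
  move=> G0; apply: linked_interval md _ _ => [a ha|a b hab].
    by split; [exact: horo_r_unit|rewrite /horo_r tri_axis_point].
  by rewrite mf_horo_r//; exact: step1.
rewrite -(horoE x hx) -(horoE y hy) -/g -/g'.
apply: (linked_trans (pathl _ _ L1 g0 lx L1l0)).
have -> : horo_l u v g L1 = horo_r u v f1 L1.
  rewrite /horo_l /horo_r -/m -/f1; congr axis_point.
  rewrite /f1; field; rewrite !gt_eqF//.
apply: (linked_trans (pathr _ _ L2 f10 L1l0 L2l0)).
have -> : horo_r u v f1 L2 = horo_l u v g' L2.
  have e : m ^+ 2 + 3 * L2 ^+ 2 = (m ^+ 2 + 3 * L1 ^+ 2) * k.
    by rewrite L2D /D; field.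
  rewrite /horo_l /horo_r -/m e /f1 /k; congr axis_point;
    field; rewrite !gt_eqF//.
exact: pathl.
Qed.

End Paths.

(** * The right-angled hexagon group and the genus two surface group *)

Definition adjacent (i j : 'I_6) : bool := (j == i.+1 %% 6 :> nat)%N || (i == j.+1 %% 6 :> nat)%N.

Lemma adjacentC i j : adjacent i j = adjacent j i.
Proof. by rewrite /adjacent orbC. Qed.

Section CoxeterAction.
Variables (T : Type) (act : 'I_6 -> T -> T).
Hypothesis actK : forall i, involutive (act i).
Hypothesis actC : forall i j t, adjacent i j -> act i (act j t) = act j (act i t).

Definition act_word (w : seq 'I_6) (t : T) : T := foldr act t w.

Lemma act_word_cat u v t : act_word (u ++ v) t = act_word u (act_word v t).
Proof. by rewrite /act_word foldr_cat. Qed.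

Lemma act_word_revK w : cancel (act_word w) (act_word (rev w)).
Proof.
elim: w => [//|i w IH] t; rewrite rev_cons -cats1 act_word_cat /=.
by rewrite actK IH.
Qed.

Fixpoint delete_letter (i : 'I_6) (w : seq 'I_6) : option (seq 'I_6) :=
  if w is j :: w' then
    if j == i then Some w'
    else if adjacent i j then omap (cons j) (delete_letter i w') else None
  else None.

(** Cancels letters that commutations of adjacent letters bring together. By soundness
    ([act_word_cancel]), identities between concrete words are checked by computation. *)
Definition cancel_word (w : seq 'I_6) : seq 'I_6 :=
  foldr (fun i w => odflt (i :: w) (delete_letter i w)) [::] w.

Lemma act_word_cancel w : act_word (cancel_word w) =1 act_word w.
Proof.
have del i u u' t : delete_letter i u = Some u' -> act_word u' t = act i (act_word u t).
  elim: u u' => [//|j u IH] u' /=; case: eqP => [->|_]; first by case=> <-; rewrite actK.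
  case: ifP => // ij; case e: (delete_letter i u) => [v|]//= [<-] /=.
  by rewrite (IH v)// actC// adjacentC.
elim: w => [//|i w IH] t /=; rewrite -IH.
by case e: (delete_letter i _) => [v|]//=; exact: del.
Qed.

End CoxeterAction.

Definition hex (n : nat) : 'I_6 := Ordinal (ltn_pmod n (isT : 0 < 6)%N).

(* The genus two surface group is the kernel of the parity map from the hexagon group
   onto (Z/2)^2; with [s_i] the reflection in the [i]-th side, its generators are
   [A = s2 s0], [B = s0 s3 s1 s0], [C = s0 s3 s0 s5] and [D = s4 s0]. *)
Definition hex_letter (l : 'I_4 * bool) : seq 'I_6 :=
  let w := map hex (nth [::] [:: [:: 2; 0]; [:: 0; 3; 1; 0]; [:: 0; 3; 0; 5]; [:: 4; 0]] l.1)%N in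
  if l.2 then rev w else w.

Definition hex_word (v : seq ('I_4 * bool)) : seq 'I_6 := flatten (map hex_letter v).

Lemma hex_word_cat u v : hex_word (u ++ v) = hex_word u ++ hex_word v.
Proof. by rewrite /hex_word map_cat flatten_cat. Qed.

Lemma act_word_relator (T : Type) (act : 'I_6 -> T -> T) :
  (forall i, involutive (act i)) ->
  (forall i j t, adjacent i j -> act i (act j t) = act j (act i t)) ->
  act_word act (hex_word Gamma2_relator) =1 id.
Proof.
move=> actK actC t; rewrite -(act_word_cancel actK actC).
by have -> : cancel_word (hex_word Gamma2_relator) = [::] by vm_compute.
Qed.

Lemma act_word_eq (T : Type) (act : 'I_6 -> T -> T) u v :
  (forall i, involutive (act i)) ->
  (forall i j t, adjacent i j -> act i (act j t) = act j (act i t)) ->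
  word_eq [set Gamma2_relator]%classic u v ->
  act_word act (hex_word u) =1 act_word act (hex_word v).
Proof.
move=> actK actC; elim=> {u v} [//|u v _ e t|v u w _ e1 _ e2 t|u u' v v' _ e1 _ e2 t|i b t|r -> t].
- by rewrite e.
- by rewrite e1 e2.
- by rewrite !hex_word_cat !act_word_cat e1 e2.
- rewrite /hex_word /= cats0 act_word_cat /hex_letter /=.
  set w := map hex _; case: b => /=; first by rewrite act_word_revK.
  by rewrite -{1}[w]revK act_word_revK.
- exact: act_word_relator.
Qed.

(** * The Lorentz representation of the hexagon group *)

Section Roots.
Variable F : comNzRingType.

Definition root (i : 'I_6) : 'cV[F]_3 :=
  vec3 ([:: 1; 1; 0; -1; -1; 0]`_i) ([:: 0; 1; 1; 0; -1; -1]`_i) 1.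

Definition basepoint : 'cV[F]_3 := vec3 0 0 1.

(** A circulant matrix: neighbouring sides are perpendicular, and the other pairs are ultraparallel,
    the distances having hyperbolic cosine 2 or 3. *)
Definition root_gram (i j : 'I_6) : int :=
  ([:: 1; 0; -2; -3; -2; 0] : seq int)`_((j + 6 - i) %% 6)%N.

End Roots.

Section Reflections.
Variable F : comNzRingType.
Local Notation root := (root F).
Local Notation base := (basepoint F).

Lemma form_root i j : form (root i) (root j) = (root_gram i j)%:~R.
Proof.
rewrite formE !mxE /=.
by case: i => [[|[|[|[|[|[|//]]]]]] hi]; case: j => [[|[|[|[|[|[|//]]]]]] hj];
  rewrite /root_gram /=; ring.
Qed.

Lemma form_root_base i : form (root i) base = - 1.
Proof.
by rewrite formE !mxE /=; ring.
Qed.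

Definition refl i : 'M[F]_3 := 1%:M - 2 *: (root i *m ((root i)^T *m gram F)).

Lemma refl_mul i v : refl i *m v = v - (2 * form (root i) v) *: root i.
Proof.
rewrite /refl mulmxBl mul1mx -scalemxAl -scalerA -[in LHS]mulmxA; congr (_ - _ *: _).
by rewrite [(root i)^T *m _ *m v]mx11_scalar mul_mx_scalar.
Qed.

Lemma form_refl i u v : form (refl i *m u) (refl i *m v) = form u v.
Proof.
rewrite !refl_mul formDl !formDr !formNl !formNr !formZl !formZr.
rewrite (formC u (root i)) form_root /root_gram addKn modnn /=; ring.
Qed.

Lemma matrix_ext n m (A B : 'M[F]_(m, n)) : (forall v : 'cV_n, A *m v = B *m v) -> A = B.
Proof.
move=> e; apply/matrixP => i j.
have /matrixP/(_ i 0) := e (delta_mx j 0).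
by rewrite -!colE !mxE.
Qed.

Lemma reflK i : refl i *m refl i = 1%:M.
Proof.
apply: matrix_ext => v; rewrite -mulmxA mul1mx !refl_mul formDr formNr formZr.
rewrite form_root /root_gram addKn modnn /= -addrA -opprD -scalerDl.
rewrite -[RHS]subr0; congr (_ - _); rewrite -[RHS](scale0r (root i)); congr (_ *: _).
ring.
Qed.

Lemma root_gram_adjacent i j : adjacent i j -> root_gram i j = 0.
Proof.
by case: i => [[|[|[|[|[|[|//]]]]]] hi]; case: j => [[|[|[|[|[|[|//]]]]]] hj].
Qed.

Lemma refl_comm i j : adjacent i j -> refl i *m refl j = refl j *m refl i.
Proof.
move=> a; apply: matrix_ext => v; rewrite -!mulmxA !refl_mul !formDr !formNr !formZr.
rewrite !form_root !root_gram_adjacent ?(adjacentC j i)// mulr0z !mulr0 !subr0.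
by rewrite addrAC.
Qed.

Definition hex_mx (w : seq 'I_6) : 'M[F]_3 := foldr (fun i M => refl i *m M) 1%:M w.

Lemma hex_mx_act w : hex_mx w = act_word (fun i (M : 'M_3) => refl i *m M) w 1%:M.
Proof. by []. Qed.

Lemma hex_mx_mul w (v : 'cV_3) : hex_mx w *m v = act_word (fun i (v : 'cV_3) => refl i *m v) w v.
Proof. by elim: w => [|i w IH] /=; rewrite ?mul1mx// -mulmxA IH. Qed.

Lemma hex_mx_cat u v : hex_mx (u ++ v) = hex_mx u *m hex_mx v.
Proof. by elim: u => [|i u IH] /=; rewrite ?mul1mx// IH mulmxA. Qed.

Lemma hex_mx_isometry w : isometry (hex_mx w).
Proof.
move=> u v; elim: w => [|i w IH] /=; first by rewrite !mul1mx.
by rewrite -!mulmxA form_refl.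
Qed.

End Reflections.

(* Tits: on a reduced word the functional of a root is positive unless the word
   can be rearranged to start with the corresponding reflection. The auxiliary action
   keeps track of the words without assuming that they are determined by their matrix,
   which is the conclusion. *)
Section Tits.
Variables (R : realFieldType) (T : Type) (act : 'I_6 -> T -> T).
Hypothesis actK : forall i, involutive (act i).
Hypothesis actC : forall i j t, adjacent i j -> act i (act j t) = act j (act i t).
Implicit Types (w : seq 'I_6) (s t i : 'I_6).

Let weq w w' : Prop := hex_mx R w = hex_mx R w' /\ act_word act w =1 act_word act w'.
Let reduced w : Prop := forall w', weq w w' -> (size w <= size w')%N.
Let begins s w : Prop := exists w', (size w').+1 = size w /\ weq w (s :: w').
Let alpha s w : R := <<root R s, hex_mx R w *m basepoint R>>.

Let weq_trans w' w w'' : weq w w' -> weq w' w'' -> weq w w''.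
Proof. by case=> e f [e' f']; split=> [|t]; rewrite ?e ?f. Qed.

Let weq_cons i w w' : weq w w' -> weq (i :: w) (i :: w').
Proof. by case=> e f; split=> [|t] /=; rewrite ?e ?f. Qed.

Let weq_cancel i w : weq (i :: i :: w) w.
Proof.
split=> [|t] /=; first by rewrite mulmxA reflK mul1mx.
exact: actK.
Qed.

Let weq_swap i j w : adjacent i j -> weq (i :: j :: w) (j :: i :: w).
Proof.
move=> a; split=> [|t] /=; first by rewrite 2!mulmxA (refl_comm _ a).
exact: actC.
Qed.

Let alpha_cons s i w : alpha s (i :: w) = alpha s w - 2 * (root_gram s i)%:~R * alpha i w.
Proof.
rewrite /alpha /= -mulmxA refl_mul /minus_form formDr formNr formZr form_root; ring.
Qed.

Let alpha_weq s w w' : weq w w' -> alpha s w = alpha s w'.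
Proof. by case=> e _; rewrite /alpha e. Qed.

Let reduced_tail i w : reduced (i :: w) -> reduced w /\ ~ begins i w.
Proof.
move=> r; split=> [w' e|[w' [sz e]]].
  by have := r _ (weq_cons i e).
have := r w' (weq_trans (weq_cons i e) (weq_cancel i w')).
by rewrite /= -sz => h; have := leq_trans h (leqnSn _); rewrite ltnn.
Qed.

Let root_gram_cases s t : [\/ s = t, adjacent s t | (2 : R) <= - (root_gram s t)%:~R].
Proof.
case: (eqVneq s t) => [|st]; first by constructor 1.
case a: (adjacent s t); first by constructor 2.
constructor 3; rewrite -rmorphN /= (_ : 2 = 2%:~R)// ler_int.
move: st a; rewrite -val_eqE.
by case: s => [[|[|[|[|[|[|//]]]]]] hi]; case: t => [[|[|[|[|[|[|//]]]]]] hj].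
Qed.

(** The second clause strengthens the induction. If [w] is [t :: u] and [u] begins with [s], then
    [alpha s u] may be negative, but it exceeds [- alpha t u]; in [alpha s w] the term [alpha t u]
    enters with a coefficient at least 4 and prevails. *)
Let tits n w : (size w <= n)%N -> reduced w ->
  forall s, ~ begins s w -> 0 < alpha s w /\
    forall t, begins t w -> (2 : R) <= - (root_gram s t)%:~R -> - alpha t w < alpha s w.
Proof.
elim: n w => [|n IH] w; rewrite ?leqn0.
  move=> /nilP -> _ s _; split; last by move=> t [w' []].
  by rewrite /alpha /= mul1mx /minus_form form_root_base opprK.
move=> sz rw s bs.
have key t u : weq w (t :: u) -> (size u).+1 = size w ->
    [/\ s <> t, reduced (t :: u) & ~ begins s (t :: u)].
  move=> e szu; split.
  - by move=> st; apply: bs; exists u; split=> //; rewrite st.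
  - by move=> w' e'; rewrite /= szu; apply: rw; exact: weq_trans e e'.
  - move=> [w' [sz' e']]; apply: bs; exists w'; split; last exact: weq_trans e e'.
    by rewrite sz' /= szu.
have main t u : weq w (t :: u) -> (size u).+1 = size w ->
    (2 : R) <= - (root_gram s t)%:~R -> 0 < - alpha t w /\ - alpha t w < alpha s w.
  move=> e szu c; have [st rtu bsu] := key _ _ e szu.
  have [ru btu] := reduced_tail rtu.
  have szun : (size u <= n)%N by rewrite -ltnS szu.
  have [at0 att] := IH u szun ru t btu.
  rewrite !(alpha_weq _ e) !alpha_cons.
  have -> : (root_gram t t)%:~R = 1 :> R by rewrite /root_gram addKn modnn.
  split; first by lra.
  have [bsu'|bsu'] := pselect (begins s u).
    have sym : root_gram t s = root_gram s t.
      apply: (@intr_inj R); rewrite -!form_root; exact: formC.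
    have := att s bsu'; rewrite sym => /(_ c) h.
    nra.
  have [as0 _] := IH u szun ru s bsu'.
  nra.
split; last by move=> t [u [szu e]] c; have [] := main _ _ e szu c.
case: w sz rw bs key main => [|t u] sz rw bs key main.
  by rewrite /alpha /= mul1mx /minus_form form_root_base opprK.
have e : weq (t :: u) (t :: u) by split.
have [st _ _] := key _ _ e erefl.
case: (root_gram_cases s t) => [//|a|c]; last first.
  have [? ?] := main _ _ e erefl c; lra.
have [ru btu] := reduced_tail rw.
have bsu : ~ begins s u.
  move=> [u' [sz' e']]; apply: bs; exists (t :: u'); split; first by rewrite /= sz'.
  apply: weq_trans (weq_cons t e') _; apply: weq_swap; by rewrite adjacentC.
have [h _] := IH u sz ru s bsu.
by rewrite alpha_cons (root_gram_adjacent a) mulr0 mul0r subr0.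
Qed.

(** If a shortest equivalent word were [t :: u], then [alpha t] would be 1 on it, since the
    basepoint is fixed, and also [- alpha t u], which is negative by [tits]. *)
Lemma hex_faithful w : hex_mx R w *m basepoint R = basepoint R -> act_word act w =1 id.
Proof.
move=> wb; pose P n := `[< exists w', weq w w' /\ size w' = n >].
have exP : exists n, P n by exists (size w); apply/asboolP; exists w; split.
case: (ex_minnP exP) => n /asboolP[w' [e sz]] nmin.
have rw' : reduced w'.
  by move=> w'' e'; rewrite sz; apply: nmin; apply/asboolP; exists w''; split=> //; exact: weq_trans e e'.
case: w' e sz rw' => [[_ e] _ _ t|t u e _ rtu]; first by rewrite e.
have [ru btu] := reduced_tail rtu.
have [h _] := tits (leqnn _) ru btu.
have a1 : alpha t w = 1 by rewrite /alpha wb /minus_form form_root_base opprK.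
have := alpha_weq t e; rewrite alpha_cons a1.
have -> : (root_gram t t)%:~R = 1 :> R by rewrite /root_gram addKn modnn.
lra.
Qed.

End Tits.

(** * The representation of the genus two group *)

Definition gamma_word (v : seq ('I_4 * bool)) : Gamma2 :=
  word_class [set Gamma2_relator]%classic v.

Section Gamma2Action.

Definition lorentz (F : comNzRingType) (x : Gamma2) : 'M[F]_3 := hex_mx F (hex_word (repr x)).

Lemma rep_class F v : lorentz F (gamma_word v) = hex_mx F (hex_word v).
Proof.
rewrite /lorentz !hex_mx_act; apply: act_word_eq (repr_word_class _ _) _.
  by move=> i M /=; rewrite mulmxA reflK mul1mx.
by move=> i j M a /=; rewrite !mulmxA (refl_comm _ a).
Qed.

Variable F : comNzRingType.

Lemma repM x y : lorentz F (x * y)%g = lorentz F x *m lorentz F y.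
Proof.
have [u ->] := word_classW x; have [v ->] := word_classW y.
rewrite [(_ * _)%g]presented_mulE !rep_class hex_word_cat; exact: hex_mx_cat.
Qed.

Lemma rep1 : lorentz F 1%g = 1%:M.
Proof. exact: rep_class. Qed.

Lemma repVK x v : lorentz F x^-1%g *m (lorentz F x *m v) = v :> 'cV_3.
Proof. by rewrite mulmxA -repM mulVg rep1 mul1mx. Qed.

Lemma repKV x v : lorentz F x *m (lorentz F x^-1%g *m v) = v :> 'cV_3.
Proof. by rewrite mulmxA -repM mulgV rep1 mul1mx. Qed.

Lemma rep_isometry x : isometry (lorentz F x).
Proof. exact: hex_mx_isometry. Qed.

Lemma rep_form_l x u v : form (lorentz F x *m u) v = form u (lorentz F x^-1%g *m v).
Proof. by rewrite -(rep_isometry x^-1%g) repVK. Qed.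

End Gamma2Action.

Lemma map_hex_mx (F F' : comNzRingType) (f : {rmorphism F -> F'}) w :
  map_mx f (hex_mx F w) = hex_mx F' w.
Proof.
have mroot i : map_mx f (root F i) = root F' i.
  apply/matrixP => a b; rewrite !mxE.
  have hc (s : seq int) k : f (s`_k)%:~R = (s`_k)%:~R by rewrite rmorph_int.
  by case: a => [[|[|[|//]]] ha] /=; rewrite ?rmorph1//;
    case: i => [[|[|[|[|[|[|//]]]]]] hi] /=; rewrite ?rmorphN ?rmorph1 ?rmorph0.
have mgram : map_mx f (gram F) = gram F'.
  apply/matrixP => a b; rewrite !mxE.
  by case: a => [[|[|[|//]]] ha] /=; case: b => [[|[|[|//]]] hb] /=;
    rewrite ?rmorphN ?rmorph_nat ?rmorph1 ?rmorph0.
elim: w => [|i w IH] /=; first exact: map_mx1.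
rewrite map_mxM IH; congr (_ *m _); rewrite /refl map_mxB map_mx1 map_mxZ !map_mxM.
by rewrite -matrix.map_trmx mroot mgram rmorph_nat.
Qed.

Lemma gamma_word_nil : gamma_word [::] = 1%g.
Proof. by []. Qed.

Lemma gamma_word_cat u v : gamma_word (u ++ v) = (gamma_word u * gamma_word v)%g.
Proof. by rewrite [RHS]presented_mulE. Qed.

Lemma genus2_relation (G : groupType) (a b c d : G) :
  (a * b * a^-1 * b^-1 * c * d * c^-1 * d^-1 = 1)%g ->
  [/\ (d * c * d^-1 * c^-1 * b * a = a * b)%g,
      (a^-1 * d * c * d^-1 * c^-1 * b = b * a^-1)%g,
      (a^-1 * b^-1 * c * d * c^-1 * d^-1 = b^-1 * a^-1)%g &
      (b^-1 * c * d * c^-1 * d^-1 * a = a * b^-1)%g].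
Proof.
move=> r.
have r3 : (a^-1 * b^-1 * c * d * c^-1 * d^-1 = b^-1 * a^-1)%g.
  by apply: (mulgI (a * b)%g); rewrite !mulgA r mulgK mulgV.
have r1 : (d * c * d^-1 * c^-1 * b * a = a * b)%g.
  have := congr1 (fun x : G => x^-1)%g r3.
  rewrite !invgM !invgK !mulgA => <-; by rewrite ?mulgA.
split=> //.
  apply: (mulgI a); apply: (mulIg a).
  by rewrite !mulgA mulgV mul1g r1 mulgVK.
apply: (mulgI a^-1%g); rewrite !mulgA mulVg mul1g.
by apply: (mulIg a^-1%g); rewrite mulgK r3.
Qed.

(** * Reidemeister-Schreier rewriting and faithfulness *)

Section Schreier.

Definition hex_state (i : bool * bool) (s : 'I_6) : bool * bool :=
  if odd s then (i.1, ~~ i.2) else (~~ i.1, i.2).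

Definition hex_transversal (i : bool * bool) : seq 'I_6 :=
  (if i.1 then [:: hex 0] else [::]) ++ (if i.2 then [:: hex 1] else [::]).

Let letter n b : 'I_4 * bool := (Ordinal (ltn_pmod n (isT : 0 < 4)%N), b).
Let A := letter 0 false. Let A' := letter 0 true.
Let B := letter 1 false. Let B' := letter 1 true.
Let C := letter 2 false. Let C' := letter 2 true.
Let D := letter 3 false. Let D' := letter 3 true.

(* [schreier i s] represents the inverse of the Schreier generator [t_i s t_j^-1], where
   [t_i] is the transversal and [j = hex_state i s]. *)
Definition schreier (i : bool * bool) (s : 'I_6) : seq ('I_4 * bool) :=
  match i, val s with
  | (false, _), 2 => [:: A']
  | (true, _), 2 => [:: A]
  | (false, false), 3 => [:: B'; C; D; C'; D']
  | (false, true), 3 => [:: D; C; D'; C'; B]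
  | (true, false), 3 => [:: B']
  | (true, true), 3 => [:: B]
  | (false, false), 4 => [:: D']
  | (true, false), 4 => [:: D]
  | (false, true), 4 => [:: B'; C; D'; C'; B]
  | (true, true), 4 => [:: B'; C; D; C'; B]
  | (_, false), 5 => [:: B'; C]
  | (_, true), 5 => [:: C'; B]
  | _, _ => [::]
  end.

(** Left multiplication in the hexagon group, an element [w] being recorded as [(i, x)] with
    [t_i w = x]. Since [x] ranges over the presented group, the action detects whether a word is
    trivial in [Gamma2] itself. *)
Definition schreier_act (s : 'I_6) (t : (bool * bool) * Gamma2) : (bool * bool) * Gamma2 :=
  (hex_state t.1 s, (gamma_word (schreier t.1 s) * t.2)%g).


Let rel : gamma_word Gamma2_relator = 1%g.
Proof. by apply/word_classP; exact: word_eq_relator. Qed.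

Let g (l : 'I_4 * bool) : Gamma2 := gamma_word [:: l].

Let wordE l v : gamma_word (l :: v) =
  (g l * gamma_word v)%g.
Proof. by rewrite -cat1s gamma_word_cat. Qed.

Let gV n : g (letter n true) = (g (letter n false))^-1%g.
Proof. by rewrite [RHS]presented_invE. Qed.

Let relE : (g A * g B * (g A)^-1 * (g B)^-1 * g C * g D * (g C)^-1 * (g D)^-1 = 1)%g.
Proof.
have e : Gamma2_relator = [:: A; B; A'; B'; C; D; C'; D'].
  by rewrite /Gamma2_relator /comm_word /inv_word /rev /=; repeat congr cons;
    congr pair; exact/val_inj.
have relW : gamma_word [:: A; B; A'; B'; C; D; C'; D'] = 1%g by rewrite -e; exact: rel.
by rewrite -!gV -[RHS]relW !wordE gamma_word_nil mulg1 !mulgA.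
Qed.

Lemma schreier_actK s : involutive (schreier_act s).
Proof.
move=> [i x]; rewrite /schreier_act /=; congr pair.
  by case: i => i j; rewrite /hex_state; case: odd; rewrite /= negbK.
rewrite mulgA -[RHS]mul1g; congr (_ * _)%g.
case: i => [[] []]; case: s => [[|[|[|[|[|[|//]]]]]] hs];
  by rewrite /schreier /hex_state /= ?wordE ?gV ?gamma_word_nil
    ?mulgA ?(mulgK, mulgVK, mulgV, mulVg, mulg1, mul1g).
Qed.


(** State by state, the commutation of two adjacent letters either holds freely or follows from one
    of the forms of the relator in [genus2_relation]. *)
Lemma schreier_actC s s' t : adjacent s s' ->
  schreier_act s (schreier_act s' t) = schreier_act s' (schreier_act s t).
Proof.
have [rel1 rel2 rel3 rel4] := genus2_relation relE.
case: t => i x; rewrite /schreier_act /=; move: i.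
suff H (i : bool * bool) : adjacent s s' ->
    hex_state (hex_state i s') s = hex_state (hex_state i s) s' /\
    (gamma_word (schreier (hex_state i s') s) * gamma_word (schreier i s') =
     gamma_word (schreier (hex_state i s) s') * gamma_word (schreier i s))%g.
  by move=> i a; have [e1 e2] := H i a; rewrite !mulgA e1 e2.
move: i => [[] []]; case: s => [[|[|[|[|[|[|//]]]]]] hs]; case: s' => [[|[|[|[|[|[|//]]]]]] hs'] // _;
  (split; first by []);
  by rewrite /schreier /hex_state /= ?wordE ?gV ?gamma_word_nil
    ?mulgA ?(mulgK, mulgVK, mulgV, mulVg, mulg1, mul1g) // ?(rel1, rel2, rel3, rel4).
Qed.


(** On the even state a word acts by left multiplication by its class, so the class is recovered
    from the action of the hexagon word. *)
Lemma schreier_act_word v x :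
  act_word schreier_act (hex_word v) (false, false, x) =
  (false, false, gamma_word v * x)%g.
Proof.
have gE k (h : (k < 4)%N) : g (Ordinal h, false) = g (letter k false).
  by congr (g (_, _)); apply/val_inj; rewrite /= modn_small.
elim: v x => [|[n b] v IH] x; first by rewrite gamma_word_nil mul1g.
rewrite -cat1s hex_word_cat act_word_cat IH gamma_word_cat -mulgA /=.
move: (gamma_word v * x)%g => {IH}x.
have -> : gamma_word [:: (n, b)] = (if b then (g (n, false))^-1 else g (n, false))%g.
  by case: b; rewrite // [RHS]presented_invE.
by case: n => [[|[|[|[|//]]]] hn]; case: b;
 rewrite /hex_word /= /hex_letter /rev /= /schreier_act /hex_state /schreier /=
  ?wordE ?gV ?gamma_word_nil; congr pair;
  rewrite ?mulgA ?(mulgK, mulgVK, mulgV, mulVg, mulg1, mul1g) gE.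
Qed.

End Schreier.

(** Up to one of four transversal elements, every element of the hexagon group acts as an element of
    [Gamma2]; this carries cocompactness over to [Gamma2]. *)
Lemma hex_mx_transversal (F : comNzRingType) w :
  let t := act_word schreier_act w (false, false, 1%g) in
  hex_mx F (hex_transversal t.1 ++ w) = lorentz F t.2.
Proof.
have revK u : hex_mx F u *m hex_mx F (rev u) = 1%:M.
  rewrite -hex_mx_cat hex_mx_act act_word_cat -[X in act_word _ X (act_word _ _ _)]revK.
  by rewrite act_word_revK// => i M /=; rewrite mulmxA reflK mul1mx.
have cancelE u : cancel_word u = [::] -> hex_mx F u = 1%:M.
  move=> e; rewrite hex_mx_act -act_word_cancel ?e//.
    by move=> i M /=; rewrite mulmxA reflK mul1mx.
  by move=> i j M a /=; rewrite !mulmxA (refl_comm _ a).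
have eqE u u' : cancel_word (rev u ++ u') = [::] -> hex_mx F u = hex_mx F u'.
  move=> /cancelE; rewrite hex_mx_cat => e.
  by rewrite -[LHS]mulmx1 -e mulmxA revK mul1mx.
elim: w => [|s w IH] /=; first by rewrite rep1.
rewrite repM -IH rep_class -cat1s catA hex_mx_cat.
move: (act_word _ w _).1 => i; rewrite [in RHS]hex_mx_cat [RHS]mulmxA -[in RHS]hex_mx_cat.
congr (_ *m _); apply: eqE.
by case: i => [[] []]; case: s => [[|[|[|[|[|[|//]]]]]] hs]; vm_compute.
Qed.


Lemma rep_base_inj (R : realFieldType) x y :
  lorentz R x *m basepoint R = lorentz R y *m basepoint R -> x = y.
Proof.
move=> e; apply/esym; suff: (x^-1 * y = 1)%g.
  by move=> h; rewrite -[y](mulVKg x) h mulg1.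
have {e} : lorentz R (x^-1 * y)%g *m basepoint R = basepoint R.
  by rewrite repM -mulmxA -e repVK.
have [v ->] := word_classW (x^-1 * y)%g.
rewrite [X in X *m _]rep_class => h.
have := hex_faithful schreier_actK schreier_actC h.
by move/(_ (false, false, 1%g)); rewrite schreier_act_word mulg1 => -[].
Qed.

(** * Cocompactness of the action on the hyperbolic plane *)

Section Geometry.
Variable R : archiRcfType.
Local Notation base := (basepoint R).
Local Notation rep := (lorentz R).

Lemma mf_base (z : 'cV[R]_3) : <<base, z>> = z i2 0.
Proof. by rewrite mfE !mxE /=; ring. Qed.

Lemma unit_base : unit_future base.
Proof. by split; rewrite ?mf_base mxE. Qed.

Lemma refl_unit i (z : 'cV[R]_3) : unit_future z -> unit_future (refl R i *m z).
Proof.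
move=> hz; have [zz _] := hz.
have e (u v : 'cV[R]_3) : <<refl R i *m u, refl R i *m v>> = <<u, v>>.
  by rewrite /minus_form form_refl.
apply: (@unit_future_of_pos _ (refl R i *m base)); first by rewrite e.
  split; first by rewrite e; case: unit_base => -> _.
  by rewrite refl_mul form_root_base !mxE /=; lra.
by rewrite e mf_base; case: hz.
Qed.

Lemma hex_mx_unit w (z : 'cV[R]_3) : unit_future z -> unit_future (hex_mx R w *m z).
Proof.
elim: w => [|i w IH] hz /=; first by rewrite mul1mx.
by rewrite -mulmxA; apply: refl_unit; exact: IH.
Qed.

(** If every reflection lowered the height [t] by less than 2, the six inequalities would bound [p],
    [q] and [p + q] by [t + 1] in absolute value. Then [3 * (t ^+ 2 - 1) <= 2 * (t + 1) ^+ 2], that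
    is [t <= 5]. *)
Lemma unit_refl_descent (z : 'cV[R]_3) : unit_future z -> 5 < z i2 0 ->
  exists i, (refl R i *m z) i2 0 <= z i2 0 - 2.
Proof.
move=> [zz z2] z5; apply: contrapT => no.
have big i : form (root R i) z < 1.
  rewrite ltNge; apply/negP => h; apply: no; exists i.
  by rewrite refl_mul !mxE /=; lra.
have := (big (hex 0), big (hex 1), big (hex 2)).
have := (big (hex 3), big (hex 4), big (hex 5)).
move: zz; rewrite mfE !formE !mxE /=.
set a := z i0 0; set b := z i1 0; move: z5 {z2 big no}; set t := z i2 0.
move=> t5 zz [[h3 h4] h5] [[h0 h1] h2].
pose p := 2 * a - b; pose q := 2 * b - a; pose M := t + 1.
have pM : p ^+ 2 <= M ^+ 2 by rewrite /p /M; nra.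
have qM : q ^+ 2 <= M ^+ 2 by rewrite /q /M; nra.
have pqM : (p + q) ^+ 2 <= M ^+ 2 by rewrite /p /q /M; nra.
have e : 3 * (t ^+ 2 - 1) = 2 * (p ^+ 2 + p * q + q ^+ 2) by rewrite /p /q; lra.
have key : p ^+ 2 + p * q + q ^+ 2 <= M ^+ 2.
  case: (lerP 0 (p * q)) => pq; first by nra.
  case: (lerP (p ^+ 2) (q ^+ 2)) => c.
    have : p * (p + q) <= 0; last by nra.
    nra.
  have : q * (p + q) <= 0; last by nra.
  nra.
by rewrite /M in key; nra.
Qed.

Lemma hex_reach (z : 'cV[R]_3) : unit_future z ->
  exists w, (hex_mx R w *m z) i2 0 <= 5.
Proof.
move=> hz; have [n hn] : exists n : nat, z i2 0 <= 5 + 2 * n%:R.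
  exists (Num.bound (z i2 0)); have [_ z2] := hz.
  have := archi_boundP (ltW z2); have : 0 <= (Num.bound (z i2 0))%:R :> R by [].
  lra.
elim: n z hz hn => [|n IH] z hz hn.
  by exists [::]; rewrite mul1mx; move: hn; rewrite mulr0 addr0.
case: (leP (z i2 0) 5) => z5; first by exists [::]; rewrite mul1mx.
have [i hi] := unit_refl_descent hz z5.
have [|w hw] := IH _ (refl_unit i hz).
  by move: hn; rewrite -natr1; lra.
by exists (w ++ [:: i]); rewrite hex_mx_cat /= mulmx1 -mulmxA.
Qed.

Lemma rep_mf x (u v : 'cV[R]_3) : <<rep x *m u, rep x *m v>> = <<u, v>>.
Proof. by rewrite /minus_form rep_isometry. Qed.

Lemma rep_unit x z : unit_future z -> unit_future (rep x *m z).
Proof. exact: hex_mx_unit. Qed.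

Lemma rep_mf_l x (u v : 'cV[R]_3) : <<rep x *m u, v>> = <<u, rep x^-1%g *m v>>.
Proof. by rewrite /minus_form rep_form_l. Qed.

Lemma Gamma2_cocompact : exists C : R, 0 < C /\ forall z, unit_future z -> exists x, <<rep x *m base, z>> <= C.
Proof.
pose T i : R := <<hex_mx R (rev (hex_transversal i)) *m base, base>>.
(* The factor 10 is the 2 of [mf_triangle] times the height 5 of [hex_reach]; the sum bounds the
   contributions of all four cosets. *)
pose C := \sum_i 10 * T i.
have T1 i : 1 <= T i.
  by apply: mf_unit_ge1; [apply: hex_mx_unit|]; exact: unit_base.
have Tle i : 10 * T i <= C.
  rewrite /C (bigD1 i)//= lerDl sumr_ge0// => j _.
  by rewrite mulr_ge0// (le_trans ler01).
exists C; split.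
  by apply: lt_le_trans (Tle (false, false)); rewrite mulr_gt0// (lt_le_trans ltr01).
move=> z hz; have [w hw] := hex_reach hz.
set t := act_word schreier_act w (false, false, 1%g).
exists t.2^-1%g; rewrite rep_mf_l invgK -hex_mx_transversal -/t.
set tau := hex_transversal t.1.
rewrite hex_mx_cat -mulmxA.
have e : hex_mx R (rev tau) *m (hex_mx R tau *m (hex_mx R w *m z)) = hex_mx R w *m z.
  rewrite !hex_mx_mul -[RHS](act_word_revK (act := fun i (v : 'cV[R]_3) => refl R i *m v) _ tau)//.
  by move=> i v /=; rewrite mulmxA reflK mul1mx.
have -> : <<base, hex_mx R tau *m (hex_mx R w *m z)>> =
    <<hex_mx R (rev tau) *m base, hex_mx R w *m z>>.
  by rewrite /minus_form -[in LHS](hex_mx_isometry (rev tau)) e.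
apply: le_trans (Tle t.1).
have hb := unit_future_future unit_base.
have := @mf_triangle _ (hex_mx R (rev tau) *m base) base (hex_mx R w *m z).
case: unit_base => -> _; rewrite mul1r => h.
apply: le_trans (h _ _ _ _) _ => //.
- exact/unit_future_future/hex_mx_unit/unit_base.
- exact/unit_future_future/hex_mx_unit.
rewrite mf_base -/(T t.1); have := T1 t.1; nra.
Qed.

End Geometry.

(** * Properness of the action *)

Lemma inj_finite_set (T : Type) (U : finType) (A : set T) (g : T -> U) :
  (forall x y, A x -> A y -> g x = g y -> x = y) -> finite_set A.
Proof.
move=> gI; pose f x := if pselect (A x) then Some (g x) else None.
apply: (@sub_finite_set _ _ (f @^-1` [set y | y != None])).
  by move=> x Ax; rewrite /= /f; case: pselect.
apply: finite_preimage; last exact: finite_finset.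
move=> x y; rewrite !inE /= /f; case: pselect => // Ax _; case: pselect => // Ay _ [].
exact: gI.
Qed.

Section Proper.
Variable R : archiRcfType.
Local Notation base := (basepoint R).
Local Notation rep := (lorentz R).

Lemma map_rep (F F' : comNzRingType) (f : {rmorphism F -> F'}) x :
  map_mx f (lorentz F x) = lorentz F' x.
Proof. exact: map_hex_mx. Qed.

Lemma map_base (F F' : comNzRingType) (f : {rmorphism F -> F'}) :
  map_mx f (basepoint F) = basepoint F'.
Proof. by apply: vec3P; rewrite !mxE /= ?rmorph0 ?rmorph1. Qed.

(** Orbit points are integral vectors, and on the hyperboloid the height bounds all coordinates, so
    only finitely many orbit points are within a given distance; [rep_base_inj] recovers the group
    elements. *)
Lemma Gamma2_proper (C : R) : finite_set [set x | <<base, rep x *m base>> <= C].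
Proof.
pose y x : 'cV[int]_3 := lorentz int x *m basepoint int.
have yE x i : (rep x *m base) i 0 = (y x i 0)%:~R.
  by rewrite -(map_rep (intr : {rmorphism int -> R})) -(map_base (intr : {rmorphism int -> R})) -map_mxM mxE.
pose k := Num.bound `|C|.
have ybound x i : <<base, rep x *m base>> <= C -> `|y x i 0| <= k%:Z.
  move=> hC; have hx := rep_unit x (unit_base R).
  have Ck : C <= k%:R.
    by rewrite (le_trans (ler_norm _))// ltW// archi_boundP.
  rewrite -(ler_int R) intr_norm -yE -pmulrn.
  have [xx x2] := hx; rewrite mf_base in hC.
  move: xx; rewrite mfE; move: hC x2.
  set a := _ i0 0; set b := _ i1 0; set t := _ i2 0 => hC t0 xx.
  have h : (rep x *m base) i 0 ^+ 2 <= t ^+ 2.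
    have : [\/ i = i0, i = i1 | i = i2].
      by case: i => [[|[|[|//]]] h]; [apply: Or31 | apply: Or32 | apply: Or33]; exact/val_inj.
    by case=> ->; rewrite -?/a -?/b -?/t; nra.
  have tk : t <= k%:R by lra.
  rewrite -(@ler_pXn2r _ 2) ?nnegrE ?normr_ge0 ?ler0n// real_normK ?num_real//.
  apply: le_trans h _; rewrite ler_pXn2r ?nnegrE ?ler0n//; exact: ltW.
pose g x : {ffun 'I_3 -> 'I_(k + k).+1} := [ffun i => inord `|(y x i 0 + k%:Z)%R|%N].
apply: (inj_finite_set (g := g)) => x x' hx hx' gg.
apply: (@rep_base_inj R); apply/matrixP => i j; rewrite ord1 !yE; congr (_%:~R).
have := congr1 (fun f : {ffun 'I_3 -> 'I_(k + k).+1} => val (f i)) gg.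
have := ybound _ i hx; have := ybound _ i hx'.
rewrite !ffunE !ler_norml => /andP[a1 a2] /andP[b1 b2].
rewrite /= !inordK; lia.
Qed.

End Proper.

(** * Hyperbolic elements and sides of lines *)

Lemma finite_set_bound (R : realDomainType) (T : Type) (F : set T) (g : T -> R) :
  finite_set F -> exists2 C, 0 < C & forall x, F x -> g x <= C.
Proof.
move=> /(finite_image g) /finite_seqP[s sE].
exists (1 + \sum_(y <- s) `|y|).
  by rewrite ltr_pwDl// sumr_ge0.
move=> x Fx; have /= gs : [set` s]%classic (g x) by rewrite -sE; exists x.
rewrite (big_rem _ gs)/= addrCA (le_trans (ler_norm _))// lerDl.
by rewrite addr_ge0// sumr_ge0.
Qed.

Lemma expr_unbounded (R : archiRealFieldType) (l x : R) : 1 < l ->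
  exists n0 : nat, forall n, (n0 <= n)%N -> x < l ^+ n.
Proof.
move=> l1; have ber n : 1 + n%:R * (l - 1) <= l ^+ n.
  elim: n => [|n IH]; first by rewrite mul0r addr0 expr0.
  rewrite exprS -natr1; have : 0 <= n%:R * (l - 1) ^+ 2 by rewrite mulr_ge0// sqr_ge0.
  have : l * (1 + n%:R * (l - 1)) <= l * l ^+ n by rewrite ler_pM2l; lra.
  lra.
exists (Num.bound (`|x| / (l - 1))) => n hn.
apply: lt_le_trans (ber n).
have l10 : 0 < l - 1 by rewrite subr_gt0.
have : `|x| / (l - 1) < n%:R.
  apply: lt_le_trans (archi_boundP _) _; last by rewrite ler_nat.
  by rewrite divr_ge0// ltW.
rewrite ltr_pdivrMr//; have := ler_norm x; lra.
Qed.

Section Dynamics.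
Variable R : archiRcfType.
Local Notation base := (basepoint R).
Local Notation rep := (lorentz R).
Implicit Types (a b c x : Gamma2) (u v w z : 'cV[R]_3) (l : R).

Definition orbit_pt x := rep x *m base.

Lemma orbit_unit x : unit_future (orbit_pt x).
Proof. exact/rep_unit/unit_base. Qed.

Lemma orbit_future x : future (orbit_pt x).
Proof. exact/unit_future_future/orbit_unit. Qed.

Lemma mf_orbit_gt0 u x : null_ray u -> 0 < <<u, orbit_pt x>>.
Proof.
move=> nu; rewrite mfC mf_timelike_gt0//; [exact: orbit_future|exact: null_future|].
by case: (orbit_unit x) => ->.
Qed.

Lemma mf_null_sum u v : null_ray u -> null_ray v -> <<u + v, u + v>> = 2 * <<u, v>>.
Proof.
move=> [uu _] [vv _]; rewrite mfDl !mfDr uu vv (mfC v u); ring.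
Qed.

Lemma null_sum_future u v : null_ray u -> null_ray v -> future (u + v).
Proof.
move=> nu nv; split; last by rewrite mxE addr_gt0//; [case: nu|case: nv].
by rewrite mf_null_sum// mulr_ge0// mf_ge0//; exact: null_future.
Qed.

(* Three null rays: if the first two are distinct, closeness to the third is
   controlled by closeness to them. *)
Lemma mf_null_bound u v w z : null_ray u -> null_ray v -> null_ray w ->
  future z -> 0 < <<u, v>> ->
  <<w, z>> <= (<<u, w>> + <<v, w>>) / <<u, v>> * (<<u, z>> + <<v, z>>).
Proof.
move=> nu nv nw fz uv.
have := mf_triangle fz (null_sum_future nu nv) (null_future nw).
rewrite mf_null_sum// pmulr_rgt0// => /(_ uv).
rewrite mfDr mfDl => h; rewrite mulrAC ler_pdivlMr//.
by move: h; rewrite (mfC z u) (mfC z v) (mfC z w); lra.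
Qed.

Definition hyperbolic a u v l : Prop :=
  [/\ null_ray u, null_ray v, 1 < l, rep a *m u = l *: u & rep a *m v = l^-1 *: v].

Lemma rep_expg_eigen a u l n : rep a *m u = l *: u ->
  rep (a ^+ n)%g *m u = l ^+ n *: u.
Proof.
move=> e; elim: n => [|n IH]; first by rewrite expg0 rep1 mul1mx expr0 scale1r.
by rewrite expgSr repM -mulmxA e -scalemxAr IH scalerA exprS.
Qed.

Section Hyperbolic.
Variables (a : Gamma2) (u v : 'cV[R]_3) (l : R).
Hypothesis ha : hyperbolic a u v l.

Let nu : null_ray u. Proof. by case: ha. Qed.
Let nv : null_ray v. Proof. by case: ha. Qed.
Let l1 : 1 < l. Proof. by case: ha. Qed.
Let l0 : 0 < l. Proof. exact: lt_trans l1. Qed.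
Let ln0 n : 0 < l ^+ n. Proof. by rewrite exprn_gt0. Qed.

Lemma hyperbolic_mf_gt0 : 0 < <<u, v>>.
Proof.
rewrite lt_neqAle mf_ge0 ?andbT; try exact: null_future.
apply/eqP => /esym /(null_parallel nu nv) e.
have [_ u2] := nu; have [_ v2] := nv; have [_ _ _ eu ev] := ha.
have := congr1 (fun z : 'cV[R]_3 => (rep a *m z) i2 0) e.
rewrite -!scalemxAr eu ev !mxE [X in _ = _ * X]mulrC mulrCA [RHS]mulrA (mulrC (v i2 0)).
have p : 0 < u i2 0 * v i2 0 by rewrite mulr_gt0.
rewrite [RHS]mulrC => /(mulIf (lt0r_neq0 p)) => h.
have : l^-1 < 1 by rewrite invf_lt1.
by rewrite -h ltNge ltW.
Qed.

Lemma mf_attract n z : <<u, rep (a ^+ n)%g *m z>> = (l ^+ n)^-1 * <<u, z>>.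
Proof.
have [_ _ _ eu _] := ha.
rewrite -[X in _ = _ * X](rep_mf (a ^+ n)%g) (rep_expg_eigen n eu) mfZl.
by rewrite mulKf// gt_eqF.
Qed.

Lemma mf_repel n z : <<v, rep (a ^+ n)%g *m z>> = l ^+ n * <<v, z>>.
Proof.
have [_ _ _ _ ev] := ha.
rewrite -[X in _ = _ * X](rep_mf (a ^+ n)%g) (rep_expg_eigen n ev) mfZl.
by rewrite exprVn mulrA mulfV ?mul1r// gt_eqF.
Qed.

Lemma mf_attractV n z : <<u, rep (a ^- n)%g *m z>> = l ^+ n * <<u, z>>.
Proof.
by rewrite -[in RHS](repKV (a ^+ n)%g z) mf_attract mulVKf// gt_eqF.
Qed.

Lemma mf_repelV n z : <<v, rep (a ^- n)%g *m z>> = (l ^+ n)^-1 * <<v, z>>.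
Proof.
by rewrite -[in RHS](repKV (a ^+ n)%g z) mf_repel mulKf// gt_eqF.
Qed.

(** Points inside a horoball at [u] and near the axis are near the positive powers of [a]. Pull [x]
    back by [a ^- n], with [n] the last exponent keeping the pairing with [u] at most [C]; then the
    pairing with [v] is at most [l], and a point with both pairings bounded is near the
    basepoint. *)
Lemma near_ray C : exists F : set Gamma2, finite_set F /\ forall x,
  <<u, orbit_pt x>> <= C -> <<u, orbit_pt x>> * <<v, orbit_pt x>> <= C ->
  exists k : nat, F (a ^- k * x)%g.
Proof.
pose m := <<u, v>>; have m0 : 0 < m by exact: hyperbolic_mf_gt0.
exists [set y | <<base, orbit_pt y>> <= (<<u, base>> + <<v, base>>) / m * (`|C| + l)]%classic.
split; first exact: Gamma2_proper.
move=> x hC huv.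
have ux := mf_orbit_gt0 x nu; have vx := mf_orbit_gt0 x nv.
have C0 : 0 < C by exact: lt_le_trans hC.
have exn : exists n, C < l ^+ n * <<u, orbit_pt x>>.
  have [n hn] := expr_unbounded (C / <<u, orbit_pt x>>) l1.
  by exists n; have := hn n (leqnn n); rewrite ltr_pdivrMr.
case: (ex_minnP exn) => [[|n]] hn nmin; first by move: hn; rewrite expr0 mul1r ltNge hC.
exists n; rewrite /= mfC.
have uy : <<u, orbit_pt (a ^- n * x)%g>> <= C.
  rewrite /orbit_pt repM -mulmxA mf_attractV leNgt; apply/negP => /nmin.
  by rewrite ltnn.
have vy : <<v, orbit_pt (a ^- n * x)%g>> <= l.
  rewrite /orbit_pt repM -mulmxA mf_repelV -/(orbit_pt x).
  rewrite ler_pdivrMl//.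
  rewrite -(ler_pM2l ux); apply: le_trans huv _.
  by rewrite -exprSr mulrC ltW.
have y0 := orbit_future (a ^- n * x)%g.
set y := orbit_pt (a ^- n * x)%g in uy vy y0 *.
have bf := unit_future_future (unit_base R).
have := mf_triangle y0 (null_sum_future nu nv) bf.
rewrite mf_null_sum// pmulr_rgt0// => /(_ m0).
rewrite mfDr mfDl -/m (mfC y u) (mfC y v) => h; rewrite mulrAC ler_pdivlMr//.
have ub : 0 < <<u, base>> by rewrite -[base]mul1mx -(rep1 R); exact: mf_orbit_gt0.
have vb : 0 < <<v, base>> by rewrite -[base]mul1mx -(rep1 R); exact: mf_orbit_gt0.
have : (<<u, base>> + <<v, base>>) * (<<u, y>> + <<v, y>>) <= (<<u, base>> + <<v, base>>) * (`|C| + l).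
  rewrite ler_pM2l; last by lra.
  have := ler_norm C; lra.
lra.
Qed.

(** All lines ending at [u] are asymptotic there, so the points [a ^+ k * f] stay near the line from
    [u] to any other point at infinity [w]. *)
Lemma ray_bounded w (F : set Gamma2) : null_ray w -> finite_set F ->
  exists C, forall k f, F f ->
    <<u, orbit_pt (a ^+ k * f)%g>> * <<w, orbit_pt (a ^+ k * f)%g>> <= C.
Proof.
move=> nw fF; pose m := <<u, v>>; have m0 : 0 < m by exact: hyperbolic_mf_gt0.
pose c := (<<u, w>> + <<v, w>>) / m.
have c0 : 0 <= c by rewrite divr_ge0 ?addr_ge0 ?mf_ge0 ?(ltW m0)//; exact: null_future.
have [U U0 hU] := finite_set_bound (fun f => <<u, orbit_pt f>>) fF.
have [V V0 hV] := finite_set_bound (fun f => <<v, orbit_pt f>>) fF.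
exists (c * (U * U + U * V)) => k f Ff.
set z := orbit_pt (a ^+ k * f)%g.
have uz := mf_orbit_gt0 (a ^+ k * f)%g nu; have vz := mf_orbit_gt0 (a ^+ k * f)%g nv.
have := mf_null_bound nu nv nw (orbit_future (a ^+ k * f)%g) m0.
rewrite -/z -/m -/c in uz vz * => h.
have uzE : <<u, z>> = (l ^+ k)^-1 * <<u, orbit_pt f>> by rewrite /z /orbit_pt repM -mulmxA mf_attract.
have vzE : <<v, z>> = l ^+ k * <<v, orbit_pt f>> by rewrite /z /orbit_pt repM -mulmxA mf_repel.
have uf := mf_orbit_gt0 f nu; have vf := mf_orbit_gt0 f nv.
have uvE : <<u, z>> * <<v, z>> = <<u, orbit_pt f>> * <<v, orbit_pt f>>.
  by rewrite uzE vzE mulrACA mulVf ?mul1r// gt_eqF.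
have uU : <<u, z>> <= U.
  rewrite uzE ler_pdivrMl//; apply: le_trans (hU f Ff) _.
  by rewrite ler_peMl ?(ltW U0)// exprn_ege1// ltW.
have uvU : <<u, z>> * <<v, z>> <= U * V.
  by rewrite uvE ler_pM ?(ltW uf) ?(ltW vf)//; [exact: hU|exact: hV].
have : <<u, z>> * <<w, z>> <= <<u, z>> * (c * (<<u, z>> + <<v, z>>)) by rewrite ler_pM2l.
move=> h1; apply: le_trans h1 _.
rewrite mulrCA; apply: ler_wpM2l => //.
by rewrite mulrDr lerD// ler_pM// ltW.
Qed.

(** The powers leave every horoball at [w]: in [mf_triangle] from [w] to [u] through the orbit point
    of [a ^+ n], the pairing of that point with [u] decays like [l ^- n]. *)
Lemma ray_growth w K : null_ray w -> 0 < <<w, u>> ->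
  exists n0 : nat, forall n, (n0 <= n)%N -> K < <<w, orbit_pt (a ^+ n)%g>>.
Proof.
move=> nw wu; have ub : 0 < <<u, base>>.
  by rewrite -[base]mul1mx -(rep1 R); exact: mf_orbit_gt0.
have [n0 hn0] := expr_unbounded (K * 2 * <<u, base>> / <<w, u>>) l1.
exists n0 => n /hn0; rewrite ltr_pdivrMr// => hn.
have [o1 _] := orbit_unit (a ^+ n)%g.
have := mf_triangle (null_future nw) (orbit_future (a ^+ n)%g) (null_future nu).
rewrite o1 mul1r ltr01 => /(_ isT).
rewrite (mfC (orbit_pt _) u) {2}/orbit_pt mf_attract => h.
have : l ^+ n * <<w, u>> <= 2 * <<w, orbit_pt (a ^+ n)%g>> * <<u, base>>.
  rewrite -ler_pdivlMl//; apply: le_trans h _.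
  by rewrite mulrCA.
move=> h1; have := lt_le_trans hn h1.
by rewrite ltr_pM2r// (mulrC 2) ltr_pM2r.
Qed.

End Hyperbolic.
End Dynamics.

Section Crossing.
Variable R : realFieldType.
Variables u v : 'cV[R]_3.
Hypothesis (nu : null_ray u) (nv : null_ray v).
Let m := <<u, v>>.
Hypothesis m_gt0 : 0 < m.

Lemma mf_pos_comb_gt0 p q (a b : R) : unit_future p -> unit_future q ->
  0 <= a -> 0 <= b -> 0 < a + b -> 0 < a ^+ 2 + b ^+ 2 + 2 * a * b * <<p, q>>.
Proof.
move=> hp hq a0 b0 ab; have := mf_unit_ge1 hp hq; set t := <<p, q>> => t1.
have : 0 < (a + b) ^+ 2 by rewrite exprn_gt0.
have : 0 <= a * b * (t - 1) by rewrite !mulr_ge0// subr_ge0.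
lra.
Qed.

(** The segment from [p] to [q] meets the line in the direction of [x], and [x] is no farther from
    [p] than [q] is. Hence [<<p, q>>] controls the distance from [p] to the line. *)
Lemma crossing_bound p q : unit_future p -> unit_future q ->
  tri u v p * tri u v q <= 0 -> <<u, p>> * <<v, p>> <= 2 * m * <<p, q>> ^+ 2.
Proof.
move=> hp hq pq; have t1 := mf_unit_ge1 hp hq; set t := <<p, q>> in t1 *.
have fp := unit_future_future hp; have fq := unit_future_future hq.
case: (hp) => p1 _; case: (hq) => q1 _.
have sp := tri_sqr nu nv p; have t2 : 1 <= t ^+ 2 by rewrite exprn_ege1.
have [p0|p0] := eqVneq (tri u v p) 0.
  have h : 2 * (<<u, p>> * <<v, p>>) = m.
    by apply: (mulfI (lt0r_neq0 m_gt0)); move: sp; rewrite p0 p1 -/m; lra.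
  have : m <= m * t ^+ 2 by rewrite ler_peMr// ltW.
  have : 0 <= m by exact: ltW.
  by move: h; rewrite -/t; lra.
pose a := `|tri u v q|; pose b := `|tri u v p|.
have b0 : 0 < b by rewrite normr_gt0.
have a0 : 0 <= a by rewrite normr_ge0.
pose x := a *: p + b *: q.
have tx : tri u v x = 0.
  rewrite /x triDr !triZr /a /b; move: pq p0.
  case: (ltrgt0P (tri u v p)) => // ? pq _.
    have : tri u v q <= 0 by rewrite -(pmulr_rle0 _ (x := tri u v p)).
    by move=> h; rewrite ler0_norm//; ring.
  have : 0 <= tri u v q by rewrite -(nmulr_rle0 _ (x := tri u v p)).
  by move=> h; rewrite ger0_norm//; ring.
have X0 := mf_pos_comb_gt0 hp hq a0 (ltW b0) (ltr_wpDl a0 b0).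
have xx : <<x, x>> = a ^+ 2 + b ^+ 2 + 2 * a * b * t.
  by rewrite /x mfDl !mfDr !mfZl !mfZr p1 q1 (mfC q p) -/t; ring.
rewrite -/t -xx in X0; set X := <<x, x>> in xx X0.
have fx : future x.
  split; first exact: ltW.
  by rewrite /x !mxE ltr_wpDl ?mulr_ge0 ?mulr_gt0//; [case: hp => _ /ltW|case: hq].
have px : <<p, x>> = a + b * t by rewrite /x mfDr !mfZr p1 mulr1.
have hu := mf_triangle fp fx (null_future nu) X0.
have hv := mf_triangle fp fx (null_future nv) X0.
have := tri_sqr nu nv x; rewrite tx -/X expr0n /= mulr0 addr0 -/m => sx.
have ux : 0 <= <<x, u>> by rewrite mf_ge0//; exact: null_future.
have vx : 0 <= <<x, v>> by rewrite mf_ge0//; exact: null_future.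
have up : 0 <= <<p, u>> by rewrite mf_ge0//; exact: null_future.
have vp : 0 <= <<p, v>> by rewrite mf_ge0//; exact: null_future.
have hh : X * <<p, u>> * (X * <<p, v>>) <= 2 * <<p, x>> * <<x, u>> * (2 * <<p, x>> * <<x, v>>).
  by apply: ler_pM => //; rewrite mulr_ge0// ltW.
have px0 : 0 <= <<p, x>> by rewrite mf_ge0.
have sx' : 2 * (<<x, u>> * <<x, v>>) = m * X.
  apply: (mulfI (lt0r_neq0 m_gt0)); rewrite (mfC x u) (mfC x v).
  by move: sx; rewrite -/m; lra.
have key : X * (X * (<<p, u>> * <<p, v>>)) <= X * (2 * m * <<p, x>> ^+ 2).
  have -> : X * (2 * m * <<p, x>> ^+ 2) = 2 * <<p, x>> ^+ 2 * (m * X) by ring.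
  rewrite -sx'; lra.
rewrite ler_pM2l// in key.
rewrite (mfC u) (mfC v) -(ler_pM2l X0); apply: le_trans key _.
rewrite [leRHS]mulrCA ler_pM2l ?mulr_gt0// px xx.
have : 0 <= (t ^+ 2 - 1) * (a ^+ 2 + 2 * a * b * t).
  rewrite mulr_ge0 ?subr_ge0// addr_ge0 ?sqr_ge0// !mulr_ge0// ?(ltW b0)//; lra.
lra.
Qed.

End Crossing.

(** * Coarse invariants of a group and their geometric meaning *)

Section CoarseInvariants.
Variable G : groupType.
Implicit Types (H S F : set G) (a b c d x y : G).

(** Up to a finite set, the positive powers of [b] follow those of [a]: the coarse form of having
    the same attracting point. *)
Definition same_end a b : Prop :=
  exists F, finite_set F /\ forall n : nat, exists k : nat, F (a ^- k * b ^+ n)%g.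

Definition avoids H F a b x : Prop :=
  H x /\ forall k : nat, ~ F (a ^- k * x)%g /\ ~ F (b ^- k * x)%g.

(* [c ^+ n] and [d ^+ n] lie on the same side of the broken line formed by the
   positive powers of [a] and of [b]. *)
Definition joined H a b c d : Prop :=
  exists S, [/\ finite_set S, (S `<=` H)%classic & forall F, finite_set F -> (F `<=` H)%classic ->
    exists n : nat, linked (avoids H F a b) (fun x y => S (x^-1 * y)%g)
      (c ^+ n)%g (d ^+ n)%g].

Lemma finite_index_transversal H : finite_index_subgroup H ->
  exists T, finite_set T /\ forall x, exists h t, [/\ H h, T t & x = (h * t)%g].
Proof.
move=> [gH fH]; pose r (A : set G) := (xget 1%g A)^-1%g.
exists [set r A | A in range (@left_coset G ^~ H)]%classic; split; first exact: finite_image.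
move=> x; have := @xgetPex _ 1%g (left_coset x^-1%g H).
have : exists y, left_coset x^-1%g H y.
  by exists x^-1%g; exists 1%g; rewrite ?mulg1//; exact: subgroup1.
move=> ex /(_ ex) [h Hh e]; exists h, (r (left_coset x^-1%g H)); split.
- by [].
- by exists (left_coset x^-1%g H) => //; exists x^-1%g.
- by rewrite /r -e invgM invgK mulVKg.
Qed.

End CoarseInvariants.

Section Sides.
Variable R : archiRcfType.
Local Notation base := (basepoint R).
Local Notation rep := (lorentz R).
Local Notation orbit := (orbit_pt R).
Implicit Types (a b c d x : Gamma2) (u v w z : 'cV[R]_3) (l : R).

Lemma opposite_comb (s t : R) : s * t <= 0 -> `|t| * s + `|s| * t = 0.
Proof.
case: (ltrgt0P s) => [s0 st|s0 st|-> _]; last by rewrite mulr0 mul0r addr0.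
  have t0 : t <= 0 by rewrite -(pmulr_rle0 _ s0).
  by rewrite ler0_norm//; ring.
have t0 : 0 <= t by rewrite -(nmulr_rle0 _ s0).
by rewrite ger0_norm//; ring.
Qed.

(** By [ray_growth] both pairings tend to infinity. If the orbit point were on the side opposite to
    [w], a combination of the two would lie on the line, and [tri_sqr] for it fails once both
    pairings exceed [K]. *)
Lemma side_of_powers u v c w w' l (D : R) : null_ray u -> null_ray v -> 0 < <<u, v>> ->
  hyperbolic c w w' l -> 0 < <<u, w>> -> 0 < <<v, w>> ->
  exists n0 : nat, forall n, (n0 <= n)%N ->
    0 < tri u v w * tri u v (orbit (c ^+ n)%g) /\
    D < <<u, orbit (c ^+ n)%g>> * <<v, orbit (c ^+ n)%g>>.
Proof.
move=> nu nv m0 hc uw vw; set m := <<u, v>> in m0.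
have [nw _ l1 _ _] := hc.
have wb : 0 < <<w, base>> by rewrite -[base]mul1mx -(rep1 R); exact: mf_orbit_gt0.
(* The summands make [f] and [g] exceed 1, make [f * g] exceed [D] and [m], and give
   [m * <<w, z>> < f * <<v, w>>]. *)
pose K := 1 + `|D| + m + m * <<w, base>> / <<v, w>>.
have [n1 hn1] := ray_growth hc K nu uw.
have [n2 hn2] := ray_growth hc K nv vw.
exists (maxn n1 n2) => n; rewrite geq_max => /andP[/hn1 fK /hn2 gK].
set z := orbit (c ^+ n)%g in fK gK *.
set f := <<u, z>> in fK *; set g := <<v, z>> in gK *.
have q0 : 0 < m * <<w, base>> / <<v, w>> by rewrite divr_gt0 ?mulr_gt0.
have D0 : 0 <= `|D| by [].
have f1 : 1 < f by rewrite /K in fK; lra.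
have g1 : 1 < g by rewrite /K in gK; lra.
have ff : f < f * g by rewrite ltr_pMr// (lt_trans ltr01).
have fg : m < f * g by rewrite /K in fK; lra.
split; last by have := ler_norm D; rewrite /K in fK; lra.
have wz : <<w, z>> <= <<w, base>>.
  rewrite /z /orbit_pt (mf_attract hc) ler_pdivrMl ?exprn_gt0 ?(lt_trans ltr01)//.
  by rewrite ler_peMl ?(ltW wb)// exprn_ege1// ltW.
have fvw : m * <<w, z>> < f * <<v, w>>.
  apply: (@le_lt_trans _ _ (m * <<w, base>>)); first by rewrite ler_pM2l.
  by rewrite -ltr_pdivrMr//; rewrite /K in fK; lra.
rewrite ltNge; apply/negP => /opposite_comb.
have := tri_sqr nu nv w; have [ww _] := nw; rewrite ww mulr0 add0r -/m => tw.
have b0 : 0 < `|tri u v w|.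
  rewrite normr_gt0; apply/eqP => e; move: tw; rewrite e expr0n /= mulr0 => /eqP.
  by rewrite gt_eqF// !mulr_gt0.
set al := `|tri u v z|; set be := `|tri u v w| in b0 * => e.
have al0 : 0 <= al by exact: normr_ge0.
have := tri_sqr nu nv (al *: w + be *: z).
rewrite triDr !triZr e expr0n /= mulr0 addr0 -/m.
rewrite mfDl !mfDr !mfZl !mfZr ww (mfC z w).
have [-> _] : unit_future z by exact: orbit_unit.
rewrite -/f -/g => E.
have E' : 2 * ((al * <<u, w>> + be * f) * (al * <<v, w>> + be * g)) =
    m * (2 * al * be * <<w, z>> + be ^+ 2).
  by apply: (mulfI (lt0r_neq0 m0)); lra.
have t1 : 0 <= al * be * (f * <<v, w>> - m * <<w, z>>).
  by apply: mulr_ge0; [apply: mulr_ge0 => //; exact: ltW|rewrite subr_ge0 ltW].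
have t2 : 0 < be ^+ 2 * (2 * (f * g) - m).
  by rewrite mulr_gt0 ?exprn_gt0// subr_gt0; lra.
have t3 : 0 <= al ^+ 2 * (<<u, w>> * <<v, w>>) 
  by rewrite mulr_ge0 ?sqr_ge0// ltW// mulr_gt0.
have t4 : 0 <= al * be * (<<u, w>> * g) 
  by apply: mulr_ge0; [apply: mulr_ge0 => //|apply: mulr_ge0]; apply: ltW => //; apply: lt_trans g1.
lra.
Qed.

(** If the attracting points differ, powers of [b] leave every horoball at [u], whereas the sets
    [a ^+ k * F] stay in one. If they agree, [ray_bounded] puts the powers of [b] near the axis of
    [a], and [near_ray] concludes. *)
Lemma same_endP a b u u' l v v' l' : hyperbolic a u u' l -> hyperbolic b v v' l' ->
  same_end a b <-> <<u, v>> = 0.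
Proof.
move=> ha hb; have [nu nu' _ _ _] := ha; have [nv nv' _ _ _] := hb.
split=> [[F [fF hF]]|uv].
  apply/eqP; rewrite eq_le mf_ge0 ?andbT; try exact: null_future.
  rewrite leNgt; apply/negP => uv.
  have [C C0 hC] := finite_set_bound (fun f => <<u, orbit f>>) fF.
  have [n hn] := ray_growth hb C nu uv.
  have [k hk] := hF n; have := hn n (leqnn n).
  rewrite ltNge => /negP; apply.
  rewrite -[(b ^+ n)%g](mulVKg (a ^+ k)%g) /orbit_pt repM -mulmxA (mf_attract ha).
  have lk : 1 <= l ^+ k by have [_ _ l1 _ _] := ha; rewrite exprn_ege1// ltW.
  rewrite ler_pdivrMl ?(lt_le_trans ltr01)//.
  by apply: le_trans (hC _ hk) _; rewrite ler_peMl// ltW.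
have [C1 hC1] := @ray_bounded _ b v v' l' hb u' [set 1%g]%classic nu' (finite_set1 _).
have vb : 0 < <<v, base>> by rewrite -[base]mul1mx -(rep1 R); exact: mf_orbit_gt0.
pose k := u i2 0 / v i2 0.
have [_ u2] := nu; have [_ v2] := nv; have k0 : 0 < k by rewrite divr_gt0.
have uE : u = k *: v.
  apply: (scalerI (lt0r_neq0 v2)); rewrite (null_parallel nu nv uv) scalerA; congr (_ *: _).
  by rewrite /k mulrC divfK// gt_eqF.
have [F [fF hF]] := near_ray ha (Num.max (k * <<v, base>>) (k * C1)).
exists F; split=> // n; apply: hF; rewrite le_max uE mfZl.
  apply/orP; left; rewrite ler_pM2l// /orbit_pt (mf_attract hb).
  have lk : 1 <= l' ^+ n by have [_ _ l1 _ _] := hb; rewrite exprn_ege1// ltW.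
  by rewrite ler_pdivrMl ?(lt_le_trans ltr01)// ler_peMl// ltW.
by apply/orP; right; rewrite -mulrA ler_pM2l// -{1 2}[(b ^+ n)%g]mulg1; apply: hC1.
Qed.

End Sides.

Lemma joinedC (G : groupType) (H : set G) (a b c d : G) : joined H a b c d -> joined H b a c d.
Proof.
move=> [S [fS SH hS]]; exists S; split=> // F fF FH; have [n hn] := hS F fF FH.
exists n; apply: (linked_map (f := id)) hn => // x [Hx av]; split=> // k.
by have [] := av k.
Qed.

Lemma triC (R : realFieldType) (u v w : 'cV[R]_3) : tri v u w = - tri u v w.
Proof. by rewrite /tri; ring. Qed.

Section Joined.
Variable R : archiRcfType.
Local Notation base := (basepoint R).
Local Notation rep := (lorentz R).
Local Notation orbit := (orbit_pt R).
Implicit Types (a b c d x : Gamma2) (u v w z : 'cV[R]_3) (l : R).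

(** Two factors with product at most [K >= 1] are not both above [K], so the point is in a horoball
    at [u] or at [v]. There the line is asymptotic to the axis of [a] or of [b], as [mf_null_bound]
    expresses, and [near_ray] applies. *)
Lemma near_line a b u u' l v v' l' (C : R) : hyperbolic a u u' l -> hyperbolic b v v' l' ->
  0 < <<u, v>> -> exists F : set Gamma2, finite_set F /\ forall x,
    <<u, orbit x>> * <<v, orbit x>> <= C ->
    exists k : nat, F (a ^- k * x)%g \/ F (b ^- k * x)%g.
Proof.
move=> ha hb uv; have [nu nu' _ _ _] := ha; have [nv nv' _ _ _] := hb.
pose K := `|C| + 1; have K0 : 0 < K by rewrite ltr_wpDl.
pose cf w := (<<u, w>> + <<v, w>>) / <<u, v>>.
have cf0 w : null_ray w -> 0 <= cf w.
  by move=> nw; rewrite divr_ge0 ?(ltW uv)// addr_ge0// mf_ge0//; exact: null_future.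
pose M w := K + cf w * (K ^+ 2 + K).
have MK w : null_ray w -> K <= M w.
  by move=> /cf0 ?; rewrite lerDl mulr_ge0// addr_ge0 ?sqr_ge0// ltW.
have [Fa [fFa hFa]] := near_ray ha (M u').
have [Fb [fFb hFb]] := near_ray hb (M v').
exists (Fa `|` Fb)%classic; split; first by rewrite finite_setU.
move=> x; set z := orbit x => fg.
have f0 := mf_orbit_gt0 x nu; have g0 := mf_orbit_gt0 x nv.
rewrite -/z in f0 g0; have fz : future z by exact: orbit_future.
have fgK : <<u, z>> * <<v, z>> <= K.
  by apply: le_trans fg _; rewrite /K; have := ler_norm C; lra.
have bound w (p q : R) : null_ray w -> <<w, z>> <= cf w * (p + q) -> 0 < p -> p <= K -> p * q <= K ->
    p * <<w, z>> <= M w.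
  move=> nw h p0 pK pq; apply: (@le_trans _ _ (p * (cf w * (p + q)))).
    by rewrite ler_pM2l.
  rewrite mulrCA mulrDr /M; apply: (@le_trans _ _ (cf w * (K ^+ 2 + K))); last by rewrite lerDr ltW.
  apply: ler_wpM2l; first exact: cf0.
  by rewrite lerD// -expr2 ler_pXn2r// nnegrE ltW.
have bu := mf_null_bound nu nv nu' fz uv; have bv := mf_null_bound nu nv nv' fz uv.
case: (lerP <<u, z>> K) => fK.
  have [||k hk] := hFa x; last by exists k; left; left.
    by apply: le_trans fK _; exact: MK.
  by apply: (bound u' <<u, z>> <<v, z>>).
have gK : <<v, z>> <= K.
  have K1 : 1 <= K by rewrite lerDr.
  rewrite leNgt; apply/negP => gK.
  have : K * K < <<u, z>> * <<v, z>> by rewrite ltr_pM ?(ltW K0).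
  by rewrite ltNge (le_trans fgK)// ler_peMr// ltW.
have [||k hk] := hFb x; last by exists k; right; right.
  by apply: le_trans gK _; exact: MK.
apply: (bound v' <<v, z>> <<u, z>>) => //; first by rewrite addrC.
by rewrite mulrC.
Qed.

Section FiniteIndex.
Variable H : set Gamma2.
Hypothesis iH : finite_index_subgroup H.
Let gH : group_closed (mem H). Proof. by case: iH. Qed.

Let HX x n : H x -> H (x ^+ n)%g.
Proof.
move=> Hx; elim: n => [|n IH]; first by rewrite expg0; exact: subgroup1.
by rewrite expgS; exact: subgroupM.
Qed.

Lemma finite_index_cocompact : exists C : R, 1 <= C /\
  forall z, unit_future z -> exists h, H h /\ <<orbit h, z>> <= C.
Proof.
have [C0 [C0_gt0 hC0]] := Gamma2_cocompact R.
have [T [fT hT]] := finite_index_transversal iH.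
have [C1 C1_gt0 hC1] := finite_set_bound (fun t => <<base, orbit t>>) fT.
exists (1 + 2 * C1 * C0); split.
  by rewrite lerDl !mulr_ge0 ?ltW.
move=> z hz; have [x hx] := hC0 z hz; have [h [t [Hh Tt xE]]] := hT x.
exists h; split=> //.
have := mf_triangle (orbit_future R h) (orbit_future R x) (unit_future_future hz).
case: (orbit_unit R x) => -> _; rewrite mul1r ltr01 => /(_ isT) le1.
apply: le_trans le1 _.
have ht : <<orbit h, orbit x>> <= C1.
  by rewrite xE /orbit_pt repM -mulmxA rep_mf; exact: hC1.
have ? : 0 <= <<orbit x, z>> by rewrite mf_ge0//; [exact: orbit_future|exact: unit_future_future].
have ? : 0 <= <<orbit h, orbit x>> by rewrite mf_ge0//; exact: orbit_future.
have : <<orbit h, orbit x>> * <<orbit x, z>> <= C1 * C0 by rewrite ler_pM.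
lra.
Qed.

(** The path of [half_plane_linked] is replaced by nearby elements of [H]. The step set depends only
    on the cocompactness constant [K]; the obstacle [F] only decides how deep in the half-plane the
    path runs. *)
Lemma joined_same_side a b c d u u' v v' w w' y y' l1 l2 l3 l4 :
  hyperbolic a u u' l1 -> hyperbolic b v v' l2 ->
  hyperbolic c w w' l3 -> hyperbolic d y y' l4 -> H c -> H d ->
  0 < <<u, v>> -> 0 < <<u, w>> -> 0 < <<v, w>> -> 0 < <<u, y>> -> 0 < <<v, y>> ->
  0 < tri u v w -> 0 < tri u v y -> joined H a b c d.
Proof.
move=> ha hb hc hd Hc Hd uv uw vw uy vy tw ty.
have [nu nu' _ _ _] := ha; have [nv nv' _ _ _] := hb.
set m := <<u, v>> in uv.
have [K [K1 hK]] := finite_index_cocompact.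
have K0 : 0 < K by exact: lt_le_trans K1.
(* Two uses of [mf_triangle] along [x], [z], [z'], [x'] give [2 * (2 * K * 2) * K]. *)
pose T := 8 * K ^+ 2.
exists (H `&` [set s | <<base, orbit s>> <= T])%classic; split.
- by apply: sub_finite_set (Gamma2_proper T) => x [].
- by move=> x [].
move=> F fF FH.
have [Da hDa] := ray_bounded ha nv fF; have [Db hDb] := ray_bounded hb nu fF.
pose D := `|Da| + `|Db|; have D0 : 0 <= D by rewrite addr_ge0.
(* An orbit point within [K] of a point of depth at least [l0] then has product of pairings above
   [D], which bounds this product on the translates of [F] along both rays. *)
pose l0 := 1 + 8 * m * K ^+ 2 * D.
have K2 : 0 < K ^+ 2 by rewrite exprn_gt0.
have l0_ge1 : 1 <= l0 by rewrite lerDl !mulr_ge0// ltW.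
(* By [tri_sqr] this is the product of pairings of a unit vector at depth exactly [l0]. *)
have [n1 hn1] := side_of_powers ((3 * l0 ^+ 2 + m ^+ 2) / (2 * m)) nu nv uv hc uw vw.
have [n2 hn2] := side_of_powers ((3 * l0 ^+ 2 + m ^+ 2) / (2 * m)) nu nv uv hd uy vy.
exists (maxn n1 n2).
have deep x s : 0 < s -> 0 < s * tri u v (orbit x) ->
    (3 * l0 ^+ 2 + m ^+ 2) / (2 * m) < <<u, orbit x>> * <<v, orbit x>> -> l0 <= tri u v (orbit x).
  move=> s0; rewrite (pmulr_rgt0 _ s0) => t0; rewrite ltr_pdivrMr ?mulr_gt0// => h.
  have := tri_sqr nu nv (orbit x); case: (orbit_unit R x) => -> _; rewrite mulr1 -/m => e.
  rewrite -(@ler_pXn2r _ 2) ?nnegrE ?(ltW t0)//; last by rewrite (le_trans ler01).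
  lra.
have [s1 b1] := hn1 _ (leq_maxl n1 n2); have [s2 b2] := hn2 _ (leq_maxr n1 n2).
have lc := deep _ _ tw s1 b1; have ld := deep _ _ ty s2 b2.
have l00 : 0 < l0 by exact: lt_le_trans l0_ge1.
have path := half_plane_linked nu nv uv l00 (orbit_unit R _) (orbit_unit R _) lc ld.
have avoid x z : H x -> unit_future z -> l0 <= tri u v z -> <<orbit x, z>> <= K -> avoids H F a b x.
  move=> Hx hz lz xz.
  have fz := unit_future_future hz; have fx := orbit_future R x.
  have x1 : <<orbit x, orbit x>> = 1 by case: (orbit_unit R x).
  have far : D < <<u, orbit x>> * <<v, orbit x>>.
    have := mf_triangle fz fx (null_future nu); have := mf_triangle fz fx (null_future nv).
    rewrite x1 !mul1r ltr01 => /(_ isT) hv /(_ isT) hu.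
    have := tri_sqr nu nv z; have [-> _] := hz; rewrite mulr1 -/m => e.
    have l02 : l0 <= l0 ^+ 2 by rewrite expr2 ler_peMl// ltW.
    have tz : l0 ^+ 2 <= tri u v z ^+ 2.
      by rewrite ler_pXn2r// nnegrE ?(ltW l00)// (le_trans (ltW l00)).
    have pu := mf_orbit_gt0 x nu; have pv := mf_orbit_gt0 x nv.
    have zx : <<z, orbit x>> <= K by rewrite mfC.
    have zx0 : 0 <= <<z, orbit x>> by rewrite mf_ge0.
    have hu' : <<u, z>> <= 2 * K * <<u, orbit x>>.
      rewrite mfC; apply: le_trans hu _; rewrite (mfC (orbit x)) ler_pM2r//.
      by rewrite ler_pM2l.
    have hv' : <<v, z>> <= 2 * K * <<v, orbit x>>.
      rewrite mfC; apply: le_trans hv _; rewrite (mfC (orbit x)) ler_pM2r//.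
      by rewrite ler_pM2l.
    have uz0 : 0 <= <<u, z>> by rewrite mf_ge0//; exact: null_future.
    have vz0 : 0 <= <<v, z>> by rewrite mf_ge0//; exact: null_future.
    have := ler_pM uz0 vz0 hu' hv'.
    set p := <<u, orbit x>> * <<v, orbit x>>.
    have -> : 2 * K * <<u, orbit x>> * (2 * K * <<v, orbit x>>) = 4 * K ^+ 2 * p.
      by rewrite /p; ring.
    move=> h.
    have h2 : 2 * m * (<<u, z>> * <<v, z>>) <= 2 * m * (4 * K ^+ 2 * p).
      by rewrite ler_pM2l// mulr_gt0.
    have mm : 0 <= m ^+ 2 by exact: sqr_ge0.
    have h3 : 8 * m * K ^+ 2 * D < 8 * m * K ^+ 2 * p by rewrite /l0 in l02 tz l0_ge1; lra.
    by rewrite ltr_pM2l in h3; rewrite ?mulr_gt0.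
  split=> // k; split=> hF.
    have := hDa k _ hF; rewrite mulVKg => h; have := lt_le_trans far h.
    by rewrite ltNge (le_trans (ler_norm _))// lerDl.
  have := hDb k _ hF; rewrite mulVKg mulrC => h; have := lt_le_trans far h.
  by rewrite ltNge (le_trans (ler_norm _))// lerDr.
have self x : <<orbit x, orbit x>> <= K by case: (orbit_unit R x) => ->.
have step x x' : <<orbit x, orbit x'>> <= T -> H x -> H x' ->
    (H `&` [set s | <<base, orbit s>> <= T])%classic (x^-1 * x')%g.
  move=> h Hx Hx'; split; first by apply: subgroupM => //; exact: subgroupV.
  by rewrite /= mfC /orbit_pt repM -mulmxA rep_mf_l invgK mfC -/(orbit x').
have tri4 x z z' x' : unit_future z -> unit_future z' -> <<orbit x, z>> <= K -> <<z, z'>> <= 2 ->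
    <<orbit x', z'>> <= K -> <<orbit x, orbit x'>> <= T.
  move=> hz hz' xz zz x'z'.
  have fx := orbit_future R x; have fx' := orbit_future R x'.
  have fz := unit_future_future hz; have fz' := unit_future_future hz'.
  have := mf_triangle fx fz fz'; have [-> _] := hz; rewrite mul1r ltr01 => /(_ isT) h1.
  have := mf_triangle fx fz' fx'; have [-> _] := hz'; rewrite mul1r ltr01 => /(_ isT) h2.
  have a1 : <<orbit x, z>> * <<z, z'>> <= K * 2 by rewrite ler_pM// mf_ge0.
  have a2 : <<orbit x, z'>> <= 4 * K by lra.
  have a3 : <<orbit x, z'>> * <<z', orbit x'>> <= 4 * K * K.
    by rewrite ler_pM ?mf_ge0// mfC.
  by rewrite /T; lra.
have lift z z' : linked (fun z => unit_future z /\ l0 <= tri u v z)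
    (fun z z' => <<z, z'>> <= 2) z z' -> forall x x', H x -> H x' ->
    <<orbit x, z>> <= K -> <<orbit x', z'>> <= K ->
    linked (avoids H F a b)
      (fun x y => (H `&` [set s | <<base, orbit s>> <= T])%classic (x^-1 * y)%g) x x'.
  elim=> {z z'} [z [hz lz]|z z1 z' [hz lz] zz1 zl IH] x x' Hx Hx' xz x'z'.
    apply: linked_step (avoid _ _ Hx hz lz xz) _ (linked_refl _ (avoid _ _ Hx' hz lz x'z')).
    apply: step => //; apply: (tri4 _ z z _ hz hz xz _ x'z').
    by case: hz => -> _; rewrite ler1n.
  have [hz1 lz1] := linked_l zl.
  have [x1 [Hx1 x1z1]] := hK _ hz1.
  apply: linked_step (avoid _ _ Hx hz lz xz) _ (IH _ _ Hx1 Hx' x1z1 x'z').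
  by apply: step => //; exact: tri4 hz hz1 xz zz1 x1z1.
by apply: lift path _ _ _ _ _ _; rewrite ?self//; exact: HX.
Qed.

(** A step of the chain that changed sides would start near the line by [crossing_bound], hence near
    one of the rays by [near_line], where the obstacle forbids it. [side_of_powers] compares the
    ends of the chain with [w] and [y]. *)
Lemma joined_tri a b c d u u' v v' w w' y y' l1 l2 l3 l4 :
  hyperbolic a u u' l1 -> hyperbolic b v v' l2 ->
  hyperbolic c w w' l3 -> hyperbolic d y y' l4 -> H a -> H b -> H c -> H d ->
  0 < <<u, v>> -> 0 < <<u, w>> -> 0 < <<v, w>> -> 0 < <<u, y>> -> 0 < <<v, y>> ->
  joined H a b c d -> 0 < tri u v w * tri u v y.
Proof.
move=> ha hb hc hd Ha Hb Hc Hd uv uw vw uy vy [S [fS SH hS]].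
have [nu nu' _ _ _] := ha; have [nv nv' _ _ _] := hb.
have [nw nw' _ _ _] := hc; have [ny ny' _ _ _] := hd.
set m := <<u, v>> in uv.
have [T T0 hT] := finite_set_bound (fun s => <<base, orbit s>>) fS.
have [F0 [fF0 hF0]] := near_line (2 * m * (T + 1) ^+ 2) ha hb uv.
have [n1 hn1] := side_of_powers 0 nu nv uv hc uw vw.
have [n2 hn2] := side_of_powers 0 nu nv uv hd uy vy.
pose N := maxn n1 n2.
(* [joined] gives no control on [n]. Adding the small powers of [c] to the obstacle forces [N <= n],
   through the case [k = 0] of [avoids]. *)
pose P := [set (c ^+ i)%g | i in `I_N]%classic.
have fP : finite_set P by apply: finite_image; exact: finite_II.
have [||n hn] := hS (H `&` (F0 `|` P))%classic.
- by apply: sub_finite_set (_ : _ `<=` F0 `|` P)%classic _; [move=> ? []|rewrite finite_setU].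
- by move=> ? [].
have Nn : (N <= n)%N.
  rewrite leqNgt; apply/negP => nN.
  have [_ /(_ 0%N)[+ _]] := linked_l hn; apply.
  rewrite expg0 invg1 mul1g; split; first exact: HX.
  by right; exists n.
have [sc _] := hn1 n (leq_trans (leq_maxl _ _) Nn).
have [sd _] := hn2 n (leq_trans (leq_maxr _ _) Nn).
suff : 0 < tri u v (orbit (c ^+ n)%g) * tri u v (orbit (d ^+ n)%g).
  move=> s; have := mulr_gt0 (mulr_gt0 sc sd) s.
  set p := tri u v (orbit (c ^+ n)%g); set q := tri u v (orbit (d ^+ n)%g).
  have -> : tri u v w * p * (tri u v y * q) * (p * q) = tri u v w * tri u v y * (p * q) ^+ 2 by ring.
  have [->|pq0] := eqVneq (p * q) 0; first by rewrite expr0n mulr0 ltxx.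
  by rewrite pmulr_lgt0// exprn_even_gt0//= .
have same x x1 : avoids H (H `&` (F0 `|` P))%classic a b x ->
    <<orbit x, orbit x1>> <= T + 1 -> 0 < tri u v (orbit x) * tri u v (orbit x1).
  move=> [Hx av] xx1; rewrite ltNge; apply/negP => neg.
  have [|k hk] := hF0 x.
    apply: le_trans (crossing_bound nu nv uv (orbit_unit R x) (orbit_unit R x1) neg) _.
    rewrite -/m ler_pM2l ?mulr_gt0// ler_pXn2r ?nnegrE ?mf_ge0//; try exact: orbit_future.
    by rewrite addr_ge0// ltW.
  have [nFa nFb] := av k; case: hk => hk; [apply: nFa|apply: nFb].
    by split; [apply: subgroupM => //; apply: subgroupV => //; exact: HX|left].
  by split; [apply: subgroupM => //; apply: subgroupV => //; exact: HX|left].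
elim: hn => [x av|x x1 x' av xx1 _ IH].
  apply: same => //; case: (orbit_unit R x) => -> _; by rewrite lerDr ltW.
have s1 : 0 < tri u v (orbit x) * tri u v (orbit x1).
  apply: same => //; have := hT _ xx1.
  rewrite /orbit_pt repM -mulmxA -rep_mf_l => h.
  by apply: le_trans h _; rewrite lerDl.
have := mulr_gt0 s1 IH.
set p := tri u v (orbit x); set q := tri u v (orbit x1); set r := tri _ _ _.
have -> : p * q * (q * r) = p * r * q ^+ 2 by ring.
have q0 : q != 0 by apply: contraTneq s1 => e; rewrite -/q e mulr0 ltxx.
by rewrite pmulr_lgt0// exprn_even_gt0//= .
Qed.

(* The relation [joined] is defined from the group alone, while the right-hand side
   says that [w] and [y] are on the same side of the line from [u] to [v]. *)
Lemma joinedP a b c d u u' v v' w w' y y' l1 l2 l3 l4 :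
  hyperbolic a u u' l1 -> hyperbolic b v v' l2 ->
  hyperbolic c w w' l3 -> hyperbolic d y y' l4 -> H a -> H b -> H c -> H d ->
  0 < <<u, v>> -> 0 < <<u, w>> -> 0 < <<v, w>> -> 0 < <<u, y>> -> 0 < <<v, y>> ->
  joined H a b c d <-> 0 < tri u v w * tri u v y.
Proof.
move=> ha hb hc hd Ha Hb Hc Hd uv uw vw uy vy; split.
  exact: joined_tri ha hb hc hd Ha Hb Hc Hd uv uw vw uy vy.
have [tw|tw|->] := ltrgt0P (tri u v w); last by rewrite mul0r ltxx.
  by rewrite pmulr_rgt0// => ty; exact: joined_same_side ha hb hc hd Hc Hd uv uw vw uy vy tw ty.
rewrite nmulr_rgt0// => ty; apply: joinedC.
apply: (joined_same_side hb ha hc hd) => //; first by rewrite mfC.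
  by rewrite triC oppr_gt0.
by rewrite triC oppr_gt0.
Qed.

End FiniteIndex.
End Joined.

(** * Elements of infinite order have hyperbolic powers *)

Lemma form_int_anisotropic (n : 'cV[int]_3) : form n n = 0 -> n = 0.
Proof.
rewrite formE; have [k hk] : exists k : nat, `|n i2 0| <= k%:Z by exists `|(n i2 0)%R|%N; lia.
elim: k n hk => [|k IH] n hk.
  move: hk; set x := n i0 0; set y := n i1 0; set t := n i2 0 => hk e.
  have t0 : t = 0 by lia.
  have x0 : x = 0 by rewrite t0 in e; nia.
  have y0 : y = 0 by rewrite t0 x0 in e; nia.
  by apply: vec3P; rewrite -?/x -?/y -?/t ?x0 ?y0 ?t0 mxE.
move: hk; set x := n i0 0; set y := n i1 0; set t := n i2 0 => hk e.
have half (z : int) : exists q r, z = 2 * q + r /\ (r = 0 \/ r = 1).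
  exists (z %/ 2)%Z, (z %% 2)%Z; split; first by rewrite mulrC -divz_eq.
  have := modz_ge0 z (isT : (2 : int) != 0); have := ltz_pmod z (isT : 0 < (2 : int)).
  lia.
(* Descent modulo 2: [t] is even, so [x ^+ 2 - x * y + y ^+ 2] is even, which forces [x] and [y] to
   be even. *)
have [t' [r [tE [r0|r1]]]] := half t; last by exfalso; rewrite tE r1 in e; lia.
have [x' [rx [xE rx']]] := half x; have [y' [ry [yE ry']]] := half y.
have e' : 2 * (t' * t') = x * x - x * y + y * y by rewrite tE r0 in e; lia.
have [rx0 ry0] : rx = 0 /\ ry = 0.
  by rewrite xE yE in e'; case: rx' e' => ->; case: ry' => ->; split=> //; lia.
rewrite rx0 addr0 in xE; rewrite ry0 addr0 in yE; rewrite r0 addr0 in tE.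
have n'0 : vec3 x' y' t' = 0.
  apply: IH; rewrite !mxE /=; first by rewrite tE in hk; lia.
  by rewrite xE yE in e'; lia.
have := congr1 (fun v : 'cV[int]_3 => (v i0 0, v i1 0, v i2 0)) n'0.
rewrite !mxE /= => -[x0 y0 t0].
by apply: vec3P; rewrite -?/x -?/y -?/t ?xE ?yE ?tE ?x0 ?y0 ?t0 mulr0 mxE.
Qed.

Lemma form_int_nondegenerate (z z' : 'cV[int]_3) :
  (forall w, form w z = form w z') -> z = z'.
Proof.
move=> h; have h0 := h (vec3 1 0 0); have h1 := h (vec3 0 1 0); have h2 := h (vec3 0 0 1).
move: h0 h1 h2; rewrite !formE !mxE /=.
move: (z i0 0) (z i1 0) (z i2 0) (z' i0 0) (z' i1 0) (z' i2 0)
  (@vec3P _ z z') => x y t x' y' t' ext h0 h1 h2.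
by apply: ext; lia.
Qed.

(* An isometry [M] differs from its adjoint [M^-1] by a skew-symmetric matrix;
   [n] spans the kernel of the latter. *)
Lemma rep_sqr_fixed (a : Gamma2) : (a ^+ 2 != 1)%g ->
  exists n : 'cV[int]_3, n != 0 /\ lorentz int (a ^+ 2)%g *m n = n.
Proof.
move=> a2; pose M := lorentz int a.
pose e0 : 'cV[int]_3 := vec3 1 0 0; pose e1 : 'cV[int]_3 := vec3 0 1 0.
pose e2 : 'cV[int]_3 := vec3 0 0 1.
pose K (x y : 'cV[int]_3) := form x (M *m y) - form (M *m x) y.
have basis (x : 'cV[int]_3) : x = x i0 0 *: e0 + x i1 0 *: e1 + x i2 0 *: e2.
  by apply: vec3P; rewrite !mxE /=; ring.
have KE (x y : 'cV[int]_3) : K x y = (x i0 0 * y i1 0 - x i1 0 * y i0 0) * K e0 e1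
    + (x i0 0 * y i2 0 - x i2 0 * y i0 0) * K e0 e2
    + (x i1 0 * y i2 0 - x i2 0 * y i1 0) * K e1 e2.
  rewrite /K {1 2}(basis x) {1 2}(basis y) !mulmxDr -!scalemxAr.
  rewrite !(formDl, formDr, formZl, formZr).
  rewrite (formC e0 (M *m e0)) (formC e1 (M *m e1)) (formC e2 (M *m e2)).
  rewrite (formC (M *m e0) e1) (formC (M *m e0) e2) (formC (M *m e1) e2).
  rewrite (formC (M *m e1) e0) (formC (M *m e2) e0) (formC (M *m e2) e1).
  ring.
(* A kernel vector satisfies [M z = M^-1 z], so it is the square of [M] that fixes it. *)
have fixP z : (forall w, K w z = 0) -> lorentz int (a ^+ 2)%g *m z = z.
  move=> h; have e : M *m z = lorentz int a^-1%g *m z.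
    apply: form_int_nondegenerate => w; have := h w; rewrite /K => /eqP.
    by rewrite subr_eq0 => /eqP ->; rewrite rep_form_l.
  by rewrite expgS expg1 repM -mulmxA -/M e repKV.
pose n : 'cV[int]_3 := vec3 (K e1 e2) (- K e0 e2) (K e0 e1).
exists n; split; last first.
  by apply: fixP => w; rewrite KE !mxE /=; ring.
apply: contra_neq a2 => n0.
have := congr1 (fun v : 'cV[int]_3 => (v i0 0, v i1 0, v i2 0)) n0.
rewrite !mxE /= => -[k12 /eqP]; rewrite oppr_eq0 => /eqP k02 k01.
apply: (@rep_base_inj realalg); rewrite rep1 mul1mx.
rewrite -(map_rep (intr : {rmorphism int -> realalg})) -(map_base (intr : {rmorphism int -> realalg})).
by rewrite -map_mxM fixP// => w; rewrite KE k12 k02 k01; ring.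
Qed.

Section Hyperbolicity.
Variable R : archiRcfType.
Local Notation base := (basepoint R).
Local Notation rep := (lorentz R).
Local Notation orbit := (orbit_pt R).
Implicit Types (a b : Gamma2) (u v w z : 'cV[R]_3).

Lemma rep_future a z : future z -> future (rep a *m z).
Proof.
move=> fz; apply: (@future_of_pos _ (orbit a)); first by rewrite rep_mf; case: fz.
  exact: orbit_future.
by rewrite /orbit_pt rep_mf mf_base; case: fz.
Qed.

Lemma rep_null a z : null_ray z -> null_ray (rep a *m z).
Proof.
move=> nz; split; first by rewrite rep_mf; case: nz.
by have [_ ] := rep_future a (null_future nz).
Qed.

(** The powers of [b] keep the basepoint at bounded distance from [z], so by [Gamma2_proper] two of
    them are equal. *)
Lemma fixed_timelike_torsion b z : future z -> 0 < <<z, z>> -> rep b *m z = z ->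
  exists2 k, (0 < k)%N & (b ^+ k = 1)%g.
Proof.
move=> fz zz bz; apply: contrapT => no.
have inj : injective (fun i => b ^+ i)%g.
  suff lt i j : (i < j)%N -> (b ^+ i <> b ^+ j)%g.
    move=> i j e; case: (ltngtP i j) => // h; first by case: (lt _ _ h).
    by case: (lt _ _ h).
  move=> ij e; apply: no; exists (j - i)%N; first by rewrite subn_gt0.
  by apply: (mulgI (b ^+ i)%g); rewrite -expgnDr subnKC ?mulg1// ltnW.
apply: infinite_nat; have := @finite_preimage _ _ _ (fun i => b ^+ i)%g _
  (Gamma2_proper (2 * <<base, z>> * <<z, base>> / <<z, z>>)).
move=> /(_ (in2W inj)); apply: sub_finite_set => i _ /=.
rewrite ler_pdivlMr// mulrC.
have e : <<z, orbit (b ^+ i)%g>> = <<z, base>>.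
  rewrite -[in LHS](_ : rep (b ^+ i)%g *m z = z) ?rep_mf//.
  by rewrite (@rep_expg_eigen _ _ _ 1) ?expr1n ?scale1r.
have := mf_triangle (unit_future_future (unit_base R)) fz (orbit_future R (b ^+ i)%g) zz.
by rewrite e.
Qed.

End Hyperbolicity.

Section Classification.
Variable R : archiRcfType.
Local Notation base := (basepoint R).
Local Notation rep := (lorentz R).
Local Notation orbit := (orbit_pt R).
Implicit Types (a b : Gamma2) (u v w z : 'cV[R]_3).

Lemma mf_conormal_self u v :
  <<conormal u v, conormal u v>> = (<<u, u>> * <<v, v>> - <<u, v>> ^+ 2) / 3.
Proof. by rewrite mf_conormal /tri /conormal !mxE /= !mfE; field. Qed.

(** The plane orthogonal to [n] contains the timelike [p], a multiple of the projection of the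
    basepoint, and the spacelike [w]. Square roots rescale both to the same length; their sum and
    difference are null. *)
Lemma spacelike_null_rays n : <<n, n>> < 0 -> exists u v,
  [/\ null_ray u, null_ray v, 0 < <<u, v>>, <<n, u>> = 0 & <<n, v>> = 0].
Proof.
move=> nn; pose q := - <<n, n>>; have q0 : 0 < q by rewrite oppr_gt0.
pose p := q *: base + <<n, base>> *: n.
have np : <<n, p>> = 0 by rewrite mfDr !mfZr /q; ring.
have bb : <<base, base>> = 1 by case: (unit_base R).
have pp : <<p, p>> = q * (q + <<n, base>> ^+ 2).
  by rewrite mfDl !mfDr !mfZl !mfZr bb (mfC base n) /q; ring.
have pp0 : 0 < <<p, p>> by rewrite pp mulr_gt0// ltr_pwDl ?sqr_ge0.
have fp : future p.
  split; first exact: ltW.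
  rewrite !mxE /= (mfC n) mf_base mulr1 -expr2; have := sqr_ge0 (n i2 0); lra.
pose w := conormal n p.
have nw : <<n, w>> = 0 by rewrite mf_conormal /tri; ring.
have pw : <<p, w>> = 0 by rewrite mf_conormal /tri; ring.
pose W := - <<w, w>>.
have WE : W = q * <<p, p>> / 3.
  by rewrite /W mf_conormal_self np /q; ring.
have W0 : 0 < W by rewrite WE divr_gt0// mulr_gt0.
pose sW := Num.sqrt W; pose sP := Num.sqrt <<p, p>>.
have sW2 : sW ^+ 2 = W by rewrite sqr_sqrtr// ltW.
have sP2 : sP ^+ 2 = <<p, p>> by rewrite sqr_sqrtr// ltW.
have sW0 : 0 < sW by rewrite sqrtr_gt0.
have ww : <<w, w>> = - W by rewrite /W opprK.
have nullE (e : R) : e ^+ 2 = 1 -> null_ray (sW *: p + (e * sP) *: w).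
  move=> e2; have z0 : <<sW *: p + (e * sP) *: w, sW *: p + (e * sP) *: w>> = 0.
    rewrite mfDl !mfDr !mfZl !mfZr (mfC w p) pw ww.
    have -> : e * sP * (e * sP * - W) = - (e ^+ 2) * sP ^+ 2 * W by ring.
    by rewrite e2 sP2 mulrA -expr2 sW2; ring.
  split=> //; have [] // := @future_of_pos _ p (sW *: p + (e * sP) *: w).
    by rewrite z0.
  by rewrite mfDr !mfZr pw mulr0 addr0 mulr_gt0.
exists (sW *: p + (1 * sP) *: w), (sW *: p + (-1 * sP) *: w); split.
- by apply: nullE; rewrite expr1n.
- by apply: nullE; rewrite sqrrN expr1n.
- rewrite mfDl !mfDr !mfZl !mfZr (mfC w p) pw ww.
  have -> : sW * (sW * <<p, p>>) + sW * (-1 * sP * 0) + (1 * sP * (sW * 0) + 1 * sP * (-1 * sP * - W)) =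
    sW ^+ 2 * <<p, p>> + sP ^+ 2 * W by ring.
  by rewrite sW2 sP2 addr_gt0// mulr_gt0.
- by rewrite mfDr !mfZr np nw; ring.
- by rewrite mfDr !mfZr np nw; ring.
Qed.

Lemma null_rays_orthogonal n u v z : <<n, n>> < 0 -> null_ray u -> null_ray v ->
  0 < <<u, v>> -> <<n, u>> = 0 -> <<n, v>> = 0 -> null_ray z -> <<n, z>> = 0 ->
  <<u, z>> = 0 \/ <<v, z>> = 0.
Proof.
move=> nn nu nv uv nuE nvE nz nzE.
have tn := tri_sqr nu nv n; rewrite (mfC u n) nuE (mfC v n) nvE mulr0 in tn.
have tn0 : tri u v n != 0.
  apply/eqP => e; move: tn; rewrite e expr0n mulr0 addr0 => /esym/eqP.
  by rewrite mulf_eq0 (lt_eqF nn) orbF expf_eq0 /= gt_eqF.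
have := tri_gram u v n u v z; rewrite nuE nvE nzE => h.
have tz : tri u v z = 0.
  have three0 : (3 : R) != 0 by rewrite pnatr_eq0.
  by apply: (mulfI tn0); apply: (mulfI three0); rewrite mulrA h; ring.
have := tri_sqr nu nv z; have [-> _] := nz; rewrite tz expr0n !mulr0 addr0 => /eqP.
rewrite !mulf_eq0 pnatr_eq0 (gt_eqF uv) /= => /orP[/eqP|/eqP]; by [left|right].
Qed.

Lemma null_scale u z : null_ray u -> null_ray z -> <<u, z>> = 0 ->
  exists2 c, 0 < c & z = c *: u.
Proof.
move=> nu nz uz; have [_ u2] := nu; have [_ z2] := nz.
exists (z i2 0 / u i2 0); first by rewrite divr_gt0.
apply: (scalerI (lt0r_neq0 u2)); rewrite -(null_parallel nu nz uz) scalerA.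
by congr (_ *: _); rewrite mulrC divfK// gt_eqF.
Qed.

Lemma swap_or_fix b n u v : <<n, n>> < 0 -> rep b *m n = n -> null_ray u -> null_ray v ->
  0 < <<u, v>> -> <<n, u>> = 0 -> <<n, v>> = 0 ->
  exists2 c, 0 < c & rep (b ^+ 2)%g *m u = c *: u.
Proof.
move=> nn bn nu nv uv nuE nvE.
have orth z : <<n, z>> = 0 -> <<n, rep b *m z>> = 0 by move=> <-; rewrite -[in LHS]bn rep_mf.
have cas z : null_ray z -> <<n, z>> = 0 -> <<u, z>> = 0 \/ <<v, z>> = 0.
  by move=> nz; exact: null_rays_orthogonal nn nu nv uv nuE nvE nz.
have nbu := rep_null b nu; have nbv := rep_null b nv.
rewrite expgS expg1 repM.
case: (cas _ nbu (orth _ nuE)) => e.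
  have [c c0 cE] := null_scale nu nbu e.
  by exists (c * c); rewrite ?mulr_gt0// -mulmxA cE -scalemxAr cE scalerA.
have [c c0 cE] := null_scale nv nbu e.
case: (cas _ nbv (orth _ nvE)) => e'; last first.
  have [c' c'0 c'E] := null_scale nv nbv e'.
  have := rep_mf b u v; rewrite cE c'E mfZl mfZr; have [-> _] := nv.
  by rewrite !mulr0 => /eqP; rewrite lt_eqF.
have [c' c'0 c'E] := null_scale nu nbv e'.
by exists (c * c'); rewrite ?mulr_gt0// -mulmxA cE -scalemxAr c'E scalerA.
Qed.

(** The integral vector fixed by [a ^+ 2] is not null, by anisotropy, nor timelike, since [a] has
    infinite order. So it is the pole of a line whose ends are permuted by [a ^+ 2] and fixed by
    [a ^+ 4]. The two eigenvalues are inverse to each other, and not 1, since [u + v] is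
    timelike. *)
Lemma infinite_order_hyperbolic a : (forall n, (0 < n)%N -> (a ^+ n <> 1)%g) ->
  exists n u v l, [/\ (0 < n)%N, hyperbolic (a ^+ n)%g u v l & u i2 0 = 1].
Proof.
move=> ainf; have [|n [n0 na]] := @rep_sqr_fixed a; first by apply/eqP; exact: ainf.
pose nR : 'cV[R]_3 := map_mx intr n.
have nRE : rep (a ^+ 2)%g *m nR = nR.
  by rewrite -(map_rep (intr : {rmorphism int -> R})) -map_mxM na.
have nn : <<nR, nR>> = - (form n n)%:~R.
  by rewrite /minus_form !formE !mxE; ring.
have torsion m z : (0 < m)%N -> future z -> 0 < <<z, z>> -> rep (a ^+ m)%g *m z = z -> False.
  move=> m0 fz zz /(fixed_timelike_torsion fz zz)[k k0].
  by rewrite -expgnA; apply: ainf; rewrite muln_gt0 m0.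
have [nn0|nn0|nn0] := ltrgt0P (form n n); last first.
- by move: n0; rewrite (form_int_anisotropic nn0) eqxx.
- exfalso; have nnp : 0 < <<nR, nR>> by rewrite nn oppr_gt0 ltrz0.
  case: (ltrgt0P (nR i2 0)) => z2.
  + by apply: (torsion 2 nR) => //; split=> //; exact: ltW.
  + have E : <<- nR, - nR>> = <<nR, nR>> by rewrite /minus_form formNl formNr opprK.
    apply: (torsion 2 (- nR)); rewrite ?E ?mulmxN ?nRE//.
    by split; rewrite ?E ?(ltW nnp)// mxE oppr_gt0.
  + move: nnp; rewrite mfE z2; set x := nR i0 0; set y := nR i1 0 => h.
    have : 0 <= 2 * (x * x) - x * y - y * x + 2 * (y * y) by nra.
    lra.
have nnn : <<nR, nR>> < 0 by rewrite nn oppr_lt0 ltr0z.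
have [u [v [nu nv uv nuE nvE]]] := spacelike_null_rays nnn.
have [c c0 cE] := swap_or_fix nnn nRE nu nv uv nuE nvE.
have vu : 0 < <<v, u>> by rewrite mfC.
have [d d0 dE] := swap_or_fix nnn nRE nv nu vu nvE nuE.
rewrite -expgnA in cE dE.
have cd : c * d = 1.
  apply: (mulIf (lt0r_neq0 uv)); rewrite mul1r -mulrA.
  by rewrite -mfZr -mfZl -cE -dE rep_mf.
have scale z : null_ray z -> null_ray ((z i2 0)^-1 *: z) /\ ((z i2 0)^-1 *: z) i2 0 = 1.
  move=> [zz z2]; have e : ((z i2 0)^-1 *: z) i2 0 = 1 by rewrite mxE mulVf// gt_eqF.
  by split=> //; split; rewrite ?e// mfZl mfZr zz !mulr0.
have eig (z : 'cV[R]_3) (m l : R) b : rep b *m z = l *: z -> rep b *m (m *: z) = l *: (m *: z).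
  by move=> e; rewrite -scalemxAr e scalerA mulrC -scalerA.
case: (ltrgtP c 1) => c1.
- exists (2 * 2)%N, ((v i2 0)^-1 *: v), u, d.
  have [sv v1] := scale v nv; split=> //; split=> //.
  + by rewrite -[ltLHS]cd gtr_pMl.
  + exact: eig.
  + by rewrite cE; congr (_ *: _); apply: (mulIf (lt0r_neq0 d0)); rewrite cd mulVf// gt_eqF.
- exists (2 * 2)%N, ((u i2 0)^-1 *: u), v, c.
  have [su u1] := scale u nu; split=> //; split=> //.
  + exact: eig.
  + by rewrite dE; congr (_ *: _); apply: (mulfI (lt0r_neq0 c0)); rewrite cd mulfV// gt_eqF.
- exfalso; apply: (torsion 4 (u + v)) => //.
  + exact: null_sum_future.
  + by rewrite mf_null_sum// mulr_gt0.
  + have d1 : d = 1 by rewrite c1 mul1r in cd.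
    by rewrite mulmxDr cE dE c1 d1 !scale1r.
Qed.

End Classification.

(** * The action of the commensurator on the ends *)

Section PartialIso.
Variable G : groupType.
Implicit Types (p q : partial_iso G) (a b c d x : G) (H : set G).

Lemma nat_pigeonhole (T : Type) (f : nat -> T) (A : set T) : finite_set A ->
  (forall i, A (f i)) -> exists i j, (i < j)%N /\ f i = f j.
Proof.
move=> fA Af; apply: contrapT => no; apply: infinite_nat.
have inj : injective f.
  move=> i j e; case: (ltngtP i j) => // h; exfalso; apply: no.
    by exists i, j.
  by exists j, i.
apply: sub_finite_set (finite_preimage (in2W inj) fA) => i _; exact: Af.
Qed.

Lemma finite_index_expg H a : finite_index_subgroup H ->
  exists2 n, (0 < n)%N & H (a ^+ n)%g.
Proof.
move=> [gH fH].
have [|i [j [ij e]]] := @nat_pigeonhole _ (fun i => left_coset (a ^+ i)%g H) _ fH.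
  by move=> i; exists (a ^+ i)%g.
exists (j - i)%N; first by rewrite subn_gt0.
have := (left_coset_eq _ _ gH).1 e.
by rewrite -{1}(subnKC (ltnW ij)) expgnDr mulKg.
Qed.

Lemma subgroupX H a n : group_closed (mem H) -> H a -> H (a ^+ n)%g.
Proof.
move=> gH Ha; elim: n => [|n IH]; first by rewrite expg0; exact: subgroup1.
by rewrite expgS; exact: subgroupM.
Qed.

Section Dom.
Variable p : partial_iso G.
Let gp : group_closed (mem (piso_dom p)). Proof. by case: (piso_domP p). Qed.

Lemma piso1 : p 1%g = 1%g.
Proof.
have p1 := subgroup1 gp; apply: (@mulgI _ (p 1%g)).
by rewrite -pisoM'// !mulg1.
Qed.

Lemma pisoV a : piso_dom p a -> p a^-1%g = (p a)^-1%g.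
Proof.
move=> pa; apply: (@mulgI _ (p a)).
by rewrite -pisoM' ?mulgV ?piso1//; exact: subgroupV.
Qed.

Lemma pisoX a n : piso_dom p a -> p (a ^+ n)%g = (p a ^+ n)%g.
Proof.
move=> pa; elim: n => [|n IH]; first by rewrite !expg0 piso1.
by rewrite !expgS pisoM' ?IH//; exact: subgroupX.
Qed.

Let domX a n : piso_dom p a -> piso_dom p (a ^+ n)%g.
Proof. exact: subgroupX. Qed.

Let domVX a n : piso_dom p a -> piso_dom p (a ^- n)%g.
Proof. by move=> pa; apply: subgroupV => //; exact: subgroupX. Qed.

Lemma same_end_piso a b : piso_dom p a -> piso_dom p b ->
  same_end a b -> same_end (p a) (p b).
Proof.
move=> pa pb [F [fF hF]]; exists (p @` F)%classic; split; first exact: finite_image.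
move=> n; have [k hk] := hF n; exists k, (a ^- k * b ^+ n)%g => //.
by rewrite pisoM' ?pisoV ?pisoX//; [exact: domX|exact: domVX|exact: domX].
Qed.

Lemma joined_piso a b c d : piso_dom p a -> piso_dom p b -> piso_dom p c -> piso_dom p d ->
  joined (piso_dom p) a b c d -> joined (piso_cod p) (p a) (p b) (p c) (p d).
Proof.
move=> pa pb pc pd [S [fS Sp hS]]; exists (p @` S)%classic; split.
- exact: finite_image.
- by move=> _ [s /Sp ps <-]; exact: piso_im.
move=> F fF Fp; have [||n hn] := hS (piso_inv p @` F)%classic.
- exact: finite_image.
- by move=> _ [f /Fp pf <-]; have [] := piso_inv_funP pf.
exists n; rewrite -!pisoX//.
have tr x k c' : piso_dom p x -> piso_dom p c' -> F (p c' ^- k * p x)%g ->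
    (piso_inv p @` F)%classic (c' ^- k * x)%g.
  move=> px pc' hF; exists (p c' ^- k * p x)%g => //.
  have -> : (p c' ^- k * p x = p (c' ^- k * x))%g.
    by rewrite pisoM' ?pisoV ?pisoX//; [exact: domX|exact: domVX].
  by apply: piso_funK; apply: subgroupM => //; exact: domVX.
apply: (linked_map (f := p)) hn => [x [px av]|x y [px _] [py _] Sxy].
  split; first exact: piso_im.
  move=> k; have [avA avB] := av k.
  by split=> hF; [apply: avA|apply: avB]; exact: tr.
exists (x^-1 * y)%g => //; rewrite pisoM' ?pisoV//; exact: subgroupV.
Qed.

End Dom.

Lemma joined_pisoE p a b c d : piso_dom p a -> piso_dom p b -> piso_dom p c -> piso_dom p d ->
  joined (piso_dom p) a b c d <-> joined (piso_cod p) (p a) (p b) (p c) (p d).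
Proof.
move=> pa pb pc pd; split; first exact: joined_piso.
move=> /(@joined_piso (piso_inv p)).
by rewrite /= !piso_funK//; apply; exact: piso_im.
Qed.

Lemma same_end_pisoE p a b : piso_dom p a -> piso_dom p b ->
  same_end a b <-> same_end (p a) (p b).
Proof.
move=> pa pb; split; first exact: same_end_piso.
move=> /(@same_end_piso (piso_inv p)).
by rewrite /= !piso_funK//; apply; exact: piso_im.
Qed.

End PartialIso.

Section Ends.
Variable R : archiRcfType.
Local Notation base := (basepoint R).
Local Notation rep := (lorentz R).
Local Notation orbit := (orbit_pt R).
Implicit Types (a b h : Gamma2) (u v w z : 'cV[R]_3) (p q : partial_iso Gamma2).

(** Time coordinate 1 selects one representative of each point at infinity, so that equality of ends
    is equality of vectors. *)
Definition attracted a u : Prop := u i2 0 = 1 /\ exists v l, hyperbolic a u v l.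

Definition is_end u : Prop := exists a, attracted a u.

Lemma attracted_null a u : attracted a u -> null_ray u.
Proof. by case=> _ [v [l []]]. Qed.

Lemma is_end_null u : is_end u -> null_ray u.
Proof. by case=> a /attracted_null. Qed.

Lemma is_end_time u : is_end u -> u i2 0 = 1. Proof. by case=> a []. Qed.

Lemma null_time1_eq u v : null_ray u -> null_ray v -> u i2 0 = 1 -> v i2 0 = 1 ->
  u = v <-> <<u, v>> = 0.
Proof.
move=> nu nv u1 v1; split=> [<-|]; first by case: nu.
by move=> /(null_parallel nu nv); rewrite u1 v1 !scale1r.
Qed.

Lemma is_end_neq u v : is_end u -> is_end v -> u <> v -> 0 < <<u, v>>.
Proof.
move=> eu ev uv; have nu := is_end_null eu; have nv := is_end_null ev.
rewrite lt_neqAle mf_ge0 ?andbT; try exact: null_future.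
apply/eqP => /esym e; apply: uv; apply/null_time1_eq => //; exact: is_end_time.
Qed.

Lemma attracted_is_end a u : attracted a u -> is_end u. Proof. by exists a. Qed.

Lemma same_end_attracted a b u v : attracted a u -> attracted b v -> same_end a b <-> u = v.
Proof.
move=> hu hv; have nu := attracted_null hu; have nv := attracted_null hv.
have [u1 [u' [l ha]]] := hu; have [v1 [v' [l' hb]]] := hv.
rewrite (same_endP ha hb); split=> h.
  exact/null_time1_eq.
exact/(null_time1_eq nu nv u1 v1).
Qed.

Lemma attracted_expg a u n : (0 < n)%N -> attracted a u -> attracted (a ^+ n)%g u.
Proof.
move=> n0 [u1 [v [l [nu nv l1 au av]]]]; split=> //; exists v, (l ^+ n); split=> //.
- by rewrite exprn_egt1// -lt0n.
- exact: rep_expg_eigen.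
- by rewrite -exprVn; exact: rep_expg_eigen.
Qed.

Lemma attracted_infinite a u n : attracted a u -> (0 < n)%N -> (a ^+ n <> 1)%g.
Proof.
move=> hu n0 e; have := attracted_expg n0 hu; rewrite e => -[u1 [v [l [_ _ l1]]]].
rewrite rep1 mul1mx => /(congr1 (fun z : 'cV[R]_3 => z i2 0)).
by rewrite mxE u1 mulr1 => e1; move: l1; rewrite -e1 ltxx.
Qed.

Definition normalize u : 'cV[R]_3 := (u i2 0)^-1 *: u.

Lemma attracted_conj a h u : attracted a u ->
  attracted (h * a * h^-1)%g (normalize (rep h *m u)).
Proof.
move=> [u1 [v [l [nu nv l1 au av]]]].
have [hu hv] := (rep_null h nu, rep_null h nv).
have [hu0 hu2] := hu; split; first by rewrite mxE mulVf// gt_eqF.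
exists (rep h *m v), l; split=> //.
- by split; rewrite ?mfZl ?mfZr ?hu0 ?mulr0// mxE mulr_gt0 ?invr_gt0.
- by rewrite /normalize -scalemxAr !repM -!mulmxA repVK au -scalemxAr !scalerA mulrC.
- by rewrite !repM -!mulmxA repVK av -scalemxAr.
Qed.

(** A relation at first: an element attracting to [u] must be raised to a power to enter the domain,
    and again for its image to be known hyperbolic. Invariance of [same_end] makes [w] depend on [u]
    alone. *)
Definition end_map p u w : Prop :=
  exists b, [/\ piso_dom p b, attracted b u & attracted (p b) w].

Lemma end_map_expg p b u : piso_dom p b -> attracted b u ->
  exists n w, [/\ (0 < n)%N & attracted (p b ^+ n)%g w].
Proof.
move=> pb hb; have gp : group_closed (mem (piso_dom p)) by case: (piso_domP p).
have [n0 n00 |n [w [v [l [n0 hw w1]]]]] := @infinite_order_hyperbolic R (p b).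
  rewrite -pisoX// -(piso1 p) => /piso_inj e; apply: (attracted_infinite hb n00).
  by apply: e; [exact: subgroupX|exact: subgroup1].
by exists n, w; split=> //; split=> //; exists v, l.
Qed.

Lemma end_map_total p u : is_end u -> exists w, end_map p u w.
Proof.
move=> [a ha]; have [n n0 pn] := finite_index_expg a (piso_domP p).
have [m [w [m0 hw]]] := end_map_expg pn (attracted_expg n0 ha).
exists w, (a ^+ n ^+ m)%g; split; last by rewrite pisoX.
  by apply: subgroupX => //; case: (piso_domP p).
by apply: attracted_expg => //; exact: attracted_expg.
Qed.

Lemma end_map_inj p u w u' w' : end_map p u w -> end_map p u' w' -> u = u' <-> w = w'.
Proof.
move=> [b [pb bu bw]] [b' [pb' bu' bw']].
by rewrite -(same_end_attracted bu bu') -(same_end_attracted bw bw'); exact: same_end_pisoE.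
Qed.

Lemma end_map_domain p u w : end_map p u w -> is_end u.
Proof. by case=> b [_ bu _]; exact: attracted_is_end bu. Qed.

Lemma end_map_codomain p u w : end_map p u w -> is_end w.
Proof. by case=> b [_ _ bw]; exact: attracted_is_end bw. Qed.

Lemma end_map_side p u1 u2 u3 u4 w1 w2 w3 w4 :
  end_map p u1 w1 -> end_map p u2 w2 -> end_map p u3 w3 -> end_map p u4 w4 ->
  u1 <> u2 -> u1 <> u3 -> u2 <> u3 -> u1 <> u4 -> u2 <> u4 ->
  0 < tri u1 u2 u3 * tri u1 u2 u4 <-> 0 < tri w1 w2 w3 * tri w1 w2 w4.
Proof.
move=> e1 e2 e3 e4 n12 n13 n23 n14 n24.
have pos i j wi wj : end_map p i wi -> end_map p j wj -> i <> j -> 0 < <<i, j>> /\ 0 < <<wi, wj>>.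
  move=> ei ej ij; split.
    by apply: is_end_neq => //; [exact: end_map_domain ei|exact: end_map_domain ej].
  apply: is_end_neq; [exact: end_map_codomain ei|exact: end_map_codomain ej|].
  by move=> /(end_map_inj ei ej).
have [p12 q12] := pos _ _ _ _ e1 e2 n12; have [p13 q13] := pos _ _ _ _ e1 e3 n13.
have [p23 q23] := pos _ _ _ _ e2 e3 n23; have [p14 q14] := pos _ _ _ _ e1 e4 n14.
have [p24 q24] := pos _ _ _ _ e2 e4 n24.
have [a [pa [_ [a' [la ha]]] [_ [a'' [la' ha']]]]] := e1.
have [b [pb [_ [b' [lb hb]]] [_ [b'' [lb' hb']]]]] := e2.
have [c [pc [_ [c' [lc hc]]] [_ [c'' [lc' hc']]]]] := e3.
have [d [pd [_ [d' [ld hd]]] [_ [d'' [ld' hd']]]]] := e4.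
have A := joinedP (piso_domP p) ha hb hc hd pa pb pc pd p12 p13 p23 p14 p24.
have im := @piso_im _ p.
have B := joinedP (piso_codP p) ha' hb' hc' hd' (im _ pa) (im _ pb) (im _ pc) (im _ pd)
  q12 q13 q23 q14 q24.
by rewrite -A -B; exact: joined_pisoE.
Qed.

Lemma end_map_commensurable p q u w : commensurable p q -> end_map p u w -> end_map q u w.
Proof.
move=> [K [fK Kp Kq pq]] [b [pb bu bw]].
have [n n0 Kn] := finite_index_expg b fK.
exists (b ^+ n)%g; split; first exact: Kq.
  exact: attracted_expg.
by rewrite -pq ?inE// pisoX//; exact: attracted_expg.
Qed.

Lemma end_map_comp p q u w z : end_map q u w -> end_map p w z -> end_map (piso_comp p q) u z.
Proof.
move=> [b [qb bu bw]] pz.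
have [n n0 pn] := finite_index_expg (q b) (piso_domP p).
have [m [z' [m0 hz']]] := end_map_expg pn (attracted_expg n0 bw).
have gq : group_closed (mem (piso_dom q)) by case: (piso_domP q).
have gp : group_closed (mem (piso_dom p)) by case: (piso_domP p).
have qbE : q (b ^+ n ^+ m)%g = (q b ^+ n ^+ m)%g.
  by rewrite -!expgnA pisoX.
have z'z : end_map p w z'.
  exists (q b ^+ n ^+ m)%g; split; [exact: subgroupX| |by rewrite pisoX].
  by apply: attracted_expg => //; exact: attracted_expg.
have <- : z' = z by apply/(end_map_inj z'z pz).
exists (b ^+ n ^+ m)%g; split.
- split; first by apply: subgroupX => //; exact: subgroupX.
  by rewrite /= qbE; exact: subgroupX.
- by apply: attracted_expg => //; exact: attracted_expg.
- by rewrite /= qbE pisoX.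
Qed.

Definition end_act (x : Comm Gamma2) u : 'cV[R]_3 := xget u [set w | end_map (repr x) u w].

Lemma end_actE p u w : end_map p u w -> end_act (comm_class p) u = w.
Proof.
move=> pw; have rw : end_map (repr (comm_class p)) u w.
  by apply: end_map_commensurable pw; apply/commensurable_sym/repr_comm_class.
rewrite /end_act; case: xgetP => [w' -> /= h|/(_ w)//].
by apply/(end_map_inj h rw).
Qed.

Lemma end_act_map p u : is_end u -> end_map p u (end_act (comm_class p) u).
Proof. by move=> /(end_map_total p)[w pw]; rewrite (end_actE pw). Qed.

Lemma is_end_act x u : is_end u -> is_end (end_act x u).
Proof.
move=> eu; have [p ->] := comm_classW x.
exact: end_map_codomain (end_act_map p eu).
Qed.

Lemma end_actM x y u : is_end u -> end_act (x * y)%g u = end_act x (end_act y u).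
Proof.
move=> eu; have [p ->] := comm_classW x; have [q ->] := comm_classW y.
rewrite [(_ * _)%g]Comm_mulE; apply: end_actE; apply: end_map_comp (end_act_map q eu) _.
by apply: end_act_map; exact: is_end_act.
Qed.

Lemma end_act1 u : is_end u -> end_act 1%g u = u.
Proof. by move=> [a ha]; apply: end_actE; exists a; split. Qed.

End Ends.

(** * Crossing chords between ends *)

Section Separation.
Variable R : archiRcfType.
Local Notation base := (basepoint R).
Local Notation rep := (lorentz R).
Local Notation is_end := (@is_end R).
Implicit Types (x y s t : Comm Gamma2) (u v w z : 'cV[R]_3).

(* The chord [u v] crosses the chord [w z]. *)
Definition cross u v w z : bool := tri u v w * tri u v z < 0.

Lemma cross_swap u v w z : cross u v w z -> cross v u w z.
Proof. by rewrite /cross triC (triC v u z) mulrNN. Qed.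

Lemma crossC u v w z : cross u v w z -> cross u v z w.
Proof. by rewrite /cross mulrC. Qed.

Lemma tri_mul_null u v w z : null_ray u -> null_ray v ->
  3 * (tri u v w * tri u v z) =
  <<u, v>> * (<<u, w>> * <<v, z>> + <<u, z>> * <<v, w>> - <<u, v>> * <<w, z>>).
Proof.
move=> [uu _] [vv _]; rewrite mulrA tri_gram uu vv (mfC v u) (mfC w u) (mfC w v).
ring.
Qed.

Lemma crossE u v w z : null_ray u -> null_ray v -> 0 < <<u, v>> ->
  cross u v w z = (<<u, w>> * <<v, z>> + <<u, z>> * <<v, w>> < <<u, v>> * <<w, z>>).
Proof.
move=> nu nv uv; have e := tri_mul_null w z nu nv.
have three0 : 0 < (3 : R) by rewrite ltr0n.
by rewrite /cross -(pmulr_rlt0 _ three0) e pmulr_rlt0// subr_lt0.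
Qed.

(* Ptolemy for four points of a conic. *)
Lemma null_ptolemy u v w z : null_ray u -> null_ray v -> null_ray w -> null_ray z ->
  0 < <<u, v>> ->
  (<<u, w>> * <<v, z>> + <<u, z>> * <<v, w>> - <<u, v>> * <<w, z>>) ^+ 2 =
  4 * (<<u, w>> * <<v, z>>) * (<<u, z>> * <<v, w>>).
Proof.
move=> nu nv nw nz uv.
have := tri_mul_null w w nu nv; have := tri_mul_null z z nu nv.
have := tri_mul_null w z nu nv; have [-> _] := nw; have [-> _] := nz.
set t := tri u v w; set s := tri u v z; set m := <<u, v>> in uv *.
rewrite !mulr0 !subr0 => ets ess ett.
have m2 : m ^+ 2 != 0 by rewrite expf_neq0 // gt_eqF.
apply: (mulfI m2); rewrite -exprMn -ets.
have -> : (3 * (t * s)) ^+ 2 = (3 * (t * t)) * (3 * (s * s)) by ring.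
by rewrite ett ess; ring.
Qed.

Definition distinct4 u v w z : Prop :=
  [/\ u <> v, u <> w & u <> z] /\ [/\ v <> w, v <> z & w <> z].

(** With [a], [b], [c] the products over the three pairings, the crossings are [b + c < a] and its
    analogues. By [null_ptolemy] the pairwise products of [b + c - a], [a + c - b], [a + b - c] sum
    to 0; if all three were nonnegative, two would vanish, and then one of [a], [b], [c] as well. *)
Lemma four_ends u v w z : is_end u -> is_end v -> is_end w -> is_end z ->
  distinct4 u v w z ->
  [/\ [\/ cross u v w z, cross u w v z | cross u z v w],
      ~ (cross u v w z /\ cross u w v z), ~ (cross u v w z /\ cross u z v w) &
      ~ (cross u w v z /\ cross u z v w)].
Proof.
move=> eu ev ew ez [[uv uw uz] [vw vz wz]].
have [[nu nv] [nw nz]] := ((is_end_null eu, is_end_null ev), (is_end_null ew, is_end_null ez)).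
have puv := is_end_neq eu ev uv; have puw := is_end_neq eu ew uw.
have puz := is_end_neq eu ez uz; have pvw := is_end_neq ev ew vw.
have pvz := is_end_neq ev ez vz; have pwz := is_end_neq ew ez wz.
have pt := null_ptolemy nu nv nw nz puv.
rewrite !crossE// (mfC w v) (mfC z v) (mfC z w).
have := mulr_gt0 puv pwz; have := mulr_gt0 puw pvz; have := mulr_gt0 puz pvw.
set a := <<u, v>> * <<w, z>> in pt *; set b := <<u, w>> * <<v, z>> in pt *.
set c := <<u, z>> * <<v, w>> in pt * => c0 b0 a0.
clearbody a b c; clear -a b c pt a0 b0 c0.
split; last 3 first.
- by case=> h1 h2; lra.
- by case=> h1 h2; lra.
- by case=> h1 h2; lra.
case: (ltrP (b + c) a) => ha; first by constructor 1.
case: (ltrP (a + c) b) => hb; first by constructor 2.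
case: (ltrP (a + b) c) => hc; first by constructor 3.
exfalso.
have x0 : 0 <= b + c - a by rewrite subr_ge0.
have y0 : 0 <= a + c - b by rewrite subr_ge0.
have z0 : 0 <= a + b - c by rewrite subr_ge0.
have xy := mulr_ge0 x0 y0; have yz := mulr_ge0 y0 z0; have xz := mulr_ge0 x0 z0.
have sum : (b + c - a) * (a + c - b) + (a + c - b) * (a + b - c) + (b + c - a) * (a + b - c) = 0 by lra.
have exy : (b + c - a) * (a + c - b) = 0 by lra.
have eyz : (a + c - b) * (a + b - c) = 0 by lra.
have exz : (b + c - a) * (a + b - c) = 0 by lra.
move/eqP: exy; rewrite mulf_eq0 => /orP[/eqP X|/eqP Y].
  move/eqP: eyz; rewrite mulf_eq0 => /orP[/eqP Y|/eqP Z]; lra.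
move/eqP: exz; rewrite mulf_eq0 => /orP[/eqP X|/eqP Z]; lra.
Qed.

Lemma cross_sym u v w z : is_end u -> is_end v -> is_end w -> is_end z ->
  u <> v -> w <> z -> cross u v w z -> cross w z u v.
Proof.
move=> eu ev ew ez uv wz.
have [[nu nv] [nw nz]] := ((is_end_null eu, is_end_null ev), (is_end_null ew, is_end_null ez)).
have puv := is_end_neq eu ev uv; have pwz := is_end_neq ew ez wz.
by rewrite !crossE// (mfC w u) (mfC w v) (mfC z v) (mfC z u)
  (mulrC <<w, z>>) (mulrC <<u, w>>) (mulrC <<v, w>>) (addrC (_ * <<u, w>>)).
Qed.

Lemma end_act_inj x u v : is_end u -> is_end v -> u <> v -> end_act x u <> end_act x v.
Proof.
move=> eu ev uv e; apply: uv.
by rewrite -(end_act1 eu) -(end_act1 ev) -(mulVg x) !end_actM// e.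
Qed.

Lemma is_end_tri u v w : is_end u -> is_end v -> is_end w -> u <> v -> u <> w -> v <> w ->
  tri u v w != 0.
Proof.
move=> eu ev ew uv uw vw.
have [nu [nv nw]] := (is_end_null eu, (is_end_null ev, is_end_null ew)).
have := tri_sqr nu nv w; have [-> _] := nw; rewrite mulr0 add0r => e.
apply/eqP => t0; move: e; rewrite t0 expr0n mulr0 => /eqP; rewrite gt_eqF//.
by rewrite !mulr_gt0// is_end_neq.
Qed.

Lemma cross_act x u v w z : is_end u -> is_end v -> is_end w -> is_end z ->
  distinct4 u v w z -> cross u v w z =
  cross (end_act x u) (end_act x v) (end_act x w) (end_act x z).
Proof.
have crossN u1 v1 w1 z1 : is_end u1 -> is_end v1 -> is_end w1 -> is_end z1 ->
    distinct4 u1 v1 w1 z1 -> cross u1 v1 w1 z1 = ~~ (0 < tri u1 v1 w1 * tri u1 v1 z1).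
  move=> eu ev ew ez [[uv uw uz] [vw vz wz]].
  have tw := is_end_tri eu ev ew uv uw vw; have tz := is_end_tri eu ev ez uv uz vz.
  by rewrite /cross -leNgt lt_neqAle mulf_eq0 (negbTE tw) (negbTE tz).
move=> eu ev ew ez d; have [[uv uw uz] [vw vz wz]] := d.
have d' : distinct4 (end_act x u) (end_act x v) (end_act x w) (end_act x z).
  by split; split; exact: end_act_inj.
rewrite !crossN//; try exact: is_end_act.
have [p xE] := comm_classW x; rewrite xE.
congr negb; apply/idP/idP;
  by apply (end_map_side (end_act_map p eu) (end_act_map p ev) (end_act_map p ew) (end_act_map p ez)).
Qed.

Lemma order3_fixed s u v : (s ^+ 3 = 1)%g -> is_end u -> end_act s u = u ->
  is_end v -> end_act s v = v.
Proof.
move=> s3 eu su ev; apply: contrapT => sv.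
pose v1 := end_act s v; pose v2 := end_act s v1.
have ev1 : is_end v1 by exact: is_end_act.
have ev2 : is_end v2 by exact: is_end_act.
have v3 : end_act s v2 = v.
  by rewrite -[RHS](end_act1 ev) -s3 !expgS expg0 mulg1 !end_actM.
have vv1 : v <> v1 by move=> h; apply: sv; rewrite -/v1 -h.
have v12 : v1 <> v2 by exact: end_act_inj.
have v20 : v2 <> v by have := end_act_inj (x := s) ev1 ev2 v12; rewrite v3.
have uv : u <> v by move=> h; apply: sv; rewrite -h su.
have uv1 : u <> v1 by have := end_act_inj (x := s) eu ev uv; rewrite su.
have uv2 : u <> v2 by have := end_act_inj (x := s) eu ev1 uv1; rewrite su.
have d : distinct4 u v v1 v2 by split; split=> // /esym.
have d1 : distinct4 u v1 v v2 by split; split=> // /esym.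
have d2 : distinct4 u v2 v v1 by split; split=> // /esym.
have r1 : cross u v v1 v2 -> cross u v1 v v2.
  rewrite (cross_act s eu ev ev1 ev2 d) su v3; exact: crossC.
have r2 : cross u v1 v v2 -> cross u v2 v v1.
  rewrite (cross_act s eu ev1 ev ev2 d1) su v3; exact: crossC.
have r3 : cross u v2 v v1 -> cross u v v1 v2.
  rewrite (cross_act s eu ev2 ev ev1 d2) su v3; exact.
have [h n1 n2 n3] := four_ends eu ev ev1 ev2 d.
case: h => h; [by apply: n1; split=> //; exact: r1|by apply: n3; split=> //; exact: r2|].
by apply: n2; split=> //; exact: r3.
Qed.

(** Four vectors in dimension 3 satisfy a linear relation with determinants as coefficients; this is
    that relation paired with [u]. It makes [tri u p z / <<u, z>>] an affine coordinate on the
    points at infinity other than [u]. *)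
Lemma tri_projection (u p y z : 'cV[R]_3) : null_ray u ->
  <<u, p>> * tri u y z = <<u, y>> * tri u p z - <<u, z>> * tri u p y.
Proof.
move=> [uu _].
have : <<u, u>> * tri p y z - <<u, p>> * tri u y z + <<u, y>> * tri u p z
   - <<u, z>> * tri u p y = 0 by rewrite !mfE /tri; ring.
rewrite uu; lra.
Qed.

(* Among finitely many points, one is next to [u]: maximise a projective coordinate
   centred at [u]. *)
Lemma adjacent_end (I : finType) (f : I -> 'cV[R]_3) (i j : I) :
  (forall k, is_end (f k)) -> injective f -> i != j ->
  exists2 k, k != i & forall l m, l != i -> m != i -> ~ cross (f i) (f k) (f l) (f m).
Proof.
move=> ef fI ij; set u := f i; set p := f j.
have up : 0 < <<u, p>>.
  apply: is_end_neq; [exact: ef|exact: ef|].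
  by move=> /fI e; rewrite e eqxx in ij.
pose kap k := tri u p (f k) / <<u, f k>>.
have pos k : k != i -> 0 < <<u, f k>>.
  move=> ki; apply: is_end_neq; [exact: ef|exact: ef|].
  by move=> /fI e; rewrite e eqxx in ki.
have triE k l : k != i -> l != i -> <<u, p>> * tri u (f k) (f l) =
    <<u, f k>> * <<u, f l>> * (kap l - kap k).
  move=> ki li; rewrite (tri_projection p (f k) (f l) (is_end_null (ef i))) /kap.
  by field; rewrite !gt_eqF ?pos.
have ji : j != i by rewrite eq_sym.
case: (@Order.TotalTheory.arg_maxP _ _ _ j (fun k => k != i) kap ji) => k ki kmax.
exists k => // l m li mi; rewrite /cross => c.
have c' : (<<u, p>> * tri u (f k) (f l)) * (<<u, p>> * tri u (f k) (f m)) < 0.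
  by rewrite mulrACA pmulr_rlt0// mulr_gt0.
move: c'; rewrite !triE//; apply/negP; rewrite -leNgt.
rewrite mulrACA mulr_ge0//.
  by rewrite !mulr_ge0 ?ltW ?pos.
by rewrite -mulrNN mulr_ge0// oppr_ge0 subr_le0; apply: kmax.
Qed.

End Separation.

(** * Faithfulness on ends and exclusion of Z/3 x Z/3 *)

Section Rotations.
Variable R : archiRcfType.
Local Notation base := (basepoint R).
Local Notation rep := (lorentz R).
Local Notation is_end := (@is_end R).
Implicit Types (x y s t : Comm Gamma2) (u v w z : 'cV[R]_3).

(** The product of two reflections in ultraparallel sides translates along their common
    perpendicular. Its null eigenvectors lie in the span of the two roots; [m] and [m^-1] are the
    zeros of the quadratic, and the eigenvalue [4 * m - 1] is [m ^+ 2]. *)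
Lemma hex_hyperbolic (i j : 'I_6) (a : Gamma2) (m : R) : root_gram i j = -2 -> rep a = hex_mx R [:: j; i] ->
  m ^+ 2 - 4 * m + 1 = 0 -> 1 < 4 * m - 1 -> is_end ((1 + m)^-1 *: (root R i + m *: root R j)).
Proof.
move=> gij aE mE m1.
have rooti k : form (root R k) (root R k) = 1.
  by rewrite form_root /root_gram addKn modnn.
have rij : form (root R i) (root R j) = -2 by rewrite form_root gij.
have m0 : 0 < m by lra.
have minv : m^-1 = 4 - m.
  by apply: (mulfI (lt0r_neq0 m0)); rewrite mulfV ?gt_eqF//; lra.
have eig (n : R) : n ^+ 2 - 4 * n + 1 = 0 ->
    hex_mx R [:: j; i] *m (root R i + n *: root R j) = (4 * n - 1) *: (root R i + n *: root R j).
  move=> nE; rewrite /= mulmx1 -mulmxA !refl_mul.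
  rewrite !(formDr, formZr, formNr) rooti rij (formC _ (root R i)) rij rooti.
  rewrite scalerDr scalerA.
  have e : (4 * n - 1) * n = 15 * n - 4 by lra.
  rewrite e; apply: vec3P; rewrite !mxE; ring.
have null (n : R) : 0 < n -> n ^+ 2 - 4 * n + 1 = 0 -> null_ray (root R i + n *: root R j).
  move=> n0 nE; split; last by rewrite !mxE /= mulr1 addr_gt0.
  rewrite /minus_form !(formDl, formDr, formZl, formZr) !rooti rij (formC (root R j)) rij; lra.
have s0 : 0 < 1 + m by lra.
have [n2 n20] := null _ m0 mE.
exists a; split; first by rewrite !mxE /= mulr1 mulVf// gt_eqF.
exists (root R i + m^-1 *: root R j), (4 * m - 1).
have iE : m^-1 ^+ 2 - 4 * m^-1 + 1 = 0 by rewrite minv; lra.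
split=> //.
- split; first by rewrite mfZl mfZr n2 !mulr0.
  by rewrite mxE mulr_gt0 ?invr_gt0.
- by apply: null; rewrite ?invr_gt0.
- by rewrite aE -scalemxAr eig// !scalerA mulrC.
- rewrite aE eig//; congr (_ *: _); apply: (mulfI (lt0r_neq0 (lt_trans ltr01 m1))).
  rewrite mulfV ?gt_eqF ?(lt_trans ltr01)// minv; lra.
Qed.

Lemma three_ends : exists u v w, [/\ is_end u, is_end v & is_end w] /\ [/\ u <> v, u <> w & v <> w].
Proof.
pose m : R := 2 + Num.sqrt 3.
have s3 : Num.sqrt (3 : R) ^+ 2 = 3 by rewrite sqr_sqrtr// ler0n.
have s0 : 0 < Num.sqrt (3 : R) by rewrite sqrtr_gt0 ltr0n.
have mE : m ^+ 2 - 4 * m + 1 = 0 by rewrite /m; lra.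
have m1 : 1 < 4 * m - 1 by rewrite /m; lra.
have m2 : 2 < m by rewrite /m; lra.
pose l k b : 'I_4 * bool := (Ordinal (ltn_pmod k (isT : 0 < 4)%N), b).
have repl k b : rep (gamma_word [:: l k b]) = hex_mx R (hex_letter (l k b)).
  by rewrite [LHS]rep_class /hex_word /= cats0.
have e1 := @hex_hyperbolic (hex 0) (hex 2) _ m erefl (repl 0%N false) mE m1.
have e2 := @hex_hyperbolic (hex 2) (hex 0) _ m erefl (repl 0%N true) mE m1.
have e3 := @hex_hyperbolic (hex 0) (hex 4) _ m erefl (repl 3%N false) mE m1.
have m10 : (1 + m)^-1 != 0 by rewrite invr_eq0 gt_eqF//; lra.
exists ((1 + m)^-1 *: (root R (hex 0) + m *: root R (hex 2))).
exists ((1 + m)^-1 *: (root R (hex 2) + m *: root R (hex 0))).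
exists ((1 + m)^-1 *: (root R (hex 0) + m *: root R (hex 4))).
split=> //; split=> /(scalerI m10) /(congr1 (fun z : 'cV[R]_3 => (z i0 0, z i1 0)));
  rewrite !mxE /= => -[h h']; lra.
Qed.

(** As [p] carries [h b h^-1] to the conjugate of [p b] by [p h], a trivial action makes [h] and
    [p h] agree on ends, so [g] fixes every end. Its eigenvalues at three ends multiply pairwise to
    1, hence are all 1. *)
Lemma end_act_faithful x : (forall u, is_end u -> end_act x u = u) -> x = 1%g.
Proof.
have [p ->] := comm_classW x => triv; apply/comm_classP.
exists (piso_dom p); split=> //; first exact: piso_domP.
move=> h /set_mem ph /=; have gp : group_closed (mem (piso_dom p)) by case: (piso_domP p).
pose g := (h^-1 * p h)%g.
have eig u : is_end u -> exists c, rep g *m u = c *: u.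
  move=> eu; have := end_act_map p eu; rewrite triv// => -[b [pb bu bw]].
  have hm : end_map p (normalize (rep h *m u)) (normalize (rep (p h) *m u)).
    exists (h * b * h^-1)%g; split; last 2 first.
    - exact: attracted_conj.
    - rewrite !pisoM' ?pisoV//; first exact: attracted_conj.
        exact: subgroupM.
      exact: subgroupV.
    by apply: subgroupM; [|exact: subgroupM|exact: subgroupV].
  have := end_actE hm; rewrite triv; last exact: end_map_domain hm.
  rewrite /normalize => e.
  have [_ n2] := rep_null (p h) (is_end_null eu).
  exists ((rep (p h) *m u) i2 0 * ((rep h *m u) i2 0)^-1).
  rewrite /g repM -mulmxA -scalerA.
  have E : rep (p h) *m u = (rep (p h) *m u) i2 0 *: (((rep h *m u) i2 0)^-1 *: (rep h *m u)).
    by rewrite e scalerA mulfV ?scale1r// gt_eqF.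
  by rewrite [X in _ *m X = _]E -!scalemxAr repVK.
have pos u c : is_end u -> rep g *m u = c *: u -> 0 < c.
  move=> eu cE; have [_] := rep_null g (is_end_null eu).
  by rewrite cE mxE (is_end_time eu) mulr1.
have prod u v c d : is_end u -> is_end v -> u <> v -> rep g *m u = c *: u -> rep g *m v = d *: v ->
    c * d = 1.
  move=> eu ev uv cE dE; have m0 := is_end_neq eu ev uv.
  apply: (mulIf (lt0r_neq0 m0)); rewrite mul1r -mulrA -mfZr -mfZl -cE -dE.
  exact: rep_mf.
have [u [v [w [[eu ev ew] [uv uw vw]]]]] := three_ends.
have [[c cE] [[d dE] [f fE]]] := (eig u eu, (eig v ev, eig w ew)).
have [c0 [d0 f0]] := (pos _ _ eu cE, (pos _ _ ev dE, pos _ _ ew fE)).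
have cd := prod _ _ _ _ eu ev uv cE dE; have cf := prod _ _ _ _ eu ew uw cE fE.
have df := prod _ _ _ _ ev ew vw dE fE.
have one (r r' r'' : R) : 0 < r -> r * r' = 1 -> r * r'' = 1 -> r' * r'' = 1 -> r = 1.
  move=> r0 e1 e2 e3.
  have e4 : r ^+ 2 = 1 by rewrite -[RHS](mulr1 1) -{1}e1 -e2 -[LHS]mulr1 -e3; ring.
  by apply/eqP; rewrite -(@eqrXn2 _ 2) ?expr1n ?e4// ltW.
have c1 := one _ _ _ c0 cd cf df.
have d1 : d = 1 by rewrite -cd c1 mul1r.
have f1 : f = 1 by rewrite -cf c1 mul1r.
rewrite c1 scale1r in cE; rewrite d1 scale1r in dE; rewrite f1 scale1r in fE.
(* Orthogonal to three independent fixed vectors, hence 0: [g] fixes the basepoint. *)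
pose del := rep g *m base - base.
have dz z : rep g *m z = z -> <<z, del>> = 0.
  by move=> zE; rewrite /del /minus_form formDr formNr -{1}zE rep_isometry subrr oppr0.
have m0 := is_end_neq eu ev uv.
have dec := axis_decomposition (is_end_null eu) (is_end_null ev) del.
rewrite (dz u cE) (dz v dE) !mulr0 !scale0r !add0r in dec.
have t0 : tri u v del = 0.
  have := congr1 (fun z => <<w, z>>) dec; rewrite !mfZr (dz w fE) mulr0 mf_conormal.
  move=> /esym/eqP; rewrite mulrN oppr_eq0 mulf_eq0 (negbTE (is_end_tri eu ev ew uv uw vw)) orbF.
  by rewrite mulf_eq0 pnatr_eq0 => /eqP.
rewrite t0 mulr0 scale0r in dec.
have g1 : g = 1%g.
  apply: (@rep_base_inj R); rewrite rep1 mul1mx; apply/eqP; rewrite -subr_eq0; apply/eqP.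
  apply: (scalerI (_ : <<u, v>> ^+ 2 != 0)); first by rewrite expf_neq0// gt_eqF.
  by rewrite scaler0; exact: dec.
by have := mulVKg h (p h); rewrite -/g g1 mulg1.
Qed.

Local Notation I9 := ('I_3 * 'I_3)%type.

Lemma ord3_add3 (k : I9) : k + k + k = 0.
Proof.
have h (i : 'I_3) : i + i + i = 0 by case: i => [[|[|[|//]]] hi]; exact/val_inj.
by case: k => i j; congr pair; exact: h.
Qed.

Lemma Comm_Gamma2_no_Z3xZ3 (g : I9 -> Comm Gamma2) :
  (forall k l, g (k + l) = (g k * g l)%g) -> ~ (forall k, g k = 1%g -> k = 0).
Proof.
move=> gD gI.
have g0 : g 0 = 1%g by apply: (@mulgI _ (g 0)); rewrite -gD addr0 mulg1.
have g3 k : (g k ^+ 3 = 1)%g.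
  by rewrite !expgS expg0 mulg1 -!gD addrA ord3_add3.
have [u [_ [_ [[eu _ _] _]]]] := three_ends.
pose f k := end_act (g k) u.
have ef k : is_end (f k) by rewrite /f; apply: is_end_act; exact: eu.
have fD k l : end_act (g k) (f l) = f (k + l).
  by rewrite /f gD (end_actM (g k) (g l) eu).
have fI : injective f.
  move=> k l e; apply/eqP; rewrite -subr_eq0; apply/eqP; apply: gI; apply: end_act_faithful => v ev.
  apply: (order3_fixed (g3 _) (ef l)) ev.
  by rewrite fD subrK.
have i10 : (0 : I9) != (1, 0) by [].
have [k k0 adj] := adjacent_end ef fI i10.
have kk0 : k + k != 0.
  apply: contra_neq k0 => kk; by have := ord3_add3 k; rewrite kk add0r.
have [r [r0 rk rkk]] : exists r : I9, [/\ r != 0, r != k & r != k + k].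
  case: (pickP (fun r : I9 => r \notin [:: 0; k; k + k])) => [r|no].
    by rewrite !inE !negb_or => /and3P[? ? ?]; exists r.
  have : (#|{: I9}| <= 3)%N.
    rewrite -[3%N]/(size [:: 0; k; k + k]) -[X in (X <= _)%N](_ : #|[:: 0; k; k + k]| = _).
      exact: card_size.
    by apply: eq_card => r; have /negbFE -> := no r; rewrite inE.
  by rewrite card_prod card_ord.
have nk l m : l != m -> f l <> f m by move=> /eqP lm /fI.
have d : distinct4 (f 0) (f k) (f (k + k)) (f r).
  have kkk : k != k + k by rewrite -subr_eq0 opprD addNKr oppr_eq0.
  by split; split; apply: nk; rewrite // eq_sym.
have rpk : r + k != 0.
  apply: contra_neq rkk => e; apply: (addIr k); by rewrite e ord3_add3.
have rpkk : r + (k + k) != 0.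
  by apply: contra_neq rk => e; apply: (addIr (k + k)); rewrite e addrA ord3_add3.
have [h _ _ _] := four_ends (ef 0) (ef k) (ef (k + k)) (ef r) d; have [[d1 d2 d3] [d4 d5 d6]] := d.
(* The first pairing is excluded by [adj]. Translations by [g k] and by [g (k + k)] carry the other
   two to chords crossing the one from [f 0] to [f k], which [adj] excludes too. *)
case: h => h.
- exact: (adj (k + k) r).
- have dd : distinct4 (f 0) (f (k + k)) (f k) (f r) by split; split=> // /esym.
  move: h; rewrite (cross_act (g k) (ef _) (ef _) (ef _) (ef _) dd) !fD addr0.
  rewrite addrA ord3_add3 (addrC k r) => /cross_swap; exact: adj.
- move/(cross_sym (ef _) (ef _) (ef _) (ef _) d3 d4): h => h.
  have dd : distinct4 (f k) (f (k + k)) (f 0) (f r) by split; split=> // /esym.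
  move: h; rewrite (cross_act (g (k + k)) (ef _) (ef _) (ef _) (ef _) dd) !fD addr0.
  rewrite ord3_add3 [k + k + (k + k)]addrA ord3_add3 add0r (addrC _ r); exact: adj.
Qed.

End Rotations.

(** * Commuting elements of order three in Comm F2 *)

Section FreeAction.
Variables (I : choiceType) (T : Type) (act : I * bool -> T -> T).
Hypothesis actK : forall i b t, act (i, b) (act (i, ~~ b) t) = t.
Local Notation free := (presented (I := I) set0).
Implicit Types (x y : free).

Definition free_act x (t : T) : T := foldr act t (repr x).

Lemma free_act_word w t : free_act (word_class set0 w) t = foldr act t w.
Proof.
suff ext u v : word_eq set0 u v -> forall t, foldr act t u = foldr act t v.
  by apply: ext; exact: repr_word_class.
elim=> {u v} [//|u v _ e t'|u v w' _ e1 _ e2 t'|u u' v v' _ e1 _ e2 t'|i b t'|r []].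
- by rewrite e.
- by rewrite e1 e2.
- by rewrite !foldr_cat e2 e1.
- exact: actK.
Qed.

Lemma free_actM x y t : free_act (x * y)%g t = free_act x (free_act y t).
Proof.
have [u ->] := word_classW x; have [v ->] := word_classW y.
by rewrite [(_ * _)%g]presented_mulE !free_act_word foldr_cat.
Qed.

Lemma free_act1 t : free_act 1%g t = t.
Proof. exact: (free_act_word [::]). Qed.

Lemma free_act_generator i t : free_act (generator set0 i) t = act (i, false) t.
Proof. exact: (free_act_word [:: (i, false)]). Qed.

Lemma free_actVK x t : free_act x^-1%g (free_act x t) = t.
Proof. by rewrite -free_actM mulVg free_act1. Qed.

End FreeAction.

Lemma presented_ind (I : choiceType) (S : set (word I)) (P : presented S -> Prop) :
  P 1%g -> (forall i, P (generator S i)) -> (forall x y, P x -> P y -> P (x * y)%g) ->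
  (forall x, P x -> P x^-1%g) -> forall x, P x.
Proof.
move=> P1 Pg PM PV x; have [w ->] := word_classW x.
elim: w => [//|[i b] w IH]; rewrite -cat1s -presented_mulE.
apply: PM => //; case: b; last exact: Pg.
have -> : word_class S [:: (i, true)] = (generator S i)^-1%g by rewrite [RHS]presented_invE.
exact: PV.
Qed.

(** * Permuting the conjugates of the second generator of F2 *)

Section Transducer.
Local Notation a := (generator set0 (0 : 'I_2) : F2).
Local Notation b := (generator set0 (1 : 'I_2) : F2).
Implicit Types (x y : F2) (s : 'I_6) (f : 'I_6 -> 'I_6).

Definition shift_letter (l : 'I_2 * bool) s : 'I_6 :=
  if l.1 == 0 then (if l.2 then s - 1 else s + 1) else s.

Lemma shift_letterK i c s : shift_letter (i, c) (shift_letter (i, ~~ c) s) = s.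
Proof.
by rewrite /shift_letter /=; case: eqP => // _; case: c; rewrite ?addrK ?subrK.
Qed.

Definition degree x : 'I_6 := free_act shift_letter x 0.

Lemma shiftE x s : free_act shift_letter x s = s + degree x.
Proof.
rewrite /degree /free_act; elim: (repr x) => [|l w IH] /=; first by rewrite addr0.
by rewrite IH /shift_letter; case: ifP => // _; case: ifP => _; rewrite addrA.
Qed.

Lemma degreeM x y : degree (x * y)%g = degree x + degree y.
Proof. by rewrite /degree (free_actM shift_letterK) shiftE addrC. Qed.

Lemma degree1 : degree 1%g = 0.
Proof. exact: free_act1 shift_letterK _. Qed.

Lemma degreeV x : degree x^-1%g = - degree x.
Proof. by apply: (addIr (degree x)); rewrite -degreeM mulVg degree1 addNr. Qed.

Lemma degree_a : degree a = 1.
Proof. by rewrite /degree (free_act_generator shift_letterK) /shift_letter /= add0r. Qed.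

Lemma degree_b : degree b = 0.
Proof. exact: free_act_generator shift_letterK _ _. Qed.

Lemma degreeX x n : degree (x ^+ n)%g = degree x *+ n.
Proof. by elim: n => [|n IH]; rewrite ?expg0 ?degree1// expgS degreeM IH mulrS. Qed.

Lemma degree_aX s : degree (a ^+ s)%g = s.
Proof. by rewrite degreeX degree_a natr_Zp. Qed.

Definition relabel f s : F2 := (a ^- f s * a ^+ s)%g.

(** The state is the degree modulo 6 of what has been read, so a letter [b] met in state [s] belongs
    to a conjugate [a^-s b a^s]. Conjugating it by [relabel f s] changes the exponent to [f s],
    while letters [a] are kept. *)
Definition transducer f (l : 'I_2 * bool) (t : 'I_6 * F2) : 'I_6 * F2 :=
  let out := if l.1 == 0 then a else (relabel f t.1 * b * (relabel f t.1)^-1)%g in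
  (shift_letter l t.1, (if l.2 then out^-1 else out) * t.2)%g.

Lemma transducerK f i c t : transducer f (i, c) (transducer f (i, ~~ c) t) = t.
Proof.
case: t => s x; rewrite /transducer /= shift_letterK; congr pair.
rewrite /shift_letter /=; case: eqP => _; case: c => /=; rewrite ?mulKg ?mulVKg//.
Qed.

(* [rewrite_from f x s] relabels the conjugates [a^-i b a^i] occurring in [x], read from
   right to left starting in state [s], as [a^-(f i) b a^(f i)]. *)
Definition rewrite_from f x s : F2 := (free_act (transducer f) x (s, 1%g)).2.

Lemma transducerE f x s y :
  free_act (transducer f) x (s, y) = (s + degree x, rewrite_from f x s * y)%g.
Proof.
rewrite /rewrite_from -shiftE /free_act; elim: (repr x) y => [|l w IH] y /=.
  by rewrite mul1g.
by rewrite IH (IH 1%g) /transducer /= mulg1 mulgA.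
Qed.

Lemma rewrite_fromM f x y s :
  rewrite_from f (x * y)%g s = (rewrite_from f x (s + degree y)%R * rewrite_from f y s)%g.
Proof.
rewrite {1}/rewrite_from (free_actM (transducerK f)) [X in free_act _ _ X]transducerE.
by rewrite transducerE /= mulg1.
Qed.

Lemma rewrite_from1 f s : rewrite_from f 1%g s = 1%g.
Proof. by rewrite /rewrite_from (free_act1 (transducerK f)). Qed.

Lemma rewrite_fromV f x s :
  rewrite_from f x^-1%g s = (rewrite_from f x (s - degree x)%R)^-1%g.
Proof.
apply: (mulgI (rewrite_from f x (s - degree x))); rewrite mulgV -degreeV -rewrite_fromM.
by rewrite mulgV rewrite_from1.
Qed.

Lemma rewrite_from_a f s : rewrite_from f a s = a.
Proof. by rewrite /rewrite_from (free_act_generator (transducerK f)) /= mulg1. Qed.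

Lemma rewrite_from_b f s :
  rewrite_from f b s = (relabel f s * b * (relabel f s)^-1)%g.
Proof. by rewrite /rewrite_from (free_act_generator (transducerK f)) /= mulg1. Qed.

Lemma rewrite_from_aX f n s : rewrite_from f (a ^+ n)%g s = (a ^+ n)%g.
Proof.
elim: n s => [|n IH] s; first by rewrite expg0 rewrite_from1.
by rewrite expgS rewrite_fromM rewrite_from_a IH.
Qed.

Lemma rewrite_from_aV f n s : rewrite_from f (a ^- n)%g s = (a ^- n)%g.
Proof. by rewrite rewrite_fromV rewrite_from_aX. Qed.

Lemma rewrite_from_relabel f g s s' : rewrite_from g (relabel f s) s' = relabel f s.
Proof. by rewrite rewrite_fromM rewrite_from_aX rewrite_from_aV. Qed.

Lemma relabel_comp f g s : (relabel f s * relabel g (f s) = relabel (g \o f) s)%g.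
Proof.
rewrite /relabel /=; set p := (a ^+ f s)%g; set q := (a ^+ g (f s))%g; set r := (a ^+ s)%g.
have aX m n : commute (a ^+ m)%g (a ^+ n)%g by exact: commuteX2.
have qr : commute q^-1%g r by apply/commute_sym/commuteV; exact: aX.
have pq : commute p q^-1%g by apply/commuteV; exact: aX.
have rp : commute r p by exact: aX.
apply: (mulgI p); rewrite !mulgA mulgV mul1g.
by rewrite -[LHS]mulgA -pq mulgA rp -!mulgA qr.
Qed.

Lemma degree_relabel f s : degree (relabel f s) = s - f s.
Proof. by rewrite degreeM degreeV !degree_aX addrC. Qed.

Lemma degree_rewrite_from f x s : degree (rewrite_from f x s) = degree x.
Proof.
elim/presented_ind: x s => [s|i s|x y IHx IHy s|x IH s].
- by rewrite rewrite_from1.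
- case: i => [[|[|//]] h].
    have -> : Ordinal h = 0 by exact/val_inj.
    by rewrite rewrite_from_a.
  have -> : Ordinal h = 1 by exact/val_inj.
  rewrite rewrite_from_b; move: (relabel f s) => c.
  by rewrite !degreeM degreeV addrAC subrr add0r.
- by rewrite rewrite_fromM !degreeM IHx IHy.
- by rewrite rewrite_fromV !degreeV IH.
Qed.

(** Rewriting preserves degrees, hence the states met later, and leaves powers of [a] unchanged; so
    it composes as the relabelings do. *)
Lemma rewrite_from_comp f g x s :
  rewrite_from g (rewrite_from f x s) s = rewrite_from (g \o f) x s.
Proof.
elim/presented_ind: x s => [s|i s|x y IHx IHy s|x IH s].
- by rewrite !rewrite_from1.
- case: i => [[|[|//]] h].
    have -> : Ordinal h = 0 by exact/val_inj.
    by rewrite !rewrite_from_a.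
  have -> : Ordinal h = 1 by exact/val_inj.
  rewrite !rewrite_from_b rewrite_fromM rewrite_fromV rewrite_fromM.
  rewrite !rewrite_from_relabel degreeV degree_relabel opprB addrC subrK rewrite_from_b.
  rewrite -(relabel_comp f g s); move: (relabel f s) (relabel g (f s)) => c c'.
  by rewrite invgM !mulgA.
- by rewrite !rewrite_fromM degree_rewrite_from IHx IHy.
- by rewrite !rewrite_fromV degree_rewrite_from IH.
Qed.

Lemma rewrite_from_id x s : rewrite_from id x s = x.
Proof.
elim/presented_ind: x s => [s|i s|x y IHx IHy s|x IH s].
- by rewrite rewrite_from1.
- case: i => [[|[|//]] h].
    have -> : Ordinal h = 0 by exact/val_inj.
    by rewrite rewrite_from_a.
  have -> : Ordinal h = 1 by exact/val_inj.
  by rewrite rewrite_from_b /relabel mulVg mul1g invg1 mulg1.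
- by rewrite rewrite_fromM IHx IHy.
- by rewrite rewrite_fromV IH.
Qed.


Definition degree0 : set F2 := [set x | degree x = 0].

Lemma degree0_finite_index : finite_index_subgroup degree0.
Proof.
apply: (@finite_index_color _ _ _ degree).
- apply: group_closedPset => [|x y]; rewrite /degree0 /=; first exact: degree1.
  by rewrite degreeM degreeV => -> ->; rewrite subr0.
- exact: finite_finset.
- by move=> x y e; rewrite /degree0 /= degreeM degreeV e addNr.
Qed.

Section RelabelIso.
Variables f g : 'I_6 -> 'I_6.
Hypothesis (fK : cancel f g) (gK : cancel g f).

Lemma rewrite_from_cancel x : rewrite_from g (rewrite_from f x 0) 0 = x.
Proof.
rewrite rewrite_from_comp -[RHS](rewrite_from_id x 0); congr rewrite_from.
by apply/funext => s; exact: fK.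
Qed.

Lemma rewrite_from_cancelV x : rewrite_from f (rewrite_from g x 0) 0 = x.
Proof.
rewrite rewrite_from_comp -[RHS](rewrite_from_id x 0); congr rewrite_from.
by apply/funext => s; exact: gK.
Qed.

Lemma rewrite_from_bij : set_bij degree0 degree0 (rewrite_from f ^~ 0).
Proof.
split=> [x|x y _ _ e|x x0]; first by rewrite /degree0 /= degree_rewrite_from.
  by rewrite -(rewrite_from_cancel x) e rewrite_from_cancel.
exists (rewrite_from g x 0); last exact: rewrite_from_cancelV.
by rewrite /degree0 /= degree_rewrite_from.
Qed.

Lemma rewrite_from_morph : {in degree0 &, {morph rewrite_from f ^~ 0 : x y / (x * y)%g}}.
Proof. by move=> x y _ /set_mem y0; rewrite rewrite_fromM y0 addr0. Qed.

Definition relabel_iso : partial_iso F2 :=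
  PartialIso degree0_finite_index degree0_finite_index rewrite_from_bij rewrite_from_morph.

End RelabelIso.

Lemma relabel_isoM f g f' g' (fK : cancel f g) (gK : cancel g f) (fK' : cancel f' g')
    (gK' : cancel g' f') h k (hK : cancel h k) (kK : cancel k h) : h =1 f \o f' ->
  (comm_class (relabel_iso hK kK) = comm_class (relabel_iso fK gK) * comm_class (relabel_iso fK' gK'))%g.
Proof.
move=> hE; rewrite [RHS]Comm_mulE; apply/comm_classP; exists degree0; split=> //.
- exact: degree0_finite_index.
- by move=> x x0; split=> //; rewrite /= /degree0 /= degree_rewrite_from.
- by move=> x _ /=; rewrite rewrite_from_comp; congr rewrite_from; exact/funext.
Qed.

(** [F2] acts on pairs of integers: [a] shifts the first coordinate, and [b] shifts the second where
    the first is 0. At [(-i, 0)] the left-hand side adds [n] to the second coordinate, and the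
    right-hand side does so only if [j = i]. *)
Lemma conj_powers_distinct (i j n : nat) : (0 < n)%N ->
  (a ^- i * b ^+ n * a ^+ i = a ^- j * b ^+ n * a ^+ j)%g -> i = j.
Proof.
move=> n0.
pose act (l : 'I_2 * bool) (t : int * int) : int * int :=
  if l.1 == 0 then (if l.2 then t.1 - 1 else t.1 + 1, t.2)
  else (t.1, if t.1 == 0 then (if l.2 then t.2 - 1 else t.2 + 1) else t.2).
have actK m c t : act (m, c) (act (m, ~~ c) t) = t.
  by case: t => x y; rewrite /act /=; case: eqP => _; case: c => /=;
    rewrite ?addrK ?subrK//; case: eqP => _; rewrite ?addrK ?subrK.
have aE m (x y : int) : free_act act (a ^+ m)%g (x, y) = (x + m%:Z, y).
  elim: m x => [|m IH] x; first by rewrite expg0 free_act1// addr0.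
  rewrite expgSr free_actM// free_act_generator// [act _ _]/= IH.
  by rewrite intS addrA.
have aVE m (x y : int) : free_act act (a ^- m)%g (x, y) = (x - m%:Z, y).
  by rewrite -[X in free_act _ _ X](_ : free_act act (a ^+ m)%g (x - m%:Z, y) = _) ?free_actVK// aE subrK.
have bE m (x y : int) : free_act act (b ^+ m)%g (x, y) = (x, if x == 0 then y + m%:Z else y).
  elim: m y => [|m IH] y; first by rewrite expg0 free_act1// addr0 if_same.
  rewrite expgSr free_actM// free_act_generator// [act _ _]/= IH.
  by case: (x == 0) => //; rewrite intS addrA.
move=> /(congr1 (fun z => free_act act z (- i%:Z, 0))).
rewrite !free_actM// !aE addNr !bE eqxx !aVE => -[_].
rewrite add0r; case: eqP => [e _|_]; first lia.
by move=> e; lia.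
Qed.

(** Agreement with the identity holds only on a finite-index subgroup, so it is tested on a power of
    each conjugate [a^-s b a^s]; this is why [conj_powers_distinct] allows an exponent. *)
Lemma relabel_iso_eq1 f g (fK : cancel f g) (gK : cancel g f) :
  comm_class (relabel_iso fK gK) = 1%g -> f =1 id.
Proof.
move=> /comm_classP[K [fiK K0 _ triv]] s.
pose x := (a ^- s * b * a ^+ s)%g.
have [n n0 Kn] : exists2 n, (0 < n)%N & K (x ^+ n)%g by exact: finite_index_expg.
have conjX (h y : F2) m : ((h^-1 * y * h) ^+ m = h^-1 * y ^+ m * h)%g.
  elim: m => [|m IH]; first by rewrite !expg0 mulg1 mulVg.
  by rewrite !expgS IH !mulgA mulgK.
have x0 : degree x = 0.
  by rewrite /x !degreeM degreeV degree_aX degree_b addr0 addNr.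
have fx : rewrite_from f x 0 = (a ^- f s * b * a ^+ f s)%g.
  rewrite /x !rewrite_fromM rewrite_from_aX rewrite_from_aV rewrite_from_b degree_aX add0r.
  have com : commute (a ^+ s)%g (a ^- f s)%g by apply: commuteV; exact: commuteX2.
  by rewrite /relabel -com invgM invgK !mulgA mulVg mul1g mulgVK.
have fX m : rewrite_from f (x ^+ m)%g 0 = (rewrite_from f x 0 ^+ m)%g.
  elim: m => [|m IH]; first by rewrite !expg0 rewrite_from1.
  by rewrite !expgSr rewrite_fromM x0 addr0 IH.
have := triv _ (mem_set Kn); rewrite /= fX fx /x !conjX => /(conj_powers_distinct n0) e.
exact/val_inj.
Qed.

End Transducer.

Section Rotate.
Local Notation I9 := ('I_3 * 'I_3)%type.
Implicit Types k l : I9.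

(** The two factors rotate the blocks 0, 1, 2 and 3, 4, 5. In the second block [x] stands for
    [x - 3], which is the same modulo 3. *)
Definition rotate k (x : 'I_6) : 'I_6 :=
  inord (if (x < 3)%N then (x + k.1) %% 3 else 3 + (x + k.2) %% 3)%N.

Lemma rotateD k l x : rotate (k + l) x = rotate k (rotate l x).
Proof.
case: k l => [k k'] [l l']; rewrite /rotate /=.
have m3 n : (n %% 3 < 3)%N by rewrite ltn_mod.
have s6 n : (3 + n %% 3 < 6)%N by rewrite -[6%N]/(3 + 3)%N ltn_add2l.
have m6 n : (n %% 3 < 6)%N by exact: leq_trans (m3 n) _.
case x3: (x < 3)%N; rewrite !inordK ?m3//.
  by congr inord; rewrite modnDml modnDmr -addnA [(l + k)%N]addnC.
rewrite ltnNge leq_addr /=.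
congr inord; congr (3 + _)%N.
by rewrite modnDmr -addnA modnDl modnDml -addnA [(l' + k')%N]addnC.
Qed.

Lemma rotate0 : rotate 0 =1 id.
Proof.
move=> x; apply/val_inj; rewrite /rotate /= !addn0.
case: ifP => x3; first by rewrite modn_small// inord_val.
have xE : (x = 3 + (x - 3) :> nat)%N by rewrite subnKC// leqNgt x3.
have x33 : (x - 3 < 3)%N by have := ltn_ord x; lia.
by rewrite {1}xE modnDl modn_small// -xE inord_val.
Qed.

Lemma rotateK k : cancel (rotate k) (rotate (- k)).
Proof. by move=> x; rewrite -rotateD addNr rotate0. Qed.

Lemma rotateVK k : cancel (rotate (- k)) (rotate k).
Proof. by move=> x; rewrite -rotateD addrN rotate0. Qed.

Lemma rotate_eq_id k : rotate k =1 id -> k = 0.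
Proof.
case: k => i j e; have := congr1 val (e (inord 0)); have := congr1 val (e (inord 3)).
have [i3 j3] := (ltn_ord i, ltn_ord j).
rewrite /rotate /= !inordK//=; [|lia|lia] => e1 e2.
by congr pair; apply/val_inj => /=; lia.
Qed.

Lemma Comm_F2_Z3xZ3 : exists g : I9 -> Comm F2,
  (forall k l, g (k + l) = (g k * g l)%g) /\ (forall k, g k = 1%g -> k = 0).
Proof.
exists (fun k => comm_class (relabel_iso (rotateK k) (rotateVK k))); split=> [k l|k].
  by apply: relabel_isoM => x; exact: rotateD.
by move=> /relabel_iso_eq1/rotate_eq_id.
Qed.

End Rotate.

Theorem proposition4 : ~ isomorphic (Comm F2) (Comm Gamma2).
Proof.
move=> [f fbij]; have [g [gD gI]] := Comm_F2_Z3xZ3.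
have f1 : f 1%g = 1%g by apply: (@mulgI _ (f 1%g)); rewrite -gmulfM !mulg1.
apply: (@Comm_Gamma2_no_Z3xZ3 realalg (f \o g)) => [k l|k /=].
  by rewrite /= gD gmulfM.
by rewrite -[RHS]f1 => /(bij_inj fbij)/gI.
Qed.
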